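(* Let $(n_k)_{k\ge1}$ be a sequence of positive integers satisfying Condition $\mathbf R$. Then for every permutation $\sigma:\mathbb N\to\mathbb N$, $$N^{-1/2}\sum_{k=1}^N \cos 2\pi n_{\sigma(k)}x \xrightarrow{\ \mathcal D\ } \mathcal N(0,1/2).$$ If moreover $(n_k)_{k\ge1}$ satisfies Condition $\mathbf R^*$, then for every permutation $\sigma$, $$\limsup_{N\to\infty}\frac{\sum_{k=1}^N\cos 2\pi n_{\sigma(k)}x}{\sqrt{N\log\log N}}=1\quad\text{for a.e. }x\in[0,1].$$
   Context: Condition $\mathbf R$: for every $p\ge2$ and every fixed choice of nonzero integers $a_1,\dots,a_p$ with $|a_i|\le p$ for all $i$, the equation $a_1n_{k_1}+\dots+a_pn_{k_p}=0$ has only finitely many solutions $(k_1,\dots,k_p)$ with $k_1<k_2<\dots<k_p$. Condition $\mathbf R^*$: there are constants $C,\alpha>0$ such that for every $p\ge 2$ and every such choice of $a_1,\dots,a_p$ the number of these solutions is at most $C\exp(p^\alpha)$. Convergence in distribution and ''a.e.'' refer to the probability space $([0,1],\mathcal B,\lambda)$ with Lebesgue measure $\lambda$. *)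

(* Defs.v *)
From Stdlib Require Import Reals Lra Lia ZArith List Sorted.
Import ListNotations.
Open Scope R_scope.

(* Sequence is indexed from 0: n 0, n 1, ... (standing for n_1, n_2, ...). *)

Definition lin_comb (n : nat -> nat) (a : list Z) (ks : list nat) : Z :=
  fold_right Z.add 0%Z (map (fun ak => (fst ak * Z.of_nat (n (snd ak)))%Z) (combine a ks)).

Definition admissible_coeffs (p : nat) (a : list Z) : Prop :=
  length a = p /\ Forall (fun ai => ai <> 0%Z /\ (Z.abs ai <= Z.of_nat p)%Z) a.

Definition is_solution (n : nat -> nat) (p : nat) (a : list Z) (ks : list nat) : Prop :=
  length ks = p /\ Sorted lt ks /\ lin_comb n a ks = 0%Z.

Definition condR (n : nat -> nat) : Prop :=
  forall (p : nat) (a : list Z), (2 <= p)%nat -> admissible_coeffs p a ->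
    exists l : list (list nat), forall ks, is_solution n p a ks -> In ks l.

Definition condRstar (n : nat -> nat) : Prop :=
  exists C alpha : R, 0 < C /\ 0 < alpha /\
    forall (p : nat) (a : list Z), (2 <= p)%nat -> admissible_coeffs p a ->
      forall l : list (list nat), NoDup l -> (forall ks, In ks l -> is_solution n p a ks) ->
        INR (length l) <= C * exp (Rpower (INR p) alpha).

Definition interval_cover_sum (E : R -> Prop) (s : R) : Prop :=
  exists a b : nat -> R,
    (forall i, a i <= b i) /\
    (forall x, E x -> exists i, a i < x < b i) /\
    infinite_sum (fun i => b i - a i) s.

Definition lebesgue_outer_is (E : R -> Prop) (m : R) : Prop :=
  (forall s, interval_cover_sum E s -> m <= s) /\
  (forall eps, 0 < eps -> exists s, interval_cover_sum E s /\ s < m + eps).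

Definition null_set (E : R -> Prop) : Prop :=
  forall eps, 0 < eps -> exists s, interval_cover_sum E s /\ s < eps.

Definition normal_half_density (u : R) : R := / sqrt PI * exp (- u ^ 2).

Definition normal_half_cdf_is (t p : R) : Prop :=
  forall eps, 0 < eps -> exists M0 : R, forall M : R, M0 <= M ->
    forall pr : Riemann_integrable normal_half_density (- M) t,
      Rabs (RiemannInt pr - p) < eps.

Fixpoint psum (f : nat -> R) (N : nat) : R :=
  match N with O => 0 | S N' => psum f N' + f N' end.

Definition trig_sum (n sigma : nat -> nat) (N : nat) (x : R) : R :=
  psum (fun k => cos (2 * PI * INR (n (sigma k)) * x)) N.

Definition bijective_nat (sigma : nat -> nat) : Prop :=
  (forall i j, sigma i = sigma j -> i = j) /\ (forall m, exists i, sigma i = m).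

Definition limsup_is (u : nat -> R) (l : R) : Prop :=
  forall eps, 0 < eps ->
    (exists N0, forall N, (N0 <= N)%nat -> u N < l + eps) /\
    (forall N0, exists N, (N0 <= N)%nat /\ l - eps < u N).

(* Main.v *)
(** A relation is a vanishing integer combination of the [n k] with at most [P] terms and coefficients
    at most [P]. Concatenating [P] disjoint relations produces a solution counted by the hypothesis, so
    a maximal disjoint family of relations is finite, and under R* has size at most [exp (C P^kappa)].
    Deleting its indices leaves a set on which all mixed moments of order [P] of the cosines coincide
    with those of independent variables. This only depends on the set of the [n k], so the permutation
    is harmless.

    Hence the partial sums have nearly Gaussian moments and characteristic functions, which gives the
    CLT. For the LIL take [P] of order [log log N], so that few indices are deleted: high moments and
    dyadic chaining give the upper half. For the lower half consider the block sums [W_j] over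
    [Theta^(j-1) <= k < Theta^j], [J <= j < 2J], and test them with the nonnegative trigonometric
    polynomial [cos(theta (w - s))^(2r)], concentrated near [s], slightly below [sqrt (log J)]: the
    variables it produces are nearly uncorrelated, and Chebyshev's inequality shows that some [W_j]
    comes close to [s]. *)
Require Import Defs.
From Stdlib Require Import Reals Lra Lia ZArith List Sorted Permutation Cantor Classical ClassicalEpsilon.
From Coquelicot Require Import Coquelicot.
Import ListNotations.
Open Scope R_scope.

(** The hypothesis bounds the coefficients by the number of terms, whereas a moment of order [P] can
    produce a relation with few terms and coefficients as large as [P]. This mismatch is what forces
    relations to be concatenated in groups. All measure statements are upper bounds on outer
    measure: uniform continuity turns grid averages into such bounds, and a lower bound is obtained
    from the complement, since any open cover of [0,1] has total length at least 1. For the iterated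
    logarithm the moment order must grow, but [P] of order log log N costs at most exp (C (log log
    N)^kappa) indices, far fewer than sqrt N. The same restriction shapes the test function of the
    lower half: its frequencies are O(sqrt (log log N)), so that Taylor polynomials of degree O(log
    log N) represent it, and its values away from the peak are negligible against its Gaussian mean,
    which is at least of order J^(-(1-eps)^2). Placing the peak below sqrt (log J) makes J times
    that mean, the expected number of successful blocks, tend to infinity. *)

(** * Finite sums and averages over grids *)

Fixpoint lsum {A : Type} (f : A -> R) (l : list A) : R :=
  match l with [] => 0 | a :: l' => f a + lsum f l' end.

Lemma lsum_ext {A : Type} (f g : A -> R) (l : list A) :
  (forall a, In a l -> f a = g a) -> lsum f l = lsum g l.
Proof.
  induction l as [|a l IH]; intros H; simpl; [reflexivity|].
  rewrite H by now left. rewrite IH; [reflexivity|]. intros b Hb; apply H; now right.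
Qed.

Lemma lsum_le {A : Type} (f g : A -> R) (l : list A) :
  (forall a, In a l -> f a <= g a) -> lsum f l <= lsum g l.
Proof.
  induction l as [|a l IH]; intros H; simpl; [lra|].
  apply Rplus_le_compat; [apply H; now left|]. apply IH; intros b Hb; apply H; now right.
Qed.

Lemma lsum_plus {A : Type} (f g : A -> R) (l : list A) :
  lsum (fun a => f a + g a) l = lsum f l + lsum g l.
Proof. induction l as [|a l IH]; simpl; [ring|rewrite IH; ring]. Qed.

Lemma lsum_scal {A : Type} (c : R) (f : A -> R) (l : list A) :
  lsum (fun a => c * f a) l = c * lsum f l.
Proof. induction l as [|a l IH]; simpl; [ring|rewrite IH; ring]. Qed.

Lemma lsum_minus {A : Type} (f g : A -> R) (l : list A) :
  lsum (fun a => f a - g a) l = lsum f l - lsum g l.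
Proof. induction l as [|a l IH]; simpl; [ring|rewrite IH; ring]. Qed.

Lemma lsum_const {A : Type} (c : R) (l : list A) :
  lsum (fun _ => c) l = c * INR (length l).
Proof.
  induction l as [|a l IH]; [simpl; ring|].
  change (length (a :: l)) with (S (length l)). rewrite S_INR. simpl. rewrite IH; ring.
Qed.

Lemma lsum_zero {A : Type} (f : A -> R) (l : list A) :
  (forall a, In a l -> f a = 0) -> lsum f l = 0.
Proof.
  intros H. rewrite (lsum_ext f (fun _ => 0)) by exact H. rewrite lsum_const; ring.
Qed.

Lemma lsum_nonneg {A : Type} (f : A -> R) (l : list A) :
  (forall a, In a l -> 0 <= f a) -> 0 <= lsum f l.
Proof.
  intros H. rewrite <- (lsum_zero (fun _ : A => 0) l) by reflexivity. now apply lsum_le.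
Qed.

Lemma lsum_app {A : Type} (f : A -> R) (l l' : list A) :
  lsum f (l ++ l') = lsum f l + lsum f l'.
Proof. induction l as [|a l IH]; simpl; [ring|rewrite IH; ring]. Qed.

Lemma lsum_map {A B : Type} (f : B -> R) (h : A -> B) (l : list A) :
  lsum f (map h l) = lsum (fun a => f (h a)) l.
Proof. induction l as [|a l IH]; simpl; [ring|rewrite IH; ring]. Qed.

Lemma lsum_abs {A : Type} (f : A -> R) (l : list A) :
  Rabs (lsum f l) <= lsum (fun a => Rabs (f a)) l.
Proof.
  induction l as [|a l IH]; simpl; [rewrite Rabs_R0; lra|].
  eapply Rle_trans; [apply Rabs_triang|]. lra.
Qed.

Lemma lsum_swap {A B : Type} (f : A -> B -> R) (l : list A) (l' : list B) :
  lsum (fun a => lsum (f a) l') l = lsum (fun b => lsum (fun a => f a b) l) l'.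
Proof.
  induction l as [|a l IH]; simpl.
  - symmetry; apply lsum_zero; reflexivity.
  - rewrite IH, lsum_plus; reflexivity.
Qed.

Lemma lsum_mul {A B : Type} (f : A -> R) (g : B -> R) (l : list A) (l' : list B) :
  lsum f l * lsum g l' = lsum (fun a => lsum (fun b => f a * g b) l') l.
Proof.
  induction l as [|a l IH]; simpl; [ring|].
  rewrite lsum_scal, <- IH; ring.
Qed.

Lemma lsum_pick {A : Type} (f : A -> R) (l : list A) (a : A) :
  (forall b, In b l -> 0 <= f b) -> In a l -> f a <= lsum f l.
Proof.
  induction l as [|b l IH]; intros H Ha; [contradiction|]. simpl.
  assert (0 <= f b) by (apply H; now left).
  assert (0 <= lsum f l) by (apply lsum_nonneg; intros; apply H; now right).
  destruct Ha as [->|Ha]; [lra|].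
  assert (f a <= lsum f l) by (apply IH; [intros; apply H; now right|assumption]). lra.
Qed.

Lemma lsum_filter_split {A : Type} (f : A -> R) (p : A -> bool) (l : list A) :
  lsum f l = lsum f (filter p l) + lsum f (filter (fun a => negb (p a)) l).
Proof.
  induction l as [|a l IH]; simpl; [ring|].
  destruct (p a); simpl; rewrite IH; ring.
Qed.

Lemma lsum_seq_S (f : nat -> R) (a n : nat) :
  lsum f (seq a (S n)) = lsum f (seq a n) + f (a + n)%nat.
Proof. rewrite seq_S, lsum_app; simpl; ring. Qed.

Lemma lsum_seq_shift (f : nat -> R) (a n : nat) :
  lsum f (seq (S a) n) = lsum (fun i => f (S i)) (seq a n).
Proof. rewrite <- seq_shift, lsum_map; reflexivity. Qed.

Lemma psum_lsum (f : nat -> R) (N : nat) : psum f N = lsum f (seq 0 N).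
Proof. induction N as [|N IH]; [reflexivity|]. rewrite lsum_seq_S, <- IH; reflexivity. Qed.

Lemma lsum_continuity_pt {A : Type} (f : A -> R -> R) (l : list A) (x : R) :
  (forall a, In a l -> continuity_pt (f a) x) ->
  continuity_pt (fun y => lsum (fun a => f a y) l) x.
Proof.
  induction l as [|a l IH]; intros H; simpl.
  - apply continuity_pt_const; intros ? ?; reflexivity.
  - apply (continuity_pt_plus (f a)); [apply H; now left|].
    apply IH; intros b Hb; apply H; now right.
Qed.

(** Averages over the grid [i/Q], [i < Q], play the role of integrals over [[0,1]]: for [Q] large
    they agree exactly with the integral on trigonometric polynomials. *)
Definition avg (Q : nat) (f : R -> R) : R :=
  lsum (fun i => f (INR i / INR Q)) (seq 0 Q) / INR Q.

Lemma avg_ext (Q : nat) (f g : R -> R) : (forall x, f x = g x) -> avg Q f = avg Q g.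
Proof. intros H; unfold avg; f_equal. apply lsum_ext; intros; apply H. Qed.

Lemma avg_plus (Q : nat) (f g : R -> R) : avg Q (fun x => f x + g x) = avg Q f + avg Q g.
Proof.
  unfold avg.
  rewrite (lsum_plus (fun i => f (INR i / INR Q)) (fun i => g (INR i / INR Q))).
  unfold Rdiv; ring.
Qed.

Lemma avg_scal (Q : nat) (c : R) (f : R -> R) : avg Q (fun x => c * f x) = c * avg Q f.
Proof.
  unfold avg. rewrite (lsum_scal c (fun i => f (INR i / INR Q))). unfold Rdiv; ring.
Qed.

Lemma avg_minus (Q : nat) (f g : R -> R) : avg Q (fun x => f x - g x) = avg Q f - avg Q g.
Proof.
  unfold avg.
  rewrite (lsum_minus (fun i => f (INR i / INR Q)) (fun i => g (INR i / INR Q))).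
  unfold Rdiv; ring.
Qed.

Lemma avg_const (Q : nat) (c : R) : (0 < Q)%nat -> avg Q (fun _ => c) = c.
Proof.
  intros HQ. unfold avg. rewrite lsum_const, length_seq. field.
  apply not_0_INR; lia.
Qed.

Lemma avg_lsum {A : Type} (Q : nat) (f : A -> R -> R) (l : list A) :
  avg Q (fun x => lsum (fun a => f a x) l) = lsum (fun a => avg Q (f a)) l.
Proof.
  unfold avg. rewrite lsum_swap. unfold Rdiv.
  rewrite Rmult_comm, <- lsum_scal. apply lsum_ext; intros; ring.
Qed.

Lemma avg_le (Q : nat) (f g : R -> R) :
  (0 < Q)%nat -> (forall x, 0 <= x <= 1 -> f x <= g x) -> avg Q f <= avg Q g.
Proof.
  intros HQ H. assert (HQ' : 0 < INR Q) by (apply lt_0_INR; lia). unfold avg, Rdiv.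
  apply Rmult_le_compat_r; [left; now apply Rinv_0_lt_compat|].
  apply lsum_le. intros i Hi. apply in_seq in Hi. apply H. split.
  - apply Rle_div_r; [assumption|]. rewrite Rmult_0_l; apply pos_INR.
  - apply Rle_div_l; [assumption|]. rewrite Rmult_1_l; apply le_INR; lia.
Qed.

Lemma avg_nonneg (Q : nat) (f : R -> R) :
  (0 < Q)%nat -> (forall x, 0 <= x <= 1 -> 0 <= f x) -> 0 <= avg Q f.
Proof.
  intros HQ H. rewrite <- (avg_const Q 0 HQ). now apply avg_le.
Qed.

Lemma avg_abs (Q : nat) (f : R -> R) :
  (0 < Q)%nat -> Rabs (avg Q f) <= avg Q (fun x => Rabs (f x)).
Proof.
  intros HQ. apply Rabs_le. split.
  - assert (H : avg Q (fun x => (-1) * Rabs (f x)) <= avg Q f).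
    { apply avg_le; [assumption|]. intros x _. generalize (Rle_abs (- f x)).
      rewrite Rabs_Ropp. lra. }
    rewrite avg_scal in H. lra.
  - apply avg_le; [assumption|]. intros x _. apply Rle_abs.
Qed.

(** Multiplying by [2 * sin (h / 2)] turns each cosine into a difference of sines at consecutive
    half-integer multiples of [h], so the sum telescopes as for the Dirichlet kernel. *)
Lemma lsum_cos_telescope (h : R) (N : nat) :
  2 * sin (h / 2) * lsum (fun i => cos (h * INR i)) (seq 0 N)
  = sin (h * INR N - h / 2) + sin (h / 2).
Proof.
  induction N as [|N IH].
  - simpl. replace (h * 0 - h / 2) with (- (h / 2)) by ring. rewrite sin_neg. ring.
  - rewrite lsum_seq_S, Rmult_plus_distr_l, IH. rewrite S_INR, Nat.add_0_l.
    replace (h * (INR N + 1) - h / 2) with (h * INR N + h / 2) by field.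
    rewrite sin_plus, sin_minus. ring.
Qed.

(** With [h = 2 * PI * v / Q] the two ends of the telescoped sum differ by the full period
    [2 * PI * v], and [sin (h / 2)] is nonzero because [0 < |v| < Q]. This orthogonality is why grid
    averages are exact. *)
Lemma avg_cos (Q : nat) (v : Z) :
  (0 < Q)%nat -> (v <> 0)%Z -> (Z.abs v < Z.of_nat Q)%Z ->
  avg Q (fun x => cos (2 * PI * IZR v * x)) = 0.
Proof.
  intros HQ Hv HvQ. assert (HQ' : 0 < INR Q) by (apply lt_0_INR; lia).
  set (h := 2 * PI * IZR v / INR Q). unfold avg.
  rewrite (lsum_ext _ (fun i => cos (h * INR i)))
    by (intros i _; f_equal; unfold h; field; lra).
  assert (Hs : sin (h / 2) <> 0).
  { assert (Hh : h / 2 = PI * (IZR v / INR Q)) by (unfold h; field; lra).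
    rewrite Hh. assert (HP := PI_RGT_0).
    rewrite INR_IZR_INZ in *. set (q := IZR (Z.of_nat Q)) in *.
    destruct (Z_lt_le_dec v 0) as [Hneg|Hpos].
    - assert (IZR v < 0) by (apply IZR_lt; lia).
      assert (- IZR v < q) by (rewrite <- opp_IZR; apply IZR_lt; lia).
      assert (0 < - IZR v / q) by (apply Rdiv_lt_0_compat; lra).
      assert (- IZR v / q < 1) by (apply Rlt_div_l; lra).
      replace (PI * (IZR v / q)) with (- (PI * (- IZR v / q))) by (field; lra).
      rewrite sin_neg. assert (0 < sin (PI * (- IZR v / q))); [|lra].
      apply sin_gt_0; nra.
    - assert (0 < IZR v) by (apply IZR_lt; lia).
      assert (IZR v < q) by (apply IZR_lt; lia).
      assert (0 < IZR v / q) by (apply Rdiv_lt_0_compat; lra).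
      assert (IZR v / q < 1) by (apply Rlt_div_l; lra).
      assert (0 < sin (PI * (IZR v / q))); [|lra].
      apply sin_gt_0; nra. }
  assert (Ht := lsum_cos_telescope h Q).
  replace (h * INR Q - h / 2) with (- (h / 2) + 2 * IZR v * PI) in Ht
    by (unfold h; field; lra).
  (* [sin_period] takes natural multiples of the period, so for negative [v] the other side is
     shifted. *)
  assert (Hper : forall y, sin (y + 2 * IZR v * PI) = sin y).
  { intros y. destruct (Z_lt_le_dec v 0) as [Hneg|Hpos].
    - rewrite <- (sin_period (y + 2 * IZR v * PI) (Z.to_nat (- v))).
      rewrite INR_IZR_INZ, Z2Nat.id, opp_IZR by lia. f_equal; ring.
    - rewrite <- (sin_period y (Z.to_nat v)).
      rewrite INR_IZR_INZ, Z2Nat.id by lia. f_equal; ring. }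
  rewrite Hper, sin_neg in Ht.
  assert (H0 : lsum (fun i => cos (h * INR i)) (seq 0 Q) = 0).
  { apply (Rmult_eq_reg_l (2 * sin (h / 2))); [|lra]. rewrite Ht; ring. }
  rewrite H0. unfold Rdiv; ring.
Qed.

Lemma exp_le_compat (x y : R) : x <= y -> exp x <= exp y.
Proof. intros [H| ->]; [left; now apply exp_increasing|lra]. Qed.

Lemma exp_mult_INR (x : R) (m : nat) : exp (x * INR m) = exp x ^ m.
Proof.
  induction m as [|m IH]; [simpl; rewrite Rmult_0_r; apply exp_0|].
  rewrite S_INR, Rmult_plus_distr_l, exp_plus, IH, Rmult_1_r. simpl; ring.
Qed.

Lemma le_exp (x : R) : x <= exp x.
Proof. generalize (exp_ineq1_le x); lra. Qed.

(** * Relations and their hitting sets *)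

Definition relsum (n : nat -> nat) (r : list (Z * nat)) : Z :=
  fold_right Z.add 0%Z (map (fun ak => (fst ak * Z.of_nat (n (snd ak)))%Z) r).

(** The coefficients are bounded by [P] and not by the number of terms, and the indices need not be
    sorted. Such relations are what can spoil the independence of moments of order [P], but a single
    one need not be an instance counted by [condR]. *)
Definition is_rel (n : nat -> nat) (P : nat) (r : list (Z * nat)) : Prop :=
  r <> [] /\ (length r <= P)%nat /\ NoDup (map snd r) /\
  List.Forall (fun ak => fst ak <> 0%Z /\ (Z.abs (fst ak) <= Z.of_nat P)%Z) r /\ relsum n r = 0%Z.

(** [B] is the set to be deleted: no relation survives on its complement. *)
Definition hits (n : nat -> nat) (P : nat) (B : list nat) : Prop :=
  forall r, is_rel n P r -> exists k, In k (map snd r) /\ In k B.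

Lemma relsum_app (n : nat -> nat) (r s : list (Z * nat)) :
  relsum n (r ++ s) = (relsum n r + relsum n s)%Z.
Proof. unfold relsum. induction r as [|a r IH]; simpl; [lia|rewrite IH; lia]. Qed.

Lemma relsum_perm (n : nat -> nat) (r s : list (Z * nat)) :
  Permutation r s -> relsum n r = relsum n s.
Proof. unfold relsum. induction 1; simpl; lia. Qed.

(** Insertion sort by index. Solutions are counted as strictly increasing index tuples, while
    concatenated relations come in arbitrary order. *)
Lemma exists_sorted_by_index (r : list (Z * nat)) :
  NoDup (map snd r) ->
  exists s, Permutation r s /\ StronglySorted lt (map snd s).
Proof.
  assert (Hins : forall (x : Z * nat) s, StronglySorted lt (map snd s) -> ~ In (snd x) (map snd s) ->
            exists s', Permutation (x :: s) s' /\ StronglySorted lt (map snd s')).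
  { intros x s; induction s as [|y s IH]; simpl; intros Hs Hx.
    - exists [x]; split; [reflexivity|]. repeat constructor.
    - inversion Hs as [|? ? Hs' Hy]; subst.
      destruct (le_lt_dec (snd y) (snd x)) as [Hle|Hlt].
      + destruct IH as [s' [Hp Hs2]]; [assumption|tauto|].
        exists (y :: s'); split.
        * rewrite perm_swap. now constructor.
        * simpl; constructor; [assumption|].
          rewrite Forall_forall in *. intros k Hk.
          apply (Permutation_in k (Permutation_sym (Permutation_map snd Hp))) in Hk.
          simpl in Hk. destruct Hk as [<-|Hk]; [|now apply Hy].
          assert (snd y <> snd x) by tauto. lia.
      + exists (x :: y :: s); split; [reflexivity|]. simpl. constructor; [assumption|].
        constructor; [assumption|]. rewrite Forall_forall in *. intros k Hk.
        specialize (Hy k Hk). lia. }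
  induction r as [|x r IH]; simpl; intros Hnd.
  - exists []; split; [reflexivity|constructor].
  - inversion Hnd as [|? ? Hx Hnd']; subst. destruct (IH Hnd') as [s [Hp Hs]].
    destruct (Hins x s Hs) as [s' [Hp' Hs']].
    + intros Hin; apply Hx.
      apply (Permutation_in _ (Permutation_sym (Permutation_map snd Hp))); assumption.
    + exists s'; split; [|assumption]. rewrite <- Hp'. now constructor.
Qed.

Lemma combine_fst_snd (r : list (Z * nat)) : combine (map fst r) (map snd r) = r.
Proof. induction r as [|[a k] r IH]; simpl; [|rewrite IH]; reflexivity. Qed.

(** Words of length at most [m], not exactly [m]: the number of terms in a group of [P] relations is
    only known to lie between [P] and [P * P]. *)
Fixpoint words (A : list Z) (m : nat) : list (list Z) :=
  match m with
  | O => [[]]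
  | S m' => [] :: flat_map (fun a => map (cons a) (words A m')) A
  end.

Lemma words_complete (A : list Z) (m : nat) (w : list Z) :
  (length w <= m)%nat -> (forall a, In a w -> In a A) -> In w (words A m).
Proof.
  revert w; induction m as [|m IH]; intros w Hl HA.
  - destruct w; simpl in *; [now left|lia].
  - destruct w as [|a w]; simpl; [now left|right].
    apply in_flat_map. exists a; split; [apply HA; now left|].
    apply in_map, IH; [simpl in Hl; lia|]. intros; apply HA; now right.
Qed.

Lemma words_length (A : list Z) (m : nat) : (length (words A m) <= (length A + 1) ^ m)%nat.
Proof.
  induction m as [|m IH]; [simpl; lia|].
  assert (H : forall A', length (flat_map (fun a => map (cons a) (words A m)) A')
              = (length A' * length (words A m))%nat).
  { induction A' as [|a A' IH']; [reflexivity|].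
    simpl. rewrite length_app, length_map, IH'. lia. }
  simpl. rewrite H.
  assert (1 <= (length A + 1) ^ m)%nat by (apply Nat.neq_0_lt_0, Nat.pow_nonzero; lia).
  nia.
Qed.

Definition coeff_range (P : nat) : list Z :=
  map (fun i => (Z.of_nat i - Z.of_nat P)%Z) (seq 0 (2 * P + 1)).

Lemma coeff_range_complete (P : nat) (a : Z) :
  (Z.abs a <= Z.of_nat P)%Z -> In a (coeff_range P).
Proof.
  intros H. apply in_map_iff. exists (Z.to_nat (a + Z.of_nat P)). split; [lia|].
  apply in_seq. lia.
Qed.

(** Pigeonhole principle, peeling off one fibre at a time. It separates the count of coefficient
    vectors from the count of solutions with a given vector. *)
Lemma fibre_count {X Y : Type} (eqd : forall a b : Y, {a = b} + {a <> b})
    (f : X -> Y) (A : list Y) (b : nat) (L : list X) :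
  (forall x, In x L -> In (f x) A) ->
  (forall y, In y A -> (length (filter (fun x => if eqd (f x) y then true else false) L) <= b)%nat) ->
  (length L <= length A * b)%nat.
Proof.
  revert L; induction A as [|y A IH]; intros L HA Hb.
  - destruct L as [|x L]; [simpl; lia|]. exfalso. apply (HA x); now left.
  - set (p := fun x => if eqd (f x) y then true else false).
    rewrite <- (filter_length p L).
    assert (H1 := Hb y (or_introl eq_refl)). fold p in H1.
    assert (H2 : (length (filter (fun x => negb (p x)) L) <= length A * b)%nat).
    { apply IH.
      - intros x Hx. apply filter_In in Hx. destruct Hx as [Hx Hp].
        unfold p in Hp. destruct (HA x Hx) as [->|H]; [|assumption].
        destruct (eqd (f x) (f x)); [discriminate|congruence].
      - intros z Hz. eapply Nat.le_trans; [|apply (Hb z); now right].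
        clear. induction L as [|x L IH]; [simpl; lia|].
        simpl. destruct (p x); simpl; destruct (eqd (f x) z); simpl; lia. }
    simpl. lia.
Qed.

Definition disjoint_family (rs : list (list (Z * nat))) : Prop :=
  NoDup (flat_map (map snd) rs).

Lemma NoDup_app_parts {X : Type} (l l' : list X) :
  NoDup (l ++ l') -> NoDup l /\ NoDup l' /\ (forall x, In x l -> ~ In x l').
Proof.
  induction l as [|a l IH]; simpl; intros H.
  - repeat split; [constructor|assumption|tauto].
  - inversion H as [|? ? Ha H']; subst. destruct (IH H') as [H1 [H2 H3]].
    rewrite in_app_iff in Ha. repeat split; [constructor; tauto|assumption|].
    intros x [<-|Hx]; [tauto|now apply H3].
Qed.

Lemma concat_relations (n : nat -> nat) (P : nat) (rs : list (list (Z * nat))) :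
  (forall r, In r rs -> is_rel n P r) ->
  (length rs <= length (concat rs) <= length rs * P)%nat /\
  List.Forall (fun ak => fst ak <> 0%Z /\ (Z.abs (fst ak) <= Z.of_nat P)%Z) (concat rs) /\
  relsum n (concat rs) = 0%Z /\
  map snd (concat rs) = flat_map (map snd) rs.
Proof.
  induction rs as [|r rs IH]; intros H; simpl.
  - repeat split; try lia; constructor.
  - destruct IH as [H1 [H2 [H3 H4]]]; [intros; apply H; now right|].
    destruct (H r (or_introl eq_refl)) as [Hr1 [Hr2 [_ [Hr4 Hr5]]]].
    assert (length r <> 0)%nat by (destruct r; simpl; congruence).
    rewrite length_app, relsum_app, map_app, H4. repeat split; try lia.
    now apply Forall_app.
Qed.

(* Concatenating [P] disjoint relations turns few terms with large coefficients into at least [P]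
   terms with coefficients at most [P], the kind of solution which the hypothesis counts. *)
Lemma grouped_solutions (n : nat -> nat) (P G : nat) (rs : list (list (Z * nat))) :
  (forall r, In r rs -> is_rel n P r) -> disjoint_family rs -> (1 <= P)%nat ->
  (G * P <= length rs)%nat ->
  exists gs : list (list (Z * nat)), length gs = G /\
    (forall g, In g gs -> (P <= length g <= P * P)%nat /\
       admissible_coeffs (length g) (map fst g) /\
       In (map fst g) (words (coeff_range P) (P * P)) /\
       is_solution n (length g) (map fst g) (map snd g)) /\
    NoDup (map (map snd) gs) /\
    (forall g k, In g gs -> In k (map snd g) -> In k (flat_map (map snd) rs)).
Proof.
  revert rs; induction G as [|G IH]; intros rs Hrel Hdis HP Hlen.
  - exists []. repeat split; simpl; try tauto. constructor.
  - rewrite <- (firstn_skipn P rs) in Hdis.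
    unfold disjoint_family in Hdis. rewrite flat_map_app in Hdis.
    apply NoDup_app_parts in Hdis. destruct Hdis as [Hd1 [Hd2 Hd3]].
    assert (Hin1 : forall r, In r (firstn P rs) -> In r rs)
      by (intros r Hr; rewrite <- (firstn_skipn P rs); apply in_or_app; now left).
    assert (Hin2 : forall r, In r (skipn P rs) -> In r rs)
      by (intros r Hr; rewrite <- (firstn_skipn P rs); apply in_or_app; now right).
    destruct (IH (skipn P rs)) as [gs [Hg1 [Hg2 [Hg3 Hg4]]]];
      [intros; apply Hrel; auto|assumption|assumption|rewrite length_skipn; lia|].
    destruct (concat_relations n P (firstn P rs)) as [H1 [H2 [H3 H4]]];
      [intros; apply Hrel; auto|].
    assert (Hl : length (firstn P rs) = P) by (rewrite length_firstn; lia).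
    rewrite Hl in H1.
    destruct (exists_sorted_by_index (concat (firstn P rs))) as [s [Hp Hs]];
      [rewrite H4; assumption|].
    assert (Hls := Permutation_length Hp).
    assert (HsF : List.Forall (fun ak => fst ak <> 0%Z /\ (Z.abs (fst ak) <= Z.of_nat P)%Z) s)
      by (eapply Permutation_Forall; eassumption).
    assert (Hks : forall k, In k (map snd s) <-> In k (flat_map (map snd) (firstn P rs))).
    { intros k. rewrite <- H4. split; intros Hk.
      - eapply Permutation_in; [apply Permutation_map; symmetry; eassumption|assumption].
      - eapply Permutation_in; [apply Permutation_map; eassumption|assumption]. }
    exists (s :: gs). repeat split.
    + simpl; lia.
    + destruct H as [<-|Hg]; [lia|apply Hg2; assumption].
    + destruct H as [<-|Hg]; [lia|apply Hg2; assumption].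
    + now rewrite length_map.
    + destruct H as [<-|Hg]; [|apply Hg2; assumption].
      rewrite Forall_map. eapply Forall_impl; [|exact HsF].
      intros [a k]; simpl; lia.
    + destruct H as [<-|Hg]; [|apply Hg2; assumption].
      apply words_complete; [rewrite length_map; lia|].
      intros a Ha. apply coeff_range_complete. apply in_map_iff in Ha.
      destruct Ha as [ak [<- Hak]]. rewrite Forall_forall in HsF. now apply HsF.
    + now rewrite length_map.
    + destruct H as [<-|Hg]; [|apply Hg2; assumption].
      now apply StronglySorted_Sorted.
    + destruct H as [<-|Hg]; [|apply Hg2; assumption].
      unfold lin_comb. rewrite combine_fst_snd. fold (relsum n s).
      rewrite <- (relsum_perm _ _ _ Hp). assumption.
    (* The index lists are distinct because each is nonempty and supported on its own group of
       disjoint relations. *)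
    + simpl. constructor; [|assumption]. intros Hbad. apply in_map_iff in Hbad.
      destruct Hbad as [g [Hgs Hg]].
      assert (Hne : map snd s <> []).
      { intros E. apply (f_equal (@length nat)) in E. rewrite length_map in E. simpl in E. lia. }
      destruct (map snd s) as [|k ks] eqn:E; [congruence|].
      assert (Hk1 : In k (flat_map (map snd) (firstn P rs))) by (apply Hks; now left).
      apply (Hd3 k Hk1), (Hg4 g); [assumption|]. rewrite Hgs; now left.
    + intros g k [<-|Hg] Hk.
      * apply Hks in Hk. apply in_flat_map in Hk. destruct Hk as [r [Hr Hk]].
        apply in_flat_map. exists r; auto.
      * specialize (Hg4 g k Hg Hk). apply in_flat_map in Hg4. destruct Hg4 as [r [Hr Hk']].
        apply in_flat_map. exists r; auto.
Qed.

Definition solution_bound (n : nat -> nat) (P b : nat) : Prop :=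
  forall p a, (2 <= p <= P)%nat -> admissible_coeffs p a ->
    forall l, NoDup l -> (forall ks, In ks l -> is_solution n p a ks) -> (length l <= b)%nat.

Lemma NoDup_map_filter {X Y : Type} (f : X -> Y) (p : X -> bool) (l : list X) :
  NoDup (map f l) -> NoDup (map f (filter p l)).
Proof.
  induction l as [|a l IH]; simpl; intros H; [constructor|].
  inversion H as [|? ? Ha H']; subst. destruct (p a); simpl; [|auto].
  constructor; [|auto]. intros Hin; apply Ha. apply in_map_iff in Hin.
  destruct Hin as [x [<- Hx]]. apply filter_In in Hx. apply in_map; tauto.
Qed.

(** Grouping the relations by [P] yields solutions whose coefficient word is one of at most
    [(2 * P + 2) ^ (P * P)], and each word occurs at most [b] times. One group more than this
    product allows gives the contradiction. *)
Lemma disjoint_family_bound (n : nat -> nat) (P b : nat) (rs : list (list (Z * nat))) :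
  (2 <= P)%nat -> solution_bound n (P * P) b ->
  (forall r, In r rs -> is_rel n P r) -> disjoint_family rs ->
  (length rs <= ((2 * P + 2) ^ (P * P) * b + 1) * P)%nat.
Proof.
  intros HP Hb Hrel Hdis.
  destruct (le_lt_dec (length rs) (((2 * P + 2) ^ (P * P) * b + 1) * P)) as [H|H]; [assumption|].
  exfalso.
  destruct (grouped_solutions n P ((2 * P + 2) ^ (P * P) * b + 1) rs)
    as [gs [H1 [H2 [H3 _]]]]; [assumption|assumption|lia|lia|].
  assert (Hc : (length gs <= length (words (coeff_range P) (P * P)) * b)%nat).
  { apply (fibre_count (list_eq_dec Z.eq_dec) (map fst)).
    - intros g Hg; now apply H2.
    - intros a _.
      set (F := filter _ gs).
      assert (HF : forall g, In g F -> In g gs /\ map fst g = a).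
      { intros g Hg. apply filter_In in Hg. destruct Hg as [Hg He]. split; [assumption|].
        destruct (list_eq_dec Z.eq_dec (map fst g) a); [assumption|discriminate]. }
      destruct F as [|g0 F'] eqn:EF; [simpl; lia|].
      destruct (HF g0 (or_introl eq_refl)) as [Hg0 Ha].
      (* Within a fibre the coefficients agree, so the groups are counted through their distinct
         index lists. *)
      rewrite <- (length_map (map snd)).
      destruct (H2 g0 Hg0) as [Hl [Had _]]. rewrite Ha in Had.
      apply (Hb (length g0) a).
      + lia.
      + assumption.
      + rewrite <- EF. now apply NoDup_map_filter.
      + intros ks Hks. apply in_map_iff in Hks. destruct Hks as [g [<- Hg]].
        destruct (HF g Hg) as [Hg1 Hg2].
        destruct (H2 g Hg1) as [_ [_ [_ Hsol]]].
        assert (length g = length g0) as <-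
          by (rewrite <- (length_map fst g), <- (length_map fst g0); congruence).
        rewrite <- Hg2. assumption. }
  assert (Hw := words_length (coeff_range P) (P * P)).
  unfold coeff_range in Hw at 2. rewrite length_map, length_seq in Hw.
  replace (2 * P + 1 + 1)%nat with (2 * P + 2)%nat in Hw by lia. nia.
Qed.

(* The union of a maximal disjoint family of relations meets every relation. *)
Lemma hitting_set (n : nat -> nat) (P b : nat) :
  (2 <= P)%nat -> solution_bound n (P * P) b ->
  exists B, (length B <= P * (((2 * P + 2) ^ (P * P) * b + 1) * P))%nat /\ hits n P B.
Proof.
  intros HP Hb. set (D := (((2 * P + 2) ^ (P * P) * b + 1) * P)%nat).
  (* [fuel] counts how many relations may still be added. A disjoint family of [S D] members
     contradicts the bound, so the greedy extension stops earlier, at a family whose indices meet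
     every relation. *)
  assert (Hgrow : forall fuel rs, (length rs + fuel = S D)%nat ->
            (forall r, In r rs -> is_rel n P r) -> disjoint_family rs ->
            exists B, (length B <= P * D)%nat /\ hits n P B).
  { induction fuel as [|fuel IH]; intros rs Hl Hrel Hdis.
    - assert (H := disjoint_family_bound n P b rs HP Hb Hrel Hdis). fold D in H. lia.
    - destruct (classic (hits n P (flat_map (map snd) rs))) as [Hh|Hh].
      + exists (flat_map (map snd) rs). split; [|assumption].
        assert (Hle : (length (flat_map (map snd) rs) <= P * length rs)%nat).
        { clear - Hrel. induction rs as [|r rs IH]; [simpl; lia|].
          destruct (Hrel r (or_introl eq_refl)) as [_ [Hr _]].
          change (flat_map (map snd) (r :: rs)) with (map snd r ++ flat_map (map snd) rs).
          change (length (r :: rs)) with (S (length rs)).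
          rewrite length_app, length_map.
          assert (length (flat_map (map snd) rs) <= P * length rs)%nat
            by (apply IH; intros; apply Hrel; now right). nia. }
        nia.
      + apply not_all_ex_not in Hh. destruct Hh as [r Hr].
        apply imply_to_and in Hr. destruct Hr as [Hr Hno].
        apply (IH (r :: rs)).
        * simpl; lia.
        * intros s [<-|Hs]; auto.
        * unfold disjoint_family; simpl. apply NoDup_app; [apply Hr|assumption|].
          intros k Hk Hk'. apply Hno. exists k; auto. }
  apply (Hgrow (S D) []); [reflexivity|simpl; tauto|constructor].
Qed.

(** Finiteness for each coefficient vector becomes a uniform bound because only finitely many
    vectors have length and entries at most [P * P]. *)
Lemma condR_hitting (n : nat -> nat) (P : nat) :
  condR n -> (2 <= P)%nat -> exists B, hits n P B.
Proof.
  intros hR HP.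
  assert (Hw : forall A, exists b, forall a, In a A -> (2 <= length a)%nat ->
            admissible_coeffs (length a) a ->
            forall l, NoDup l -> (forall ks, In ks l -> is_solution n (length a) a ks) ->
            (length l <= b)%nat).
  { induction A as [|a A [b IH]]; [exists 0%nat; simpl; tauto|].
    destruct (classic ((2 <= length a)%nat /\ admissible_coeffs (length a) a)) as [[H1 H2]|H].
    - destruct (hR _ _ H1 H2) as [L HL]. exists (Nat.max (length L) b).
      intros a' [<-|Ha'] H1' H2' l Hnd Hl.
      + assert (length l <= length L)%nat; [|lia].
        apply NoDup_incl_length; [assumption|]. intros ks Hks; apply HL, Hl, Hks.
      + specialize (IH a' Ha' H1' H2' l Hnd Hl). lia.
    - exists b. intros a' [<-|Ha'] H1' H2'; [tauto|]. now apply IH. }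
  destruct (Hw (words (coeff_range (P * P)) (P * P))) as [b Hb].
  destruct (hitting_set n P b HP) as [B [_ HB]]; [|exists B; exact HB].
  intros p a Hp Ha l Hnd Hl. destruct Ha as [Hla HFa]. subst p.
  apply (Hb a); try assumption; try lia.
  - apply words_complete; [lia|]. intros c Hc. apply coeff_range_complete.
    rewrite Forall_forall in HFa. specialize (HFa c Hc). lia.
  - split; [reflexivity|assumption].
Qed.

(** Groups have up to [P ^ 2] terms, so the counting hypothesis contributes [exp (P ^ (2 * alpha))],
    while the number of coefficient words is at most [exp (3 * P ^ 3)]. *)
Lemma condRstar_hitting (n : nat -> nat) :
  condRstar n ->
  exists (C : R) (kappa : nat), 0 < C /\
    forall P, (2 <= P)%nat ->
      exists B, hits n P B /\ INR (length B) <= exp (C * INR P ^ kappa).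
Proof.
  intros [C [alpha [HC [Halpha H]]]].
  destruct (INR_unbounded (2 * alpha)) as [k0 Hk0].
  (* The exponent is at least [2 * alpha], for the solution count, and at least 3, for the count of
     words. The added 8 absorbs the polynomial factors and the remaining constants. *)
  set (k := (k0 + 3)%nat). exists (C + 8), k. split; [lra|]. intros P HP.
  assert (HP2 : 2 <= INR P) by (change 2 with (INR 2); now apply le_INR).
  set (E := exp (INR P ^ k)).
  assert (HE : 1 <= E).
  { unfold E. rewrite <- exp_0. apply exp_le_compat. apply pow_le; lra. }
  assert (HCE : 0 <= C * E) by nra.
  destruct (nfloor_ex (C * E) HCE) as [b [Hb1 Hb2]].
  destruct (hitting_set n P b HP) as [B [HB1 HB2]].
  - intros p a Hp Ha l Hnd Hl.
    apply INR_le. assert (Hx := H p a (proj1 Hp) Ha l Hnd Hl).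
    assert (Hpow : Rpower (INR p) alpha <= INR P ^ k).
    { assert (Hp2 : 2 <= INR p) by (change 2 with (INR 2); apply le_INR; lia).
      assert (HpP : INR p <= INR P * INR P) by (rewrite <- mult_INR; apply le_INR; lia).
      apply Rle_trans with (Rpower (INR P * INR P) alpha).
      - apply Rle_Rpower_l; lra.
      - rewrite <- Rpower_mult_distr by lra. rewrite <- Rpower_plus.
        rewrite <- Rpower_pow by lra. apply Rle_Rpower; [lra|].
        unfold k. rewrite plus_INR. simpl. lra. }
    assert (HxE : INR (length l) <= C * E).
    { eapply Rle_trans; [exact Hx|]. apply Rmult_le_compat_l; [lra|]. now apply exp_le_compat. }
    assert (INR (length l) < INR (b + 1)) by (rewrite plus_INR; simpl; lra).
    apply INR_lt in H0. apply le_INR; lia.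
  - exists B. split; [assumption|].
    apply le_INR in HB1. eapply Rle_trans; [exact HB1|].
    rewrite !mult_INR, plus_INR, !mult_INR, pow_INR, plus_INR, !mult_INR.
    change (INR 1) with 1. change (INR 2) with 2.
    set (p := INR P) in *.
    assert (Hp3 : p ^ 3 <= p ^ k) by (apply Rle_pow; [lra|unfold k; lia]).
    assert (Hpp : p <= exp p) by apply le_exp.
    assert (H2p : (2 * p + 2) ^ (P * P) <= exp (3 * p ^ 3)).
    { replace (3 * p ^ 3) with ((3 * p) * INR (P * P)) by (rewrite mult_INR; unfold p; ring).
      rewrite exp_mult_INR. apply pow_incr. split; [lra|].
      generalize (le_exp (3 * p)); lra. }
    assert (Hb3 : INR b <= exp C * E).
    { apply Rle_trans with (C * E); [assumption|]. generalize (le_exp C); nra. }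
    assert (HeC : 1 <= exp C) by (rewrite <- exp_0; apply exp_le_compat; lra).
    set (X := (2 * p + 2) ^ (P * P)) in *.
    assert (HX0 : 0 <= X) by (apply pow_le; lra).
    assert (HXb : X * INR b + 1 <= 2 * (exp (3 * p ^ 3) * (exp C * E))).
    { assert (X * INR b <= exp (3 * p ^ 3) * (exp C * E))
        by (apply Rmult_le_compat; [assumption|apply pos_INR|assumption|assumption]).
      assert (1 <= exp (3 * p ^ 3)).
      { rewrite <- exp_0; apply exp_le_compat. assert (0 <= p ^ 3) by (apply pow_le; lra). lra. }
      assert (1 <= exp C * E) by nra. nra. }
    apply Rle_trans with (exp p * (exp 1 * (exp (3 * p ^ 3) * (exp C * E)) * exp p)).
    + assert (2 <= exp 1) by (generalize (exp_ineq1_le 1); lra).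
      assert (0 < exp (3 * p ^ 3) * (exp C * E)).
      { apply Rmult_lt_0_compat; [apply exp_pos|]. apply Rmult_lt_0_compat; [apply exp_pos|lra]. }
      assert (0 <= X * INR b) by (apply Rmult_le_pos; [assumption|apply pos_INR]).
      assert (X * INR b + 1 <= exp 1 * (exp (3 * p ^ 3) * (exp C * E))) by nra.
      apply Rmult_le_compat; [lra| |assumption|].
      * apply Rmult_le_pos; lra.
      * apply Rmult_le_compat; lra.
    + unfold E. rewrite <- !exp_plus. apply exp_le_compat.
      assert (1 <= p ^ 3) by (simpl; nra).
      assert (p <= p ^ 3) by (simpl; nra). nra.
Qed.

(** * Moments of sums of cosines *)

Definition tcos (v : Z) (x : R) : R := cos (2 * PI * IZR v * x).

(** Only a set containing the frequencies is recorded, since frequencies alone decide which averages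
    vanish. Frequencies may repeat, and their coefficients may cancel. *)
Definition spec (S : Z -> Prop) (f : R -> R) : Prop :=
  exists l : list (R * Z), (forall cv, In cv l -> S (snd cv)) /\
    forall x, f x = lsum (fun cv => fst cv * tcos (snd cv) x) l.

Lemma spec_mul (S1 S2 S : Z -> Prop) (f g : R -> R) :
  (forall v w, S1 v -> S2 w -> S (v + w)%Z /\ S (v - w)%Z) ->
  spec S1 f -> spec S2 g -> spec S (fun x => f x * g x).
Proof.
  intros HS [l [Hl Hf]] [l' [Hl' Hg]].
  exists (flat_map (fun cv => flat_map (fun dw =>
     [(fst cv * fst dw / 2, (snd cv + snd dw)%Z); (fst cv * fst dw / 2, (snd cv - snd dw)%Z)]) l') l).
  split.
  - intros cv Hcv. apply in_flat_map in Hcv. destruct Hcv as [a [Ha Hcv]].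
    apply in_flat_map in Hcv. destruct Hcv as [b [Hb Hcv]].
    destruct (HS _ _ (Hl a Ha) (Hl' b Hb)). destruct Hcv as [<-|[<-|[]]]; assumption.
  - intros x. rewrite Hf, Hg, lsum_mul. clear.
    induction l as [|a l IH]; [reflexivity|]. simpl. rewrite lsum_app, IH. f_equal.
    clear. induction l' as [|b l' IH]; [reflexivity|]. simpl. rewrite IH.
    unfold tcos. rewrite plus_IZR, minus_IZR.
    replace (2 * PI * (IZR (snd a) + IZR (snd b)) * x)
      with (2 * PI * IZR (snd a) * x + 2 * PI * IZR (snd b) * x) by ring.
    replace (2 * PI * (IZR (snd a) - IZR (snd b)) * x)
      with (2 * PI * IZR (snd a) * x - 2 * PI * IZR (snd b) * x) by ring.
    rewrite cos_plus, cos_minus. field.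
Qed.

Lemma avg_tcos (Q : nat) (v : Z) :
  (0 < Q)%nat -> (Z.abs v < Z.of_nat Q)%Z -> avg Q (tcos v) = if Z.eq_dec v 0 then 1 else 0.
Proof.
  intros HQ Hv. destruct (Z.eq_dec v 0) as [->|Hne].
  - rewrite (avg_ext Q _ (fun _ => 1)); [now apply avg_const|].
    intros x; unfold tcos. rewrite Rmult_0_r, Rmult_0_l. apply cos_0.
  - now apply avg_cos.
Qed.

Lemma avg_spec (Q : nat) (S : Z -> Prop) (f : R -> R) :
  (0 < Q)%nat -> (forall v, S v -> v <> 0%Z /\ (Z.abs v < Z.of_nat Q)%Z) ->
  spec S f -> avg Q f = 0.
Proof.
  intros HQ HS [l [Hl Hf]]. rewrite (avg_ext Q _ _ Hf).
  rewrite (avg_lsum Q (fun cv x => fst cv * tcos (snd cv) x)).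
  apply lsum_zero. intros cv Hcv. destruct (HS _ (Hl cv Hcv)) as [H0 H1].
  rewrite avg_scal, avg_tcos by assumption.
  destruct (Z.eq_dec (snd cv) 0); [contradiction|ring].
Qed.

(** By the product formula only pairs with [v + w = 0] or [v - w = 0] survive averaging. The
    hypothesis then forces both frequencies to vanish, and such pairs are just those that contribute
    to the product of the averages. *)
Lemma avg_spec_mul (Q : nat) (S1 S2 : Z -> Prop) (f g : R -> R) :
  (0 < Q)%nat ->
  (forall v w, S1 v -> S2 w -> (Z.abs v + Z.abs w < Z.of_nat Q)%Z /\
     (v + w = 0 -> v = 0 /\ w = 0)%Z /\ (v - w = 0 -> v = 0 /\ w = 0)%Z) ->
  spec S1 f -> spec S2 g -> avg Q (fun x => f x * g x) = avg Q f * avg Q g.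
Proof.
  intros HQ HS [l [Hl Hf]] [l' [Hl' Hg]].
  rewrite (avg_ext Q f _ Hf), (avg_ext Q g _ Hg).
  rewrite (avg_lsum Q (fun cv x => fst cv * tcos (snd cv) x)).
  rewrite (avg_lsum Q (fun cv x => fst cv * tcos (snd cv) x)).
  rewrite lsum_mul.
  rewrite (avg_ext Q (fun x => f x * g x) (fun x => lsum (fun a => lsum (fun b =>
     (fst a * tcos (snd a) x) * (fst b * tcos (snd b) x)) l') l))
    by (intros x; rewrite Hf, Hg, lsum_mul; reflexivity).
  rewrite (avg_lsum Q (fun a x => lsum (fun b =>
     (fst a * tcos (snd a) x) * (fst b * tcos (snd b) x)) l')).
  apply lsum_ext; intros a Ha.
  rewrite (avg_lsum Q (fun b x => (fst a * tcos (snd a) x) * (fst b * tcos (snd b) x))).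
  apply lsum_ext; intros b Hb.
  destruct (HS _ _ (Hl a Ha) (Hl' b Hb)) as [H1 [H2 H3]].
  set (v := snd a) in *. set (w := snd b) in *.
  rewrite (avg_ext Q _ (fun x => (fst a * fst b / 2) * (tcos (v + w) x + tcos (v - w) x))).
  2:{ intros x. unfold tcos. rewrite plus_IZR, minus_IZR.
      replace (2 * PI * (IZR v + IZR w) * x) with (2 * PI * IZR v * x + 2 * PI * IZR w * x) by ring.
      replace (2 * PI * (IZR v - IZR w) * x) with (2 * PI * IZR v * x - 2 * PI * IZR w * x) by ring.
      rewrite cos_plus, cos_minus. field. }
  rewrite !avg_scal, avg_plus, !avg_tcos by lia.
  destruct (Z.eq_dec (v + w) 0); destruct (Z.eq_dec (v - w) 0);
    destruct (Z.eq_dec v 0); destruct (Z.eq_dec w 0); try (exfalso; lia); field.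
Qed.

(** * Frequencies of polynomials in the cosines *)

(** The integers [sum a_k * nu k] with [sum |a_k|] at most [d]: the possible frequencies of a
    polynomial of degree [d] in the cosines indexed by [ks]. The natural subtraction is exact
    because [|a|] is at most [d]. *)
Fixpoint comb (nu : nat -> nat) (ks : list nat) (d : nat) (v : Z) : Prop :=
  match ks with
  | [] => v = 0%Z
  | k :: ks' => exists a w, (v = a * Z.of_nat (nu k) + w)%Z /\ (Z.abs_nat a <= d)%nat /\
                  comb nu ks' (d - Z.abs_nat a) w
  end.

Lemma comb_zero (nu : nat -> nat) (ks : list nat) (d : nat) : comb nu ks d 0%Z.
Proof.
  revert d; induction ks as [|k ks IH]; intros d; simpl; [reflexivity|].
  exists 0%Z, 0%Z. repeat split; [lia|apply IH].
Qed.

Lemma comb_weaken (nu : nat -> nat) (ks : list nat) (d e : nat) (v : Z) :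
  (d <= e)%nat -> comb nu ks d v -> comb nu ks e v.
Proof.
  revert d e v; induction ks as [|k ks IH]; intros d e v Hde; simpl; [auto|].
  intros [a [w [H1 [H2 H3]]]]. exists a, w. repeat split; [assumption|lia|].
  apply (IH (d - Z.abs_nat a)%nat); [lia|assumption].
Qed.

Lemma comb_add_sub (nu : nat -> nat) (ks : list nat) (d e : nat) (v w : Z) :
  comb nu ks d v -> comb nu ks e w ->
  comb nu ks (d + e) (v + w) /\ comb nu ks (d + e) (v - w).
Proof.
  revert d e v w; induction ks as [|k ks IH]; intros d e v w; simpl; [lia|].
  intros [a [v' [H1 [H2 H3]]]] [b [w' [H4 [H5 H6]]]].
  destruct (IH _ _ _ _ H3 H6) as [Hp Hm]. split.
  - exists (a + b)%Z, (v' + w')%Z. repeat split; [lia|lia|].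
    eapply comb_weaken; [|exact Hp]; lia.
  - exists (a - b)%Z, (v' - w')%Z. repeat split; [lia|lia|].
    eapply comb_weaken; [|exact Hm]; lia.
Qed.

Lemma comb_single (nu : nat -> nat) (ks : list nat) (k : nat) :
  In k ks -> comb nu ks 1 (Z.of_nat (nu k)).
Proof.
  induction ks as [|l ks IH]; simpl; [tauto|].
  destruct (Nat.eq_dec l k) as [->|Hne].
  - intros _. exists 1%Z, 0%Z. repeat split; [lia|lia|]. apply comb_zero.
  - intros [H|H]; [contradiction|].
    exists 0%Z, (Z.of_nat (nu k)). repeat split; [lia|]. now apply IH.
Qed.

Lemma comb_bound (nu : nat -> nat) (M : nat) (ks : list nat) (d : nat) (v : Z) :
  (forall k, In k ks -> (nu k <= M)%nat) -> comb nu ks d v ->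
  (Z.abs v <= Z.of_nat (d * M))%Z.
Proof.
  revert d v; induction ks as [|k ks IH]; intros d v HM; simpl; [intros ->; lia|].
  intros [a [w [H1 [H2 H3]]]].
  apply IH in H3; [|intros; apply HM; now right].
  assert (Hk : (nu k <= M)%nat) by (apply HM; now left).
  rewrite H1.
  assert (Z.abs (a * Z.of_nat (nu k)) <= Z.of_nat (Z.abs_nat a * M))%Z.
  { rewrite Z.abs_mul, Nat2Z.inj_mul, Zabs2Nat.id_abs. nia. }
  assert (Z.abs_nat a * M + (d - Z.abs_nat a) * M = d * M)%nat by nia. lia.
Qed.

(** Zero coefficients are discarded. Each remaining one has absolute value at least 1, so the budget
    [d] bounds the number of terms as well as the coefficients. *)
Lemma comb_relation (nu : nat -> nat) (ks : list nat) (d : nat) (v : Z) :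
  NoDup ks -> comb nu ks d v ->
  exists r, relsum nu r = v /\ (forall k, In k (map snd r) -> In k ks) /\
    NoDup (map snd r) /\ (length r <= d)%nat /\
    List.Forall (fun ak => fst ak <> 0%Z /\ (Z.abs (fst ak) <= Z.of_nat d)%Z) r.
Proof.
  revert d v; induction ks as [|k ks IH]; intros d v Hnd; simpl.
  - intros ->. exists []. simpl. repeat split; [tauto|constructor|lia|constructor].
  - inversion Hnd as [|? ? Hk Hnd']; subst. intros [a [w [H1 [H2 H3]]]].
    destruct (IH _ _ Hnd' H3) as [r [R1 [R2 [R3 [R4 R5]]]]].
    destruct (Z.eq_dec a 0) as [->|Ha].
    + exists r. repeat split; [lia| |assumption|lia|].
      * intros l Hl; right; auto.
      * eapply Forall_impl; [|exact R5]. intros ak; simpl; lia.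
    + exists ((a, k) :: r). repeat split.
      * unfold relsum in *; simpl. lia.
      * intros l [<-|Hl]; [now left|right; auto].
      * simpl. constructor; auto.
      * simpl; lia.
      * constructor; [simpl; lia|]. eapply Forall_impl; [|exact R5]. intros ak; simpl; lia.
Qed.

(** No relation is supported inside [ks]. This is the substitute for independence up to order
    [P]. *)
Definition off (nu : nat -> nat) (P : nat) (ks : list nat) : Prop :=
  NoDup ks /\ forall r, is_rel nu P r -> exists k, In k (map snd r) /\ ~ In k ks.

Lemma off_sub (nu : nat -> nat) (P : nat) (ks ks' : list nat) :
  off nu P ks -> NoDup ks' -> (forall k, In k ks' -> In k ks) -> off nu P ks'.
Proof.
  intros [_ H] Hnd Hsub. split; [assumption|]. intros r Hr.
  destruct (H r Hr) as [k [H1 H2]]. exists k; auto.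
Qed.

(** Relabelling by [sigma] turns a relation of the permuted sequence into one of [n], with distinct
    indices by injectivity. A hitting set chosen for [n] alone thus serves every permutation. *)
Lemma hits_off (n sigma : nat -> nat) (P : nat) (B ks : list nat) :
  (forall i j, sigma i = sigma j -> i = j) -> hits n P B -> NoDup ks ->
  (forall k, In k ks -> ~ In (sigma k) B) -> off (fun k => n (sigma k)) P ks.
Proof.
  intros Hinj HB Hnd Hks. split; [assumption|]. intros r [R1 [R2 [R3 [R4 R5]]]].
  set (r' := map (fun ak => (fst ak, sigma (snd ak))) r).
  assert (Hsnd : map snd r' = map sigma (map snd r)).
  { unfold r'. rewrite !map_map. reflexivity. }
  destruct (HB r') as [k [K1 K2]].
  - repeat split.
    + unfold r'. destruct r; simpl; congruence.
    + unfold r'. now rewrite length_map.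
    + rewrite Hsnd. apply FinFun.Injective_map_NoDup; [exact Hinj|assumption].
    + unfold r'. rewrite Forall_map. exact R4.
    + rewrite <- R5. unfold r', relsum. rewrite map_map. reflexivity.
  - rewrite Hsnd in K1. apply in_map_iff in K1. destruct K1 as [l [<- Hl]].
    exists l. split; [assumption|]. intros Hin. now apply (Hks l Hin).
Qed.

Definition xcos (nu : nat -> nat) (k : nat) (x : R) : R := cos (2 * PI * INR (nu k) * x).

Definition wsum (nu : nat -> nat) (K : list (R * nat)) (x : R) : R :=
  lsum (fun ck => fst ck * xcos nu (snd ck) x) K.

Lemma spec_ext (S : Z -> Prop) (f g : R -> R) :
  (forall x, g x = f x) -> spec S f -> spec S g.
Proof. intros H [l [H1 H2]]. exists l. split; [assumption|]. intros x; now rewrite H. Qed.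

Lemma spec_wsum_pow (nu : nat -> nat) (K : list (R * nat)) (j : nat) :
  spec (comb nu (map snd K) j) (fun x => wsum nu K x ^ j).
Proof.
  induction j as [|j IH].
  - exists [(1, 0%Z)]. split.
    + intros cv [<-|[]]. apply comb_zero.
    + intros x. unfold tcos. simpl. rewrite Rmult_0_r, Rmult_0_l, cos_0. ring.
  - apply (spec_mul (comb nu (map snd K) 1) (comb nu (map snd K) j)).
    + intros v w Hv Hw. apply (comb_add_sub nu (map snd K) 1 j v w Hv Hw).
    + exists (map (fun ck => (fst ck, Z.of_nat (nu (snd ck)))) K). split.
      * intros cv Hcv. apply in_map_iff in Hcv. destruct Hcv as [ck [<- Hck]].
        apply comb_single, in_map, Hck.
      * intros x. rewrite lsum_map. apply lsum_ext. intros ck _.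
        unfold xcos, tcos; simpl. now rewrite INR_IZR_INZ.
    + exact IH.
Qed.

Lemma wsum_single (nu : nat -> nat) (k : nat) (x : R) : wsum nu [(1, k)] x = xcos nu k x.
Proof. unfold wsum; simpl; ring. Qed.

(** This is the independence statement. A nonzero frequency of the single cosine that cancels one
    from the rest would give a vanishing combination of total weight at most [P] with nonzero
    coefficient at [k], hence a relation inside [k :: map snd K]. *)
Lemma moment_factor (nu : nat -> nat) (P M Q : nat) (k : nat) (K : list (R * nat)) (i j : nat) :
  off nu P (k :: map snd K) -> (forall l, In l (k :: map snd K) -> (nu l <= M)%nat) ->
  (j + i <= P)%nat -> (P * M < Q)%nat ->
  avg Q (fun x => xcos nu k x ^ j * wsum nu K x ^ i)
  = avg Q (fun x => xcos nu k x ^ j) * avg Q (fun x => wsum nu K x ^ i).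
Proof.
  intros [Hnd Hoff] HM HP HQ.
  apply (avg_spec_mul Q (comb nu [k] j) (comb nu (map snd K) i)); [lia| | |apply spec_wsum_pow].
  2:{ apply (spec_ext _ (fun x => wsum nu [(1, k)] x ^ j));
        [intros x; now rewrite wsum_single|apply (spec_wsum_pow nu [(1, k)] j)]. }
  assert (Hkey : forall v w, comb nu [k] j v -> comb nu (map snd K) i w -> (v + w = 0)%Z ->
            v = 0%Z /\ w = 0%Z).
  { intros v w [a [z [V1 [V2 V3]]]] Hw Hvw. simpl in V3. subst z.
    destruct (Z.eq_dec a 0) as [->|Ha]; [lia|]. exfalso.
    inversion Hnd as [|? ? Hk Hnd']; subst.
    destruct (comb_relation _ _ _ _ Hnd' Hw) as [r [R1 [R2 [R3 [R4 R5]]]]].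
    destruct (Hoff ((a, k) :: r)) as [l [L1 L2]].
    - split; [discriminate|]. split; [simpl; lia|]. split.
      + simpl; constructor; [|assumption]. intros Hin; apply Hk; auto.
      + split; [constructor; [simpl; lia|]|].
        * eapply Forall_impl; [|exact R5]. intros ak; simpl; lia.
        * unfold relsum in *; simpl; lia.
    - apply L2. destruct L1 as [<-|L1]; [now left|right; auto]. }
  intros v w Hv Hw.
  assert (B1 : (Z.abs v <= Z.of_nat (j * M))%Z).
  { eapply comb_bound; [|exact Hv]. intros l [<-|[]]; apply HM; now left. }
  assert (B2 : (Z.abs w <= Z.of_nat (i * M))%Z).
  { eapply comb_bound; [|exact Hw]. intros l Hl; apply HM; now right. }
  split; [nia|]. split; [apply Hkey; assumption|].
  (* Differences reduce to sums because the set of frequencies is symmetric under negation. *)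
  intros H. assert (Hw' : comb nu (map snd K) i (- w)).
  { rewrite <- Z.sub_0_l. apply (comb_add_sub nu (map snd K) 0 i); [apply comb_zero|exact Hw]. }
  destruct (Hkey v (- w)%Z Hv Hw'); lia.
Qed.

(** The frequencies of the [m]-th power are multiples of [nu k] by integers of the same parity as
    [m], so for odd [m] none of them vanishes. *)
Lemma avg_xcos_odd (nu : nat -> nat) (k j Q : nat) :
  (0 < nu k)%nat -> ((2 * j + 1) * nu k < Q)%nat -> avg Q (fun x => xcos nu k x ^ (2 * j + 1)) = 0.
Proof.
  intros Hnu HQ.
  set (S := fun m v => exists a, v = (a * Z.of_nat (nu k))%Z /\ Z.odd a = Nat.odd m /\
              (Z.abs_nat a <= m)%nat).
  assert (HS : forall m, spec (S m) (fun x => xcos nu k x ^ m)).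
  { induction m as [|m IH].
    - exists [(1, 0%Z)]. split.
      + intros cv [<-|[]]. exists 0%Z. repeat split; simpl; lia.
      + intros x. unfold tcos; simpl. rewrite Rmult_0_r, Rmult_0_l, cos_0; ring.
    - apply (spec_mul (fun v => v = Z.of_nat (nu k)) (S m)); [| |exact IH].
      + intros v w -> [a [-> [H1 H2]]]. split.
        * exists (1 + a)%Z. repeat split; [lia| |lia].
          rewrite Z.odd_add, H1, Nat.odd_succ, <- Nat.negb_odd. now destruct (Nat.odd m).
        * exists (1 - a)%Z. repeat split; [lia| |lia].
          rewrite Z.odd_sub, H1, Nat.odd_succ, <- Nat.negb_odd. now destruct (Nat.odd m).
      + exists [(1, Z.of_nat (nu k))]. split.
        * intros cv [<-|[]]. reflexivity.
        * intros x. unfold xcos, tcos; simpl. rewrite INR_IZR_INZ; ring. }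
  apply (avg_spec Q (S (2 * j + 1)%nat)); [lia| |apply HS].
  intros v [a [-> [H1 H2]]].
  assert (Ha : a <> 0%Z).
  { intros ->. rewrite Nat.add_1_r, Nat.odd_succ, Nat.even_mul in H1. discriminate. }
  split; [nia|]. rewrite Z.abs_mul, <- Zabs2Nat.id_abs. nia.
Qed.

Lemma xcos_bound (nu : nat -> nat) (k : nat) (x : R) : -1 <= xcos nu k x <= 1.
Proof. apply COS_bound. Qed.

Lemma avg_xcos_sqr (nu : nat -> nat) (k Q : nat) :
  (0 < nu k)%nat -> (2 * nu k < Q)%nat -> avg Q (fun x => xcos nu k x ^ 2) = 1 / 2.
Proof.
  intros Hnu HQ.
  rewrite (avg_ext Q _ (fun x => 1 / 2 + 1 / 2 * cos (2 * PI * IZR (2 * Z.of_nat (nu k)) * x))).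
  - rewrite avg_plus, avg_scal, avg_const, avg_cos by lia. ring.
  - intros x. unfold xcos. rewrite mult_IZR, <- INR_IZR_INZ.
    replace (2 * PI * (2 * INR (nu k)) * x) with (2 * (2 * PI * INR (nu k) * x)) by ring.
    rewrite cos_2a_cos. field.
Qed.

Lemma pow_even_nonneg (x : R) (j : nat) : 0 <= x ^ (2 * j).
Proof. rewrite pow_mult. apply pow_le, pow2_ge_0. Qed.

Lemma avg_xcos_even (nu : nat -> nat) (k j Q : nat) :
  (0 < nu k)%nat -> (2 * nu k < Q)%nat -> (1 <= j)%nat ->
  0 <= avg Q (fun x => xcos nu k x ^ (2 * j)) <= 1 / 2.
Proof.
  intros Hnu HQ Hj. split.
  - apply avg_nonneg; [lia|]. intros; apply pow_even_nonneg.
  - rewrite <- (avg_xcos_sqr nu k Q Hnu HQ). apply avg_le; [lia|]. intros x _.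
    replace (2 * j)%nat with (2 + 2 * (j - 1))%nat by lia. rewrite pow_add.
    rewrite <- (Rmult_1_r (xcos nu k x ^ 2)) at 2.
    apply Rmult_le_compat_l; [apply pow2_ge_0|].
    rewrite pow_mult, <- (pow1 (j - 1)). apply pow_incr.
    assert (H := xcos_bound nu k x). split; [apply pow2_ge_0|nra].
Qed.

(** * Normalized powers and truncated convolutions *)

(** Dividing by the factorial turns the binomial theorem into a convolution and the sum over all
    orders into [exp]. *)
Definition pw (k : nat) (x : R) : R := x ^ k / INR (fact k).

Lemma pw_nonneg (k : nat) (x : R) : 0 <= x -> 0 <= pw k x.
Proof.
  intros H. unfold pw. apply Rmult_le_pos; [now apply pow_le|].
  left; apply Rinv_0_lt_compat, INR_fact_lt_0.
Qed.

Lemma pw_0 (x : R) : pw 0 x = 1.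
Proof. unfold pw; simpl; field. Qed.

Lemma sum_f_R0_lsum (f : nat -> R) (n : nat) : sum_f_R0 f n = lsum f (seq 0 (S n)).
Proof.
  induction n as [|n IH]; [simpl; ring|].
  rewrite lsum_seq_S, <- IH. reflexivity.
Qed.

Lemma pw_plus (n : nat) (x y : R) :
  pw n (x + y) = lsum (fun i => pw i x * pw (n - i) y) (seq 0 (S n)).
Proof.
  unfold pw at 1. rewrite binomial, sum_f_R0_lsum. unfold Rdiv.
  rewrite Rmult_comm, <- lsum_scal. apply lsum_ext. intros i _.
  unfold Binomial.C, pw. field. repeat split; apply INR_fact_neq_0.
Qed.

Lemma pw_mult (k : nat) (c x : R) : pw k (c * x) = c ^ k * pw k x.
Proof. unfold pw. rewrite Rpow_mult_distr. unfold Rdiv; ring. Qed.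

Lemma pw_sum_exp (m : nat) (x : R) : 0 <= x -> lsum (fun k => pw k x) (seq 0 m) <= exp x.
Proof.
  intros Hx. destruct m as [|m]; [simpl; left; apply exp_pos|].
  generalize (exp_ge_taylor x m Hx). rewrite sum_f_R0_lsum. auto.
Qed.

Lemma pw_le_exp (k : nat) (x : R) : 0 <= x -> pw k x <= exp x.
Proof.
  intros Hx. eapply Rle_trans; [|apply (pw_sum_exp (S k) x Hx)].
  apply (lsum_pick (fun k => pw k x)); [intros; now apply pw_nonneg|apply in_seq; lia].
Qed.

Lemma lsum_even (f : nat -> R) (k : nat) :
  (forall j, (2 * j + 1 <= 2 * k)%nat -> f (2 * j + 1)%nat = 0) ->
  lsum f (seq 0 (S (2 * k))) = lsum (fun j => f (2 * j)%nat) (seq 0 (S k)).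
Proof.
  induction k as [|k IH]; intros H; [reflexivity|].
  replace (S (2 * S k)) with (S (S (S (2 * k)))) by lia.
  rewrite lsum_seq_S, lsum_seq_S, IH by (intros; apply H; lia).
  rewrite (lsum_seq_S _ 0 (S k)).
  replace (0 + S (2 * k))%nat with (2 * k + 1)%nat by lia.
  rewrite H by lia.
  replace (0 + S (S (2 * k)))%nat with (2 * (0 + S k))%nat by lia. ring.
Qed.

Lemma convolution_identity (a b : nat -> R) (m : nat) :
  lsum (fun k => lsum (fun j => a j * b (k - j)%nat) (seq 0 (S k))) (seq 0 m)
  = lsum (fun j => a j * lsum b (seq 0 (m - j))) (seq 0 m).
Proof.
  induction m as [|m IH]; [reflexivity|].
  rewrite lsum_seq_S, IH, (lsum_seq_S _ 0 m).
  rewrite (lsum_seq_S (fun j => a j * lsum b (seq 0 (S m - j))) 0 m).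
  replace (S m - (0 + m))%nat with 1%nat by lia.
  replace (lsum (fun j => a j * lsum b (seq 0 (S m - j))) (seq 0 m))
    with (lsum (fun j => a j * lsum b (seq 0 (m - j)) + a j * b (m - j)%nat) (seq 0 m)).
  - rewrite lsum_plus. simpl. rewrite Nat.sub_diag. ring.
  - apply lsum_ext. intros j Hj. apply in_seq in Hj.
    replace (S m - j)%nat with (S (m - j)) by lia. rewrite lsum_seq_S. simpl. ring.
Qed.

Lemma lsum_seq_mono (b : nat -> R) (m n : nat) :
  (m <= n)%nat -> (forall k, 0 <= b k) -> lsum b (seq 0 m) <= lsum b (seq 0 n).
Proof.
  intros Hmn Hb. replace n with (m + (n - m))%nat by lia. rewrite seq_app, lsum_app.
  assert (0 <= lsum b (seq (0 + m) (n - m))) by (apply lsum_nonneg; auto). lra.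
Qed.

(** The left side runs over the triangle [i + j < m] inside the square of pairs on the right.
    Nonnegativity of [b] is asked only below [m], because the moment gaps to which this applies are
    controlled only up to order [P]. *)
Lemma convolution_le (a b : nat -> R) (m : nat) :
  (forall k, 0 <= a k) -> (forall k, (k < m)%nat -> 0 <= b k) ->
  lsum (fun k => lsum (fun j => a j * b (k - j)%nat) (seq 0 (S k))) (seq 0 m)
  <= lsum a (seq 0 m) * lsum b (seq 0 m).
Proof.
  intros Ha Hb. rewrite convolution_identity.
  rewrite (Rmult_comm (lsum a _)), <- lsum_scal. apply lsum_le. intros j Hj.
  rewrite Rmult_comm. apply Rmult_le_compat_r; [apply Ha|].
  replace m with ((m - j) + (m - (m - j)))%nat at 2 by lia.
  rewrite seq_app, lsum_app.
  assert (0 <= lsum b (seq (0 + (m - j)) (m - (m - j)))); [|lra].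
  apply lsum_nonneg. intros k Hk. apply in_seq in Hk. apply Hb. lia.
Qed.

(** Standing assumptions on a weighted sum. The last inequality makes [avg Q] exact on polynomials
    of degree at most [P] in cosines of frequency at most [M]. *)
Definition adm (nu : nat -> nat) (P M Q : nat) (K : list (R * nat)) : Prop :=
  off nu P (map snd K) /\ (forall k, In k (map snd K) -> (0 < nu k <= M)%nat) /\
  (2 <= P)%nat /\ (0 < M)%nat /\ (P * M < Q)%nat.

Lemma adm_tail (nu : nat -> nat) (P M Q : nat) (ck : R * nat) (K : list (R * nat)) :
  adm nu P M Q (ck :: K) -> adm nu P M Q K.
Proof.
  intros [H1 [H2 H3]]. split; [|split; [|assumption]].
  - apply (off_sub nu P (map snd (ck :: K))); [assumption| |intros; now right].
    destruct H1 as [H1 _]. now inversion H1.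
  - intros k Hk; apply H2; now right.
Qed.

Lemma wsum_cons (nu : nat -> nat) (ck : R * nat) (K : list (R * nat)) (x : R) :
  wsum nu (ck :: K) x = fst ck * xcos nu (snd ck) x + wsum nu K x.
Proof. reflexivity. Qed.

Lemma avg_pw (Q n : nat) (f : R -> R) :
  avg Q (fun x => pw n (f x)) = avg Q (fun x => f x ^ n) / INR (fact n).
Proof.
  unfold Rdiv. rewrite Rmult_comm, <- avg_scal. apply avg_ext; intros x.
  unfold pw, Rdiv; ring.
Qed.

Lemma moment_expand (nu : nat -> nat) (P M Q : nat) (ck : R * nat) (K : list (R * nat)) (n : nat) :
  adm nu P M Q (ck :: K) -> (n <= P)%nat ->
  avg Q (fun x => pw n (wsum nu (ck :: K) x))
  = lsum (fun i => fst ck ^ i * avg Q (fun x => pw i (xcos nu (snd ck) x)) *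
                   avg Q (fun x => pw (n - i) (wsum nu K x))) (seq 0 (S n)).
Proof.
  intros [H1 [H2 [H3 [H4 H5]]]] Hn.
  rewrite (avg_ext Q _ (fun x => lsum (fun i => fst ck ^ i / INR (fact i) / INR (fact (n - i)) *
     (xcos nu (snd ck) x ^ i * wsum nu K x ^ (n - i))) (seq 0 (S n)))).
  - rewrite (avg_lsum Q (fun i x => fst ck ^ i / INR (fact i) / INR (fact (n - i)) *
       (xcos nu (snd ck) x ^ i * wsum nu K x ^ (n - i)))).
    apply lsum_ext. intros i Hi. apply in_seq in Hi. rewrite avg_scal.
    rewrite (moment_factor nu P M); [|exact H1|intros l Hl; now apply H2|lia|assumption].
    rewrite !avg_pw. field. split; apply INR_fact_neq_0.
  - intros x. rewrite wsum_cons, pw_plus. apply lsum_ext. intros i _.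
    rewrite pw_mult. unfold pw. field. split; apply INR_fact_neq_0.
Qed.

(** In each term of the expansion either the exponent of the single cosine or that of the remaining
    sum is odd. *)
Lemma odd_moment (nu : nat -> nat) (P M Q : nat) (K : list (R * nat)) (j : nat) :
  adm nu P M Q K -> (2 * j + 1 <= P)%nat -> avg Q (fun x => pw (2 * j + 1) (wsum nu K x)) = 0.
Proof.
  revert j; induction K as [|ck K IH]; intros j HK Hj.
  - rewrite (avg_ext Q _ (fun _ => 0)).
    + destruct HK as [_ [_ HK]]. apply avg_const; lia.
    + intros x. unfold wsum, pw; simpl lsum. rewrite pow_i by lia. unfold Rdiv; ring.
  - rewrite (moment_expand nu P M) by assumption. apply lsum_zero. intros i Hi.
    apply in_seq in Hi. assert (HK' := adm_tail _ _ _ _ _ _ HK).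
    destruct (Nat.Even_or_Odd i) as [[e He]|[e He]].
    + replace (2 * j + 1 - i)%nat with (2 * (j - e) + 1)%nat by lia.
      rewrite IH; [ring|assumption|lia].
    + rewrite He, avg_pw, avg_xcos_odd; [unfold Rdiv; ring| |]; clear IH.
      * destruct HK as [_ [HK _]]. apply HK; now left.
      * destruct HK as [_ [HK [_ [_ HQ]]]].
        assert (0 < nu (snd ck) <= M)%nat by (apply HK; now left).
        apply Nat.le_lt_trans with (P * M)%nat; [apply Nat.mul_le_mono; lia|assumption].
Qed.

(** Odd moments vanish, so only even orders are kept. [alpha] belongs to a whole sum and [beta]
    below to a single weighted cosine; adding a term convolves [alpha] with [beta]. *)
Definition alpha (Q : nat) (nu : nat -> nat) (K : list (R * nat)) (k : nat) : R :=
  avg Q (fun x => pw (2 * k) (wsum nu K x)).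

Definition beta (Q : nat) (nu : nat -> nat) (ck : R * nat) (j : nat) : R :=
  fst ck ^ (2 * j) * avg Q (fun x => pw (2 * j) (xcos nu (snd ck) x)).

Lemma alpha_cons (nu : nat -> nat) (P M Q : nat) (ck : R * nat) (K : list (R * nat)) (k : nat) :
  adm nu P M Q (ck :: K) -> (2 * k <= P)%nat ->
  alpha Q nu (ck :: K) k = lsum (fun j => beta Q nu ck j * alpha Q nu K (k - j)) (seq 0 (S k)).
Proof.
  intros HK Hk. unfold alpha at 1. rewrite (moment_expand nu P M) by assumption.
  rewrite lsum_even.
  - apply lsum_ext. intros j Hj. unfold beta, alpha.
    replace (2 * (k - j))%nat with (2 * k - 2 * j)%nat by lia. reflexivity.
  - intros j Hj. rewrite avg_pw, avg_xcos_odd; [unfold Rdiv; ring| |].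
    + destruct HK as [_ [HK _]]. apply HK; now left.
    + destruct HK as [_ [HK [_ [_ HQ]]]].
      assert (0 < nu (snd ck) <= M)%nat by (apply HK; now left).
        apply Nat.le_lt_trans with (P * M)%nat; [apply Nat.mul_le_mono; lia|assumption].
Qed.

(** [pw j (c ^ 2 / 4)] is the normalized moment of order [2 * j] of a centred Gaussian variable with
    the variance [c ^ 2 / 2] of one term. For positive [j] the moment of the cosine is at most 1/2,
    and [4 ^ j * j!] is at most twice the factorial of [2 * j]. *)
Lemma beta_bounds (nu : nat -> nat) (P M Q : nat) (ck : R * nat) (K : list (R * nat)) (j : nat) :
  adm nu P M Q (ck :: K) -> 0 <= beta Q nu ck j <= pw j (fst ck ^ 2 / 4).
Proof.
  intros [_ [HK [HP [_ HQ]]]].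
  assert (Hnu : (0 < nu (snd ck) <= M)%nat) by (apply HK; now left).
  unfold beta. rewrite avg_pw.
  assert (Hc := pow_even_nonneg (fst ck) j).
  assert (Hf := INR_fact_lt_0 (2 * j)).
  destruct j as [|j].
  - simpl. rewrite avg_const by lia. rewrite pw_0. lra.
  - destruct (avg_xcos_even nu (snd ck) (S j) Q) as [A1 A2]; [lia|nia|lia|].
    set (a := avg Q _) in *. split.
    + apply Rmult_le_pos; [assumption|]. apply Rdiv_le_0_compat; assumption.
    + unfold pw.
      assert (Hfac : forall i, 4 ^ S i * INR (fact (S i)) <= 2 * INR (fact (2 * S i))).
      { induction i as [|i IH]; [simpl; lra|].
        replace (2 * S (S i))%nat with (S (S (2 * S i))) by lia.
        rewrite (fact_simpl (S i)), (fact_simpl (S (2 * S i))), (fact_simpl (2 * S i)), !mult_INR.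
        rewrite (S_INR (S (2 * S i))), (S_INR (2 * S i)), mult_INR.
        change (INR 2) with 2.
        replace (INR (S (S i))) with (INR (S i) + 1) by now rewrite (S_INR (S i)).
        assert (0 <= INR i) by apply pos_INR. rewrite (S_INR i) in *.
        assert (0 < INR (fact (S i))) by apply INR_fact_lt_0.
        assert (0 < 4 ^ S i) by (apply pow_lt; lra).
        change (4 ^ S (S i)) with (4 * 4 ^ S i).
        set (A := 4 ^ S i) in *. set (B := INR (fact (S i))) in *.
        set (D := INR (fact (2 * S i))) in *.
        assert (HD : 0 < D) by apply INR_fact_lt_0.
        apply Rle_trans with (4 * (INR i + 2) * (A * B)); [right; ring|].
        apply Rle_trans with (4 * (INR i + 2) * ((2 * INR i + 3) * D)); [|right; ring].
        apply Rmult_le_compat_l; nra. }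
      specialize (Hfac j).
      replace ((fst ck ^ 2 / 4) ^ S j) with (fst ck ^ (2 * S j) / 4 ^ S j)
        by (unfold Rdiv; rewrite Rpow_mult_distr, pow_inv, pow_mult; reflexivity).
      assert (H4 : 0 < 4 ^ S j) by (apply pow_lt; lra).
      assert (HF : 0 < INR (fact (S j))) by apply INR_fact_lt_0.
      replace (fst ck ^ (2 * S j) / 4 ^ S j / INR (fact (S j)))
        with (fst ck ^ (2 * S j) * / (4 ^ S j * INR (fact (S j)))) by (field; lra).
      apply Rmult_le_compat_l; [assumption|].
      apply Rle_trans with (/ (2 * INR (fact (2 * S j)))).
      * rewrite Rinv_mult. unfold Rdiv. apply Rmult_le_compat_r; [|lra].
        left; now apply Rinv_0_lt_compat.
      * apply Rinv_le_contravar; [now apply Rmult_lt_0_compat|assumption].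
Qed.

Lemma beta_0 (nu : nat -> nat) (Q : nat) (ck : R * nat) : (0 < Q)%nat -> beta Q nu ck 0 = 1.
Proof.
  intros HQ. unfold beta. rewrite (avg_ext Q _ (fun _ => 1)) by (intros; apply pw_0).
  rewrite avg_const by assumption. simpl; ring.
Qed.

(** The variances agree, so the comparison with the Gaussian moments can be strict only from [j = 2]
    on. *)
Lemma beta_1 (nu : nat -> nat) (P M Q : nat) (ck : R * nat) (K : list (R * nat)) :
  adm nu P M Q (ck :: K) -> beta Q nu ck 1 = fst ck ^ 2 / 4.
Proof.
  intros [_ [HK [HP [_ HQ]]]].
  assert (Hnu : (0 < nu (snd ck) <= M)%nat) by (apply HK; now left).
  unfold beta. rewrite avg_pw. change (2 * 1)%nat with 2%nat.
  rewrite avg_xcos_sqr; [simpl; field|lia|nia].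
Qed.

(** Half the variance of the sum, which is the exponent in its Gaussian characteristic function.
    [qdef] below measures the discrepancy with Gaussian terms, which starts at the fourth moment. *)
Definition qvar (K : list (R * nat)) : R := lsum (fun ck => fst ck ^ 2 / 4) K.
Definition qdef (K : list (R * nat)) : R := lsum (fun ck => (fst ck ^ 2 / 4) ^ 2 / 2) K.

Lemma qvar_nonneg (K : list (R * nat)) : 0 <= qvar K.
Proof. apply lsum_nonneg. intros a _. assert (H := pow2_ge_0 (fst a)). lra. Qed.

Lemma qdef_nonneg (K : list (R * nat)) : 0 <= qdef K.
Proof. apply lsum_nonneg. intros a _. assert (H := pow2_ge_0 (fst a ^ 2 / 4)). lra. Qed.

(** Convolution preserves the comparison with Gaussian moments: the bounds [pw j] of the terms
    convolve to [pw k] of the total. *)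
Lemma alpha_bounds (nu : nat -> nat) (P M Q : nat) (K : list (R * nat)) (k : nat) :
  adm nu P M Q K -> (2 * k <= P)%nat -> 0 <= alpha Q nu K k <= pw k (qvar K).
Proof.
  revert k; induction K as [|ck K IH]; intros k HK Hk.
  - assert (HQ : (0 < Q)%nat) by (destruct HK as [_ [_ HK]]; lia).
    unfold alpha, wsum, qvar; simpl lsum. rewrite avg_const by assumption.
    destruct k as [|k]; [rewrite !pw_0; lra|].
    unfold pw. rewrite !pow_i by lia. lra.
  - assert (HK' := adm_tail _ _ _ _ _ _ HK).
    rewrite (alpha_cons nu P M) by assumption.
    assert (Hb := fun j => beta_bounds nu P M Q ck K j HK).
    split.
    + apply lsum_nonneg. intros j Hj. apply Rmult_le_pos; [apply Hb|apply IH; [assumption|lia]].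
    + change (qvar (ck :: K)) with (fst ck ^ 2 / 4 + qvar K). rewrite pw_plus. apply lsum_le. intros j Hj.
      destruct (IH (k - j)%nat HK') as [A1 A2]; [lia|].
      apply Rmult_le_compat; [apply Hb|assumption|apply Hb|assumption].
Qed.

Lemma pw_sum_from_2 (m : nat) (w : R) : 0 <= w ->
  lsum (fun j => if le_lt_dec 2 j then pw j w else 0) (seq 0 m) <= w ^ 2 / 2 * exp w.
Proof.
  intros Hw.
  apply Rle_trans with (lsum (fun j => if le_lt_dec 2 j then pw j w else 0) (seq 0 (S (S m)))).
  - apply lsum_seq_mono; [lia|]. intros k. destruct (le_lt_dec 2 k); [now apply pw_nonneg|lra].
  - apply Rle_trans with (w ^ 2 / 2 * lsum (fun j => pw j w) (seq 0 m)).
    + rewrite <- lsum_scal. change (seq 0 (S (S m))) with (0%nat :: 1%nat :: seq 2 m).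
      simpl lsum. rewrite (lsum_seq_shift _ 1 m).
      rewrite (lsum_seq_shift _ 0 m). rewrite !Rplus_0_l. apply lsum_le. intros j _.
      destruct (le_lt_dec 2 (S (S j))) as [_|H]; [|lia].
      unfold pw. change (w ^ S (S j)) with (w * (w * w ^ j)).
      rewrite !fact_simpl, !mult_INR. rewrite !(S_INR (S j)), !(S_INR j).
      assert (Hj := pos_INR j). assert (Hf := INR_fact_lt_0 j). assert (Hp := pow_le w j Hw).
      apply Rle_trans with ((w ^ 2 * w ^ j / INR (fact j)) * / ((INR j + 1 + 1) * (INR j + 1)));
        [right; simpl; field; lra|].
      apply Rle_trans with ((w ^ 2 * w ^ j / INR (fact j)) * / 2); [|right; simpl; field; lra].
      apply Rmult_le_compat_l.
      * apply Rdiv_le_0_compat; [|assumption]. apply Rmult_le_pos; [apply pow2_ge_0|assumption].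
      * apply Rinv_le_contravar; nra.
    + apply Rmult_le_compat_l; [assert (H := pow2_ge_0 w); lra|]. now apply pw_sum_exp.
Qed.

(** The terms are exchanged for Gaussian ones one at a time, as in Lindeberg's method. A new term
    convolves the old gap with [pw j w] and creates a new gap only at orders [j] at least 2, of
    total size at most [w ^ 2 / 2 * exp w]. Summed over all orders, convolutions are bounded by
    products, and the exponentials multiply. *)
Lemma alpha_gap (nu : nat -> nat) (P M Q : nat) (K : list (R * nat)) (m : nat) :
  adm nu P M Q K -> (2 * m <= P)%nat ->
  lsum (fun k => pw k (qvar K) - alpha Q nu K k) (seq 0 m) <= qdef K * exp (qvar K).
Proof.
  intros HK Hm. induction K as [|ck K IH].
  - assert (HQ : (0 < Q)%nat) by (destruct HK as [_ [_ HK]]; lia).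
    rewrite lsum_zero; [unfold qdef; simpl; lra|].
    intros k _. unfold alpha, wsum, qvar; simpl lsum. rewrite avg_const by assumption.
    destruct k as [|k]; [rewrite !pw_0; ring|].
    unfold pw. rewrite !pow_i by lia. unfold Rdiv; ring.
  - assert (HK' := adm_tail _ _ _ _ _ _ HK). specialize (IH HK').
    assert (HQ : (0 < Q)%nat) by (destruct HK as [_ [_ HK]]; lia).
    set (w := fst ck ^ 2 / 4). set (u := qvar K) in *.
    assert (Hw : 0 <= w) by (unfold w; assert (H := pow2_ge_0 (fst ck)); lra).
    assert (Hu : 0 <= u) by apply qvar_nonneg.
    (* A bound for the gap created by the new term. It vanishes at orders 0 and 1, where mass and
       variance agree. *)
    set (e := fun j => if le_lt_dec 2 j then pw j w else 0).
    assert (He : forall j, 0 <= e j)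
      by (intros j; unfold e; destruct (le_lt_dec 2 j); [now apply pw_nonneg|lra]).
    set (gap := fun k => pw k u - alpha Q nu K k) in *.
    assert (Hgap : forall k, (k < m)%nat -> 0 <= gap k).
    { intros k Hk. unfold gap, u. destruct (alpha_bounds nu P M Q K k HK'); [lia|lra]. }
    change (qvar (ck :: K)) with (w + u).
    change (qdef (ck :: K)) with (w ^ 2 / 2 + qdef K).
    apply Rle_trans with
      (lsum (fun k => lsum (fun j => pw j w * gap (k - j)%nat) (seq 0 (S k)) +
                      lsum (fun j => e j * pw (k - j) u) (seq 0 (S k))) (seq 0 m)).
    + apply lsum_le. intros k Hk. apply in_seq in Hk.
      rewrite (alpha_cons nu P M), pw_plus by (assumption || lia).
      rewrite <- lsum_minus, <- lsum_plus. apply lsum_le. intros j Hj. apply in_seq in Hj.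
      destruct (alpha_bounds nu P M Q K (k - j) HK') as [A1 A2]; [lia|]. fold u in A2.
      destruct (beta_bounds nu P M Q ck K j HK) as [B1 B2]. fold w in B2.
      assert (Hbe : pw j w - beta Q nu ck j <= e j).
      { unfold e. destruct (le_lt_dec 2 j) as [H|H]; [lra|].
        destruct j as [|[|j]]; [| |lia].
        - rewrite pw_0, beta_0 by assumption; lra.
        - rewrite (beta_1 nu P M Q ck K HK). unfold pw, w; simpl. lra. }
      unfold gap. specialize (He j). set (a := alpha Q nu K (k - j)) in *.
      set (b := beta Q nu ck j) in *. set (g := pw (k - j) u) in *.
      assert ((pw j w - b) * a <= e j * g).
      { apply Rle_trans with (e j * a).
        - apply Rmult_le_compat_r; lra.
        - apply Rmult_le_compat_l; lra. }
      nra.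
    + rewrite lsum_plus, Rmult_plus_distr_r, exp_plus, Rplus_comm.
      assert (Hew := exp_pos w). assert (Heu := exp_pos u).
      apply Rplus_le_compat.
      * eapply Rle_trans.
        { apply (convolution_le e (fun k => pw k u)); [assumption|]. intros; now apply pw_nonneg. }
        rewrite <- Rmult_assoc. apply Rmult_le_compat.
        -- apply lsum_nonneg; auto.
        -- apply lsum_nonneg; intros; now apply pw_nonneg.
        -- now apply pw_sum_from_2.
        -- now apply pw_sum_exp.
      * eapply Rle_trans.
        { apply (convolution_le (fun j => pw j w) gap); [intros; now apply pw_nonneg|assumption]. }
        replace (qdef K * (exp w * exp u)) with (exp w * (qdef K * exp u)) by ring.
        apply Rmult_le_compat.
        -- apply lsum_nonneg; intros; now apply pw_nonneg.
        -- apply lsum_nonneg; intros k Hk; apply in_seq in Hk; apply Hgap; lia.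
        -- now apply pw_sum_exp.
        -- exact IH.
Qed.

(** * Characteristic functions *)

Lemma derivable_pt_lim_pw (n : nat) (x : R) : derivable_pt_lim (pw (S n)) x (pw n x).
Proof.
  assert (H := derivable_pt_lim_scal (fun y => y ^ S n) (/ INR (fact (S n))) x
                 (INR (S n) * x ^ n) (derivable_pt_lim_pow x (S n))).
  replace (pw n x) with (/ INR (fact (S n)) * (INR (S n) * x ^ n)).
  - apply (derivable_pt_lim_ext _ _ _ _ (fun y => Rmult_comm _ _) H).
  - rewrite fact_simpl, mult_INR. unfold pw. field.
    split; [apply INR_fact_neq_0|apply not_0_INR; lia].
Qed.

(** Both [pw (S n) + f] and [pw (S n) - f] start at 0 and have nonnegative derivative on the
    positive axis. *)
Lemma bound_by_derivative (f f' : R -> R) (n : nat) :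
  f 0 = 0 -> (forall y, derivable_pt_lim f y (f' y)) ->
  (forall y, 0 <= y -> Rabs (f' y) <= pw n y) -> forall y, 0 <= y -> Rabs (f y) <= pw (S n) y.
Proof.
  intros H0 Hd Hb y [Hy| <-].
  2:{ rewrite H0, Rabs_R0. apply pw_nonneg; lra. }
  assert (Hp0 : pw (S n) 0 = 0) by (unfold pw; rewrite pow_i by lia; unfold Rdiv; ring).
  apply Rabs_le. split.
  - destruct (MVT_cor2 (fun y => pw (S n) y + f y) (fun y => pw n y + f' y) 0 y Hy) as [c [Hc1 Hc2]].
    { intros c _. apply derivable_pt_lim_plus; [apply derivable_pt_lim_pw|apply Hd]. }
    rewrite H0, Hp0 in Hc1.
    assert (H := Hb c). apply Rabs_le_between in H; [|lra].
    assert (0 <= (pw n c + f' c) * (y - 0)) by (apply Rmult_le_pos; lra). lra.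
  - destruct (MVT_cor2 (fun y => pw (S n) y - f y) (fun y => pw n y - f' y) 0 y Hy) as [c [Hc1 Hc2]].
    { intros c _. apply derivable_pt_lim_minus; [apply derivable_pt_lim_pw|apply Hd]. }
    rewrite H0, Hp0 in Hc1.
    assert (H := Hb c). apply Rabs_le_between in H; [|lra].
    assert (0 <= (pw n c - f' c) * (y - 0)) by (apply Rmult_le_pos; lra). lra.
Qed.

Definition cosT (m : nat) (y : R) : R := lsum (fun k => (-1) ^ k * pw (2 * k) y) (seq 0 m).
Definition sinT (m : nat) (y : R) : R := lsum (fun k => (-1) ^ k * pw (2 * k + 1) y) (seq 0 m).
Definition expT (m : nat) (y : R) : R := lsum (fun k => (-1) ^ k * pw k y) (seq 0 m).

Lemma pw_at_0 (n : nat) : pw (S n) 0 = 0.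
Proof. unfold pw; rewrite pow_i by lia; unfold Rdiv; ring. Qed.

Lemma derivable_sinT (m : nat) (y : R) : derivable_pt_lim (sinT m) y (cosT m y).
Proof.
  induction m as [|m IH].
  - apply derivable_pt_lim_const.
  - unfold cosT. rewrite lsum_seq_S. fold (cosT m y).
    eapply derivable_pt_lim_ext; [intros x; symmetry; apply (lsum_seq_S _ 0 m)|].
    apply derivable_pt_lim_plus; [exact IH|].
    apply derivable_pt_lim_scal. rewrite Nat.add_1_r. apply derivable_pt_lim_pw.
Qed.

Lemma derivable_cosT (m : nat) (y : R) : derivable_pt_lim (cosT (S m)) y (- sinT m y).
Proof.
  induction m as [|m IH].
  - apply (derivable_pt_lim_ext (fun _ => 1)).
    + intros x. unfold cosT; simpl. rewrite pw_0; ring.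
    + replace (- sinT 0 y) with 0 by (unfold sinT; simpl; ring). apply derivable_pt_lim_const.
  - unfold sinT. rewrite lsum_seq_S. fold (sinT m y).
    eapply derivable_pt_lim_ext; [intros x; symmetry; apply (lsum_seq_S _ 0 (S m))|].
    rewrite Ropp_plus_distr. apply derivable_pt_lim_plus; [exact IH|].
    replace (- ((-1) ^ (0 + m) * pw (2 * (0 + m) + 1) y))
      with ((-1) ^ (0 + S m) * pw (2 * m + 1) y) by (simpl; ring).
    apply derivable_pt_lim_scal.
    replace (2 * (0 + S m))%nat with (S (2 * m + 1)) by lia. apply derivable_pt_lim_pw.
Qed.

Lemma derivable_expT (m : nat) (y : R) : derivable_pt_lim (expT (S m)) y (- expT m y).
Proof.
  induction m as [|m IH].
  - apply (derivable_pt_lim_ext (fun _ => 1)).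
    + intros x. unfold expT; simpl. rewrite pw_0; ring.
    + replace (- expT 0 y) with 0 by (unfold expT; simpl; ring). apply derivable_pt_lim_const.
  - unfold expT at 2. rewrite lsum_seq_S. fold (expT m y).
    eapply derivable_pt_lim_ext; [intros x; symmetry; apply (lsum_seq_S _ 0 (S m))|].
    rewrite Ropp_plus_distr. apply derivable_pt_lim_plus; [exact IH|].
    replace (- ((-1) ^ (0 + m) * pw (0 + m) y))
      with ((-1) ^ (0 + S m) * pw m y) by (simpl; ring).
    apply derivable_pt_lim_scal. apply derivable_pt_lim_pw.
Qed.

Lemma cosT_at_0 (m : nat) : cosT (S m) 0 = 1.
Proof.
  induction m as [|m IH]; [unfold cosT; simpl; rewrite pw_0; ring|].
  unfold cosT. rewrite lsum_seq_S. fold (cosT (S m) 0). rewrite IH.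
  replace (2 * (0 + S m))%nat with (S (2 * m + 1)) by lia. rewrite pw_at_0; ring.
Qed.

Lemma sinT_at_0 (m : nat) : sinT m 0 = 0.
Proof. apply lsum_zero. intros k _. rewrite Nat.add_1_r, pw_at_0; ring. Qed.

Lemma expT_at_0 (m : nat) : expT (S m) 0 = 1.
Proof.
  induction m as [|m IH]; [unfold expT; simpl; rewrite pw_0; ring|].
  unfold expT. rewrite lsum_seq_S. fold (expT (S m) 0). rewrite IH, Nat.add_0_l.
  rewrite pw_at_0; ring.
Qed.

(** The derivative of a Taylor remainder of sine is one of cosine, and conversely up to sign.
    Alternating this lemma with [cos_step] raises the order by one each time. *)
Lemma sin_step (m n : nat) :
  (forall y, 0 <= y -> Rabs (cos y - cosT m y) <= pw n y) ->
  forall y, 0 <= y -> Rabs (sin y - sinT m y) <= pw (S n) y.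
Proof.
  apply bound_by_derivative.
  - rewrite sin_0, sinT_at_0; ring.
  - intros y. apply derivable_pt_lim_minus; [apply derivable_pt_lim_sin|apply derivable_sinT].
Qed.

Lemma cos_step (m n : nat) :
  (forall y, 0 <= y -> Rabs (sin y - sinT m y) <= pw n y) ->
  forall y, 0 <= y -> Rabs (cos y - cosT (S m) y) <= pw (S n) y.
Proof.
  intros H. apply (bound_by_derivative _ (fun y => - sin y - - sinT m y)).
  - rewrite cos_0, cosT_at_0; ring.
  - intros y. apply derivable_pt_lim_minus; [apply derivable_pt_lim_cos|apply derivable_cosT].
  - intros y Hy. replace (- sin y - - sinT m y) with (- (sin y - sinT m y)) by ring.
    rewrite Rabs_Ropp. now apply H.
Qed.

Lemma pw_even_opp (m : nat) (y : R) : pw (2 * m) (- y) = pw (2 * m) y.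
Proof. unfold pw. rewrite !pow_mult. replace ((- y) ^ 2) with (y ^ 2) by ring. reflexivity. Qed.

Lemma cosT_error (m : nat) (y : R) : Rabs (cos y - cosT m y) <= pw (2 * m) y.
Proof.
  assert (H : forall m y, 0 <= y -> Rabs (cos y - cosT m y) <= pw (2 * m) y).
  { clear. induction m as [|m IH].
    - intros y _. unfold cosT; simpl. rewrite Rminus_0_r, pw_0.
      apply Rabs_le, COS_bound.
    - replace (2 * S m)%nat with (S (S (2 * m))) by lia. now apply cos_step, sin_step. }
  destruct (Rle_dec 0 y) as [Hy|Hy]; [now apply H|].
  rewrite <- cos_neg, <- pw_even_opp.
  replace (cosT m y) with (cosT m (- y)); [apply H; lra|].
  apply lsum_ext. intros k _. now rewrite pw_even_opp.
Qed.

(** The order of the bound is [2 * m] and not the natural [2 * m + 1]: an even power is nonnegative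
    on both half lines, and its average is an even moment. *)
Lemma sinT_error (m : nat) (y : R) : Rabs (sin y - sinT m y) <= pw (2 * m) y.
Proof.
  assert (H : forall m y, 0 <= y -> Rabs (sin y - sinT m y) <= pw (2 * m) y).
  { clear. induction m as [|m IH].
    - intros y _. unfold sinT; simpl. rewrite Rminus_0_r, pw_0.
      apply Rabs_le, SIN_bound.
    - replace (2 * S m)%nat with (S (S (2 * m))) by lia. now apply sin_step, cos_step. }
  destruct (Rle_dec 0 y) as [Hy|Hy]; [now apply H|].
  rewrite <- pw_even_opp.
  replace (sin y - sinT m y) with (- (sin (- y) - sinT m (- y))).
  - rewrite Rabs_Ropp. apply H; lra.
  - rewrite sin_neg. replace (sinT m (- y)) with (- sinT m y); [ring|].
    unfold sinT. replace (- lsum (fun k => (-1) ^ k * pw (2 * k + 1) y) (seq 0 m))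
      with ((-1) * lsum (fun k => (-1) ^ k * pw (2 * k + 1) y) (seq 0 m)) by ring.
    rewrite <- lsum_scal. apply lsum_ext. intros k _.
    unfold pw. rewrite !pow_add, !pow_mult. replace ((- y) ^ 2) with (y ^ 2) by ring.
    unfold Rdiv. ring.
Qed.

Lemma expT_error (m : nat) (y : R) : 0 <= y -> Rabs (exp (- y) - expT m y) <= pw m y.
Proof.
  revert y. induction m as [|m IH]; intros y Hy.
  - unfold expT; simpl. rewrite Rminus_0_r, pw_0.
    assert (H := exp_pos (- y)). rewrite Rabs_pos_eq by lra.
    rewrite <- exp_0. apply exp_le_compat; lra.
  - revert y Hy. apply (bound_by_derivative _ (fun y => - exp (- y) - - expT m y)).
    + rewrite Ropp_0, exp_0, expT_at_0; ring.
    + intros y. apply derivable_pt_lim_minus; [|apply derivable_expT].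
      apply is_derive_Reals. auto_derive; [exact I|ring].
    + intros y Hy. replace (- exp (- y) - - expT m y) with (- (exp (- y) - expT m y)) by ring.
      rewrite Rabs_Ropp. now apply IH.
Qed.

(** Cosine and sine of the sum are replaced by Taylor polynomials. The polynomial of sine averages
    to 0, and that of cosine differs from its Gaussian counterpart by [alpha_gap]. The three copies
    of [pw m] are the truncation errors of cosine, of sine and of [exp (- q)]; the first two are
    bounded through the moment of order [2 * m]. *)
Lemma char_fun_estimate (nu : nat -> nat) (P M Q : nat) (K : list (R * nat)) (m : nat) (phi : R) :
  adm nu P M Q K -> (2 * m <= P)%nat ->
  Rabs (avg Q (fun x => cos (wsum nu K x + phi)) - cos phi * exp (- qvar K))
  <= 3 * pw m (qvar K) + qdef K * exp (qvar K).
Proof.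
  intros HK Hm. assert (HQ : (0 < Q)%nat) by (destruct HK as [_ [_ HK]]; lia).
  set (q := qvar K). assert (Hq : 0 <= q) by apply qvar_nonneg.
  assert (Htop : avg Q (fun x => pw (2 * m) (wsum nu K x)) <= pw m q)
    by (apply (alpha_bounds nu P M Q K m HK Hm)).
  assert (Hcos : Rabs (avg Q (fun x => cos (wsum nu K x)) - exp (- q))
                 <= 2 * pw m q + qdef K * exp q).
  { assert (H1 : Rabs (avg Q (fun x => cos (wsum nu K x)) - avg Q (fun x => cosT m (wsum nu K x)))
                 <= pw m q).
    { rewrite <- avg_minus. eapply Rle_trans; [now apply avg_abs|].
      eapply Rle_trans; [|exact Htop]. apply avg_le; [assumption|]. intros; apply cosT_error. }
    assert (H2 : Rabs (avg Q (fun x => cosT m (wsum nu K x)) - expT m q) <= qdef K * exp q).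
    { unfold cosT. rewrite (avg_lsum Q (fun k x => (-1) ^ k * pw (2 * k) (wsum nu K x))).
      unfold expT. rewrite <- lsum_minus. eapply Rle_trans; [apply lsum_abs|].
      eapply Rle_trans; [|apply (alpha_gap nu P M Q K m HK Hm)]. apply lsum_le.
      intros k Hk. apply in_seq in Hk. rewrite avg_scal. fold (alpha Q nu K k).
      rewrite <- Rmult_minus_distr_l, Rabs_mult, pow_1_abs, Rmult_1_l.
      destruct (alpha_bounds nu P M Q K k HK) as [A1 A2]; [lia|]. fold q in A2.
      fold q. rewrite Rabs_minus_sym, Rabs_pos_eq; lra. }
    assert (H3 := expT_error m q Hq). rewrite Rabs_minus_sym in H3.
    apply Rabs_le_between in H1, H2, H3. apply Rabs_le. lra. }
  assert (Hsin : Rabs (avg Q (fun x => sin (wsum nu K x))) <= pw m q).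
  { replace (avg Q (fun x => sin (wsum nu K x)))
      with (avg Q (fun x => sin (wsum nu K x) - sinT m (wsum nu K x))).
    - eapply Rle_trans; [now apply avg_abs|].
      eapply Rle_trans; [|exact Htop]. apply avg_le; [assumption|]. intros; apply sinT_error.
    - rewrite avg_minus. unfold sinT.
      rewrite (avg_lsum Q (fun k x => (-1) ^ k * pw (2 * k + 1) (wsum nu K x))).
      rewrite (lsum_zero (fun a => avg Q _)); [ring|].
      intros k Hk. apply in_seq in Hk. rewrite avg_scal, (odd_moment nu P M); [ring|assumption|lia]. }
  rewrite (avg_ext Q _ (fun x => cos phi * cos (wsum nu K x) - sin phi * sin (wsum nu K x)))
    by (intros x; rewrite cos_plus; ring).
  rewrite avg_minus, !avg_scal.
  set (a := avg Q (fun x => cos (wsum nu K x))) in *.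
  set (b := avg Q (fun x => sin (wsum nu K x))) in *.
  replace (cos phi * a - sin phi * b - cos phi * exp (- q))
    with (cos phi * (a - exp (- q)) + - (sin phi * b)) by ring.
  eapply Rle_trans; [apply Rabs_triang|]. rewrite Rabs_Ropp, !Rabs_mult.
  assert (Rabs (cos phi) <= 1) by (apply Rabs_le, COS_bound).
  assert (Rabs (sin phi) <= 1) by (apply Rabs_le, SIN_bound).
  assert (Rabs (cos phi) * Rabs (a - exp (- q)) <= 1 * (2 * pw m q + qdef K * exp q))
    by (apply Rmult_le_compat; auto using Rabs_pos).
  assert (Rabs (sin phi) * Rabs b <= 1 * pw m q)
    by (apply Rmult_le_compat; auto using Rabs_pos).
  lra.
Qed.

Lemma fact_double_le (q : nat) : INR (fact (2 * q)) <= 4 ^ q * (INR (fact q) * INR (fact q)).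
Proof.
  induction q as [|q IH]; [simpl; lra|].
  replace (2 * S q)%nat with (S (S (2 * q))) by lia.
  rewrite (fact_simpl (S (2 * q))), (fact_simpl (2 * q)), (fact_simpl q), !mult_INR.
  rewrite (S_INR (S (2 * q))), (S_INR (2 * q)), mult_INR, (S_INR q). change (INR 2) with 2.
  assert (Hq := pos_INR q). assert (Hf := INR_fact_lt_0 (2 * q)).
  change (4 ^ S q) with (4 * 4 ^ q).
  apply Rle_trans with ((2 * INR q + 2) * (2 * INR q + 2) * INR (fact (2 * q))); [nra|].
  apply Rle_trans with ((2 * INR q + 2) * (2 * INR q + 2) *
                        (4 ^ q * (INR (fact q) * INR (fact q)))); [|right; ring].
  apply Rmult_le_compat_l; [nra|assumption].
Qed.

(** The factorial of [2 * q] divided by [q!] is at most [4 ^ q * q!]. The remaining [q!] is what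
    yields tails close to [exp (- y)] once [q] is chosen near [y]. *)
Lemma even_moment_bound (nu : nat -> nat) (P M Q : nat) (K : list (R * nat)) (q : nat) :
  adm nu P M Q K -> (2 * q <= P)%nat ->
  avg Q (fun x => wsum nu K x ^ (2 * q)) <= INR (fact q) * (4 * qvar K) ^ q.
Proof.
  intros HK Hq. destruct (alpha_bounds nu P M Q K q HK Hq) as [_ H].
  unfold alpha in H. rewrite avg_pw in H. unfold pw in H.
  assert (Hf := INR_fact_lt_0 (2 * q)). assert (Hg := INR_fact_lt_0 q).
  assert (Hv : 0 <= qvar K ^ q) by (apply pow_le, qvar_nonneg).
  apply (proj1 (Rle_div_l _ _ _ Hf)) in H. eapply Rle_trans; [exact H|].
  rewrite Rpow_mult_distr.
  apply Rle_trans with (qvar K ^ q / INR (fact q) * (4 ^ q * (INR (fact q) * INR (fact q)))).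
  - apply Rmult_le_compat_l; [now apply Rdiv_le_0_compat|apply fact_double_le].
  - right; field; lra.
Qed.

(** * Trigonometric polynomials and their Gaussian means *)

Definition tev (l : list (R * (R * R))) (w : R) : R :=
  lsum (fun t => fst t * cos (fst (snd t) * w + snd (snd t))) l.

(* The mean of [tev l] under N(0,1/2). *)
Definition gam (l : list (R * (R * R))) : R :=
  lsum (fun t => fst t * (cos (snd (snd t)) * exp (- (fst (snd t) ^ 2 / 4)))) l.

(** [A] bounds the sum of the absolute coefficients, [T] bounds the frequencies, and [g] is the
    Gaussian mean computed from the representation; [tpoly_glim] identifies it with an integral. *)
Definition tpoly (A T : R) (f : R -> R) (g : R) : Prop :=
  exists l, lsum (fun t => Rabs (fst t)) l <= A /\ (forall t, In t l -> Rabs (fst (snd t)) <= T) /\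
    (forall w, f w = tev l w) /\ gam l = g.

Lemma tpoly_const (c : R) : tpoly (Rabs c) 0 (fun _ => c) c.
Proof.
  exists [(c, (0, 0))]. repeat split; simpl.
  - lra.
  - intros t [<-|[]]; simpl. rewrite Rabs_R0; lra.
  - intros w. unfold tev; simpl. replace (0 * w + 0) with 0 by ring. rewrite cos_0; ring.
  - unfold gam; simpl. rewrite cos_0. replace (- (0 * (0 * 1) / 4)) with 0 by field.
    rewrite exp_0; ring.
Qed.

Lemma tpoly_cos (tau phi : R) :
  tpoly 1 (Rabs tau) (fun w => cos (tau * w + phi)) (cos phi * exp (- (tau ^ 2 / 4))).
Proof.
  exists [(1, (tau, phi))]. repeat split; simpl.
  - rewrite Rabs_R1; lra.
  - intros t [<-|[]]; simpl. lra.
  - intros w. unfold tev; simpl. ring.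
  - unfold gam; simpl. ring.
Qed.

Lemma tpoly_add (A T f g A' T' f' g' : _) :
  tpoly A T f g -> tpoly A' T' f' g' -> tpoly (A + A') (Rmax T T') (fun w => f w + f' w) (g + g').
Proof.
  intros [l [H1 [H2 [H3 H4]]]] [l' [H1' [H2' [H3' H4']]]]. exists (l ++ l'). repeat split.
  - rewrite lsum_app; lra.
  - intros t Ht. apply in_app_or in Ht. destruct Ht as [Ht|Ht].
    + eapply Rle_trans; [now apply H2|apply Rmax_l].
    + eapply Rle_trans; [now apply H2'|apply Rmax_r].
  - intros w. rewrite H3, H3'. unfold tev. now rewrite lsum_app.
  - rewrite <- H4, <- H4'. unfold gam. now rewrite lsum_app.
Qed.

(** The mean of a product is not a function of the means of its factors, hence the existential
    quantifier. *)
Lemma tpoly_mul (A T f g A' T' f' g' : _) :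
  tpoly A T f g -> tpoly A' T' f' g' -> exists g2, tpoly (A * A') (T + T') (fun w => f w * f' w) g2.
Proof.
  intros [l [H1 [H2 [H3 _]]]] [l' [H1' [H2' [H3' _]]]].
  set (p := flat_map (fun t => flat_map (fun u =>
    [(fst t * fst u / 2, (fst (snd t) + fst (snd u), snd (snd t) + snd (snd u)));
     (fst t * fst u / 2, (fst (snd t) - fst (snd u), snd (snd t) - snd (snd u)))]) l') l).
  exists (gam p), p. repeat split.
  - apply Rle_trans with (lsum (fun t => Rabs (fst t)) l * lsum (fun t => Rabs (fst t)) l').
    + rewrite lsum_mul. unfold p. clear. induction l as [|t l IH]; [simpl; lra|].
      simpl. rewrite lsum_app. apply Rplus_le_compat; [|exact IH]. clear.
      induction l' as [|u l' IH]; [simpl; lra|]. simpl.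
      assert (E : Rabs (fst t * fst u / 2) = Rabs (fst t) * Rabs (fst u) / 2).
      { unfold Rdiv. rewrite !Rabs_mult, (Rabs_pos_eq (/ 2)) by lra. ring. }
      rewrite E. lra.
    + apply Rmult_le_compat; try assumption; apply lsum_nonneg; intros; apply Rabs_pos.
  - intros t Ht. apply in_flat_map in Ht. destruct Ht as [a [Ha Ht]].
    apply in_flat_map in Ht. destruct Ht as [b [Hb Ht]].
    specialize (H2 a Ha). specialize (H2' b Hb). destruct Ht as [<-|[<-|[]]]; simpl.
    + eapply Rle_trans; [apply Rabs_triang|]; lra.
    + unfold Rminus. eapply Rle_trans; [apply Rabs_triang|]. rewrite Rabs_Ropp; lra.
  - intros w. rewrite H3, H3'. unfold tev. rewrite lsum_mul. unfold p. clear.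
    induction l as [|t l IH]; [reflexivity|]. simpl. rewrite lsum_app, IH. f_equal. clear.
    induction l' as [|u l' IH]; [reflexivity|]. simpl. rewrite IH.
    replace ((fst (snd t) + fst (snd u)) * w + (snd (snd t) + snd (snd u)))
      with ((fst (snd t) * w + snd (snd t)) + (fst (snd u) * w + snd (snd u))) by ring.
    replace ((fst (snd t) - fst (snd u)) * w + (snd (snd t) - snd (snd u)))
      with ((fst (snd t) * w + snd (snd t)) - (fst (snd u) * w + snd (snd u))) by ring.
    rewrite (cos_plus (_ * w + _)), (cos_minus (_ * w + _)). field.
Qed.

Lemma tpoly_pow (A T f g : _) (n : nat) :
  tpoly A T f g -> exists g2, tpoly (A ^ n) (INR n * T) (fun w => f w ^ n) g2.
Proof.
  intros Hf. induction n as [|n [g2 IH]].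
  - exists 1. replace (A ^ 0) with (Rabs 1) by (rewrite Rabs_R1; reflexivity).
    simpl INR. rewrite Rmult_0_l. apply tpoly_const.
  - destruct (tpoly_mul _ _ _ _ _ _ _ _ Hf IH) as [g3 H]. exists g3.
    rewrite S_INR. replace ((INR n + 1) * T) with (T + INR n * T) by ring. exact H.
Qed.

Lemma tpoly_ext (A T f f' g : _) : (forall w, f' w = f w) -> tpoly A T f g -> tpoly A T f' g.
Proof.
  intros H [l [H1 [H2 [H3 H4]]]]. exists l. repeat split; try assumption.
  intros w; now rewrite H.
Qed.

Lemma tpoly_gam_bound (A T f g : _) : tpoly A T f g -> Rabs g <= A.
Proof.
  intros [l [H1 [_ [_ <-]]]]. eapply Rle_trans; [|exact H1].
  eapply Rle_trans; [apply lsum_abs|]. apply lsum_le. intros t _.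
  rewrite !Rabs_mult. rewrite <- (Rmult_1_r (Rabs (fst t))) at 2.
  apply Rmult_le_compat_l; [apply Rabs_pos|].
  assert (Rabs (cos (snd (snd t))) <= 1) by (apply Rabs_le, COS_bound).
  assert (He := exp_pos (- (fst (snd t) ^ 2 / 4))).
  assert (exp (- (fst (snd t) ^ 2 / 4)) <= 1).
  { rewrite <- exp_0. apply exp_le_compat. assert (Hp := pow2_ge_0 (fst (snd t))). lra. }
  rewrite (Rabs_pos_eq (exp _)) by lra. generalize (Rabs_pos (cos (snd (snd t)))). nra.
Qed.

Definition blk (c : R) (ks : list nat) : list (R * nat) := map (fun k => (c, k)) ks.

Definition bsum (nu : nat -> nat) (ks : list nat) (x : R) : R := lsum (fun k => xcos nu k x) ks.

Lemma map_snd_blk (c : R) (ks : list nat) : map snd (blk c ks) = ks.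
Proof. unfold blk. rewrite map_map. apply map_id. Qed.

Lemma wsum_blk (nu : nat -> nat) (c : R) (ks : list nat) (x : R) :
  wsum nu (blk c ks) x = c * bsum nu ks x.
Proof. unfold wsum, blk, bsum. rewrite lsum_map, <- lsum_scal. reflexivity. Qed.

Lemma wsum_app (nu : nat -> nat) (K K' : list (R * nat)) (x : R) :
  wsum nu (K ++ K') x = wsum nu K x + wsum nu K' x.
Proof. apply lsum_app. Qed.

Lemma qvar_blk (c : R) (ks : list nat) : qvar (blk c ks) = c ^ 2 / 4 * INR (length ks).
Proof. unfold qvar, blk. rewrite lsum_map. simpl fst. apply lsum_const. Qed.

Lemma qdef_blk (c : R) (ks : list nat) : qdef (blk c ks) = (c ^ 2 / 4) ^ 2 / 2 * INR (length ks).
Proof. unfold qdef, blk. rewrite lsum_map. simpl fst. apply lsum_const. Qed.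

Definition cf_error (m : nat) (V D : R) : R := 3 * pw m V + D * exp V.

Lemma pw_mono (m : nat) (x y : R) : 0 <= x <= y -> pw m x <= pw m y.
Proof.
  intros H. unfold pw, Rdiv. apply Rmult_le_compat_r.
  - left; apply Rinv_0_lt_compat, INR_fact_lt_0.
  - now apply pow_incr.
Qed.

Lemma cf_error_mono (m : nat) (V V' D D' : R) :
  0 <= V <= V' -> 0 <= D <= D' -> cf_error m V D <= cf_error m V' D'.
Proof.
  intros HV HD. unfold cf_error. assert (H := pw_mono m V V' HV).
  assert (D * exp V <= D' * exp V').
  { apply Rmult_le_compat; [lra|left; apply exp_pos|lra|apply exp_le_compat; lra]. }
  lra.
Qed.

Lemma cf_error_nonneg (m : nat) (V D : R) : 0 <= V -> 0 <= D -> 0 <= cf_error m V D.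
Proof.
  intros HV HD. unfold cf_error. assert (H := pw_nonneg m V HV). assert (H' := exp_pos V). nra.
Qed.

Lemma sqr_le_of_abs (t T : R) : Rabs t <= T -> 0 <= t ^ 2 <= T ^ 2.
Proof.
  intros H. split; [apply pow2_ge_0|]. rewrite <- (pow2_abs t).
  apply pow_incr. split; [apply Rabs_pos|assumption].
Qed.

(** Division by the square root of the number of retained indices gives variance 1/2, matching
    [gam]. *)
Definition wnorm (nu : nat -> nat) (ks : list nat) (x : R) : R :=
  bsum nu ks x / sqrt (INR (length ks)).

(** Each cosine of the polynomial is a characteristic function with weight [tau / sqrt h] on every
    index, for which [qvar] is [tau ^ 2 / 4] and [qdef] is [tau ^ 4 / (32 * h)]. *)
Lemma tpoly_block (nu : nat -> nat) (P M Q : nat) (ks : list nat) (m : nat) (A T f g : _) :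
  adm nu P M Q (blk 1 ks) -> (2 * m <= P)%nat -> (0 < length ks)%nat -> tpoly A T f g ->
  Rabs (avg Q (fun x => f (wnorm nu ks x)) - g)
  <= A * cf_error m (T ^ 2 / 4) (T ^ 4 / (32 * INR (length ks))).
Proof.
  intros Hadm Hm Hh [l [H1 [H2 [H3 <-]]]].
  set (h := INR (length ks)). assert (Hh' : 0 < h) by (apply lt_0_INR; lia).
  assert (Hsq : sqrt h * sqrt h = h) by (apply sqrt_sqrt; lra).
  assert (Hs : 0 < sqrt h) by (apply sqrt_lt_R0; lra).
  set (E := cf_error m (T ^ 2 / 4) (T ^ 4 / (32 * h))).
  rewrite (avg_ext Q _ (fun x => lsum (fun t => fst t * cos (fst (snd t) * wnorm nu ks x + snd (snd t))) l))
    by (intros; apply H3).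
  rewrite (avg_lsum Q (fun t x => fst t * cos (fst (snd t) * wnorm nu ks x + snd (snd t)))).
  unfold gam. rewrite <- lsum_minus. eapply Rle_trans; [apply lsum_abs|].
  apply Rle_trans with (lsum (fun t => E * Rabs (fst t)) l).
  - apply lsum_le. intros t Ht. set (tau := fst (snd t)). set (phi := snd (snd t)).
    rewrite avg_scal, <- Rmult_minus_distr_l, Rabs_mult, (Rmult_comm E).
    apply Rmult_le_compat_l; [apply Rabs_pos|].
    set (c := tau / sqrt h).
    assert (Hc2 : c ^ 2 = tau ^ 2 / h).
    { unfold c. rewrite <- Hsq at 2. field. lra. }
    assert (Hadm' : adm nu P M Q (blk c ks)).
    { unfold adm in *. now rewrite map_snd_blk in *. }
    assert (Hcf := char_fun_estimate nu P M Q (blk c ks) m phi Hadm' Hm).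
    assert (Hv : qvar (blk c ks) = tau ^ 2 / 4).
    { rewrite qvar_blk, Hc2. fold h. field; lra. }
    assert (Hd : qdef (blk c ks) = tau ^ 4 / (32 * h)).
    { rewrite qdef_blk, Hc2. fold h. field; lra. }
    rewrite Hv, Hd in Hcf.
    rewrite (avg_ext Q _ (fun x => cos (wsum nu (blk c ks) x + phi))).
    + eapply Rle_trans; [exact Hcf|]. apply cf_error_mono.
      * assert (H := sqr_le_of_abs tau T (H2 t Ht)). lra.
      * assert (H := sqr_le_of_abs tau T (H2 t Ht)).
        replace (tau ^ 4) with (tau ^ 2 * tau ^ 2) by ring.
        replace (T ^ 4) with (T ^ 2 * T ^ 2) by ring. split.
        -- apply Rdiv_le_0_compat; nra.
        -- unfold Rdiv. apply Rmult_le_compat_r; [left; apply Rinv_0_lt_compat; lra|nra].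
    + intros x. rewrite wsum_blk. unfold wnorm, c. fold h. f_equal. field. lra.
  - rewrite lsum_scal, Rmult_comm. apply Rmult_le_compat_r; [|assumption].
    assert (0 <= T ^ 2) by apply pow2_ge_0.
    apply cf_error_nonneg; [lra|]. replace (T ^ 4) with (T ^ 2 * T ^ 2) by ring.
    apply Rdiv_le_0_compat; nra.
Qed.

(** A product of two cosines is a combination of cosines of joint expressions [tau * W + tau' * W'].
    The two blocks together form one weighted sum, so [char_fun_estimate] applies, and additivity of
    [qvar] splits the Gaussian factor into a product. The arguments of [cf_error] are therefore
    twice those for one block. *)
Lemma tpoly_two_blocks (nu : nat -> nat) (P M Q : nat) (ks ks' : list nat) (m : nat) (h A T f g : _) :
  adm nu P M Q (blk 1 (ks ++ ks')) -> (2 * m <= P)%nat ->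
  0 < h -> h <= INR (length ks) -> h <= INR (length ks') -> tpoly A T f g ->
  Rabs (avg Q (fun x => f (wnorm nu ks x) * f (wnorm nu ks' x)) - g * g)
  <= A * A * cf_error m (T ^ 2 / 2) (T ^ 4 / (16 * h)).
Proof.
  intros Hadm Hm Hh Hks Hks' [l [H1 [H2 [H3 <-]]]].
  set (p := INR (length ks)) in *. set (p' := INR (length ks')) in *.
  assert (Hsq : sqrt p * sqrt p = p) by (apply sqrt_sqrt; lra).
  assert (Hs : 0 < sqrt p) by (apply sqrt_lt_R0; lra).
  assert (Hsq' : sqrt p' * sqrt p' = p') by (apply sqrt_sqrt; lra).
  assert (Hs' : 0 < sqrt p') by (apply sqrt_lt_R0; lra).
  set (E := cf_error m (T ^ 2 / 2) (T ^ 4 / (16 * h))).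
  assert (HT2 : 0 <= T ^ 2) by apply pow2_ge_0.
  assert (HE : 0 <= E).
  { apply cf_error_nonneg; [lra|]. replace (T ^ 4) with (T ^ 2 * T ^ 2) by ring.
    apply Rdiv_le_0_compat; nra. }
  assert (Hcos : forall tau tau' phi, Rabs tau <= T -> Rabs tau' <= T ->
     Rabs (avg Q (fun x => cos (tau * wnorm nu ks x + tau' * wnorm nu ks' x + phi))
           - cos phi * exp (- (tau ^ 2 / 4 + tau' ^ 2 / 4))) <= E).
  { intros tau tau' phi Ht Ht'.
    set (c := tau / sqrt p). set (c' := tau' / sqrt p').
    assert (Hc2 : c ^ 2 = tau ^ 2 / p) by (unfold c; rewrite <- Hsq at 2; field; lra).
    assert (Hc2' : c' ^ 2 = tau' ^ 2 / p') by (unfold c'; rewrite <- Hsq' at 2; field; lra).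
    assert (Hadm' : adm nu P M Q (blk c ks ++ blk c' ks')).
    { unfold adm in *. rewrite map_app, !map_snd_blk in *. exact Hadm. }
    assert (Hcf := char_fun_estimate nu P M Q _ m phi Hadm' Hm).
    assert (Hv : qvar (blk c ks ++ blk c' ks') = tau ^ 2 / 4 + tau' ^ 2 / 4).
    { unfold qvar. rewrite lsum_app. fold (qvar (blk c ks)). fold (qvar (blk c' ks')).
      rewrite !qvar_blk, Hc2, Hc2'. fold p p'. field; lra. }
    assert (Hd : qdef (blk c ks ++ blk c' ks') = tau ^ 4 / (32 * p) + tau' ^ 4 / (32 * p')).
    { unfold qdef. rewrite lsum_app. fold (qdef (blk c ks)). fold (qdef (blk c' ks')).
      rewrite !qdef_blk, Hc2, Hc2'. fold p p'. field; lra. }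
    rewrite Hv, Hd in Hcf.
    rewrite (avg_ext Q _ (fun x => cos (wsum nu (blk c ks ++ blk c' ks') x + phi))).
    - eapply Rle_trans; [exact Hcf|].
      assert (B := sqr_le_of_abs tau T Ht). assert (B' := sqr_le_of_abs tau' T Ht').
      apply cf_error_mono; [lra|].
      assert (Hq : forall s q, 0 <= s ^ 2 <= T ^ 2 -> h <= q ->
                0 <= s ^ 4 / (32 * q) <= T ^ 4 / (32 * h)).
      { intros s q Hsq2 Hq. replace (s ^ 4) with (s ^ 2 * s ^ 2) by ring.
        replace (T ^ 4) with (T ^ 2 * T ^ 2) by ring. split.
        - apply Rdiv_le_0_compat; nra.
        - unfold Rdiv. apply Rmult_le_compat; [nra| |nra|].
          + left; apply Rinv_0_lt_compat; lra.
          + apply Rinv_le_contravar; lra. }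
      assert (Q1 := Hq tau p B Hks). assert (Q2 := Hq tau' p' B' Hks').
      replace (T ^ 4 / (16 * h)) with (T ^ 4 / (32 * h) + T ^ 4 / (32 * h)) by (field; lra).
      lra.
    - intros x. rewrite wsum_app, !wsum_blk. unfold wnorm, c, c'. fold p p'. f_equal. field. lra. }
  rewrite (avg_ext Q _ (fun x => lsum (fun t => lsum (fun u =>
     fst t * fst u / 2 *
      (cos (fst (snd t) * wnorm nu ks x + fst (snd u) * wnorm nu ks' x + (snd (snd t) + snd (snd u)))
     + cos (fst (snd t) * wnorm nu ks x + - fst (snd u) * wnorm nu ks' x + (snd (snd t) - snd (snd u)))))
     l) l)).
  2:{ intros x. rewrite !H3. unfold tev. rewrite lsum_mul.
      apply lsum_ext; intros t _. apply lsum_ext; intros u _.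
      replace (fst (snd t) * wnorm nu ks x + fst (snd u) * wnorm nu ks' x + (snd (snd t) + snd (snd u)))
        with ((fst (snd t) * wnorm nu ks x + snd (snd t)) + (fst (snd u) * wnorm nu ks' x + snd (snd u)))
        by ring.
      replace (fst (snd t) * wnorm nu ks x + - fst (snd u) * wnorm nu ks' x + (snd (snd t) - snd (snd u)))
        with ((fst (snd t) * wnorm nu ks x + snd (snd t)) - (fst (snd u) * wnorm nu ks' x + snd (snd u)))
        by ring.
      rewrite (cos_plus (_ * _ + _)), (cos_minus (_ * _ + _)). field. }
  rewrite (avg_lsum Q (fun t x => lsum (fun u => fst t * fst u / 2 *
      (cos (fst (snd t) * wnorm nu ks x + fst (snd u) * wnorm nu ks' x + (snd (snd t) + snd (snd u)))
     + cos (fst (snd t) * wnorm nu ks x + - fst (snd u) * wnorm nu ks' x + (snd (snd t) - snd (snd u))))) l)).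
  unfold gam. rewrite lsum_mul, <- lsum_minus. eapply Rle_trans; [apply lsum_abs|].
  apply Rle_trans with (lsum (fun t => lsum (fun u => E * (Rabs (fst t) * Rabs (fst u))) l) l).
  - apply lsum_le. intros t Ht.
    rewrite (avg_lsum Q (fun u x => fst t * fst u / 2 *
      (cos (fst (snd t) * wnorm nu ks x + fst (snd u) * wnorm nu ks' x + (snd (snd t) + snd (snd u)))
     + cos (fst (snd t) * wnorm nu ks x + - fst (snd u) * wnorm nu ks' x + (snd (snd t) - snd (snd u)))))).
    rewrite <- lsum_minus. eapply Rle_trans; [apply lsum_abs|]. apply lsum_le. intros u Hu.
    rewrite avg_scal, avg_plus.
    assert (C1 := Hcos _ _ (snd (snd t) + snd (snd u)) (H2 t Ht) (H2 u Hu)).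
    assert (Hu' : Rabs (- fst (snd u)) <= T) by (rewrite Rabs_Ropp; auto).
    assert (C2 := Hcos _ _ (snd (snd t) - snd (snd u)) (H2 t Ht) Hu').
    set (a1 := avg Q _) in *. set (a2 := avg Q _) in C2 |- *.
    replace ((- fst (snd u)) ^ 2) with (fst (snd u) ^ 2) in C2 by ring.
    rewrite Ropp_plus_distr, exp_plus in C1, C2.
    rewrite cos_plus in C1. rewrite cos_minus in C2.
    set (e := exp (- (fst (snd t) ^ 2 / 4))) in *. set (e' := exp (- (fst (snd u) ^ 2 / 4))) in *.
    set (ct := cos (snd (snd t))) in *. set (cu := cos (snd (snd u))) in *.
    set (st := sin (snd (snd t))) in *. set (su := sin (snd (snd u))) in *.
    replace (fst t * fst u / 2 * (a1 + a2) - fst t * (ct * e) * (fst u * (cu * e')))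
      with ((fst t * fst u) *
            (((a1 - (ct * cu - st * su) * (e * e')) + (a2 - (ct * cu + st * su) * (e * e'))) / 2))
      by field.
    rewrite Rabs_mult, Rabs_mult, Rmult_comm. apply Rmult_le_compat_r.
    + apply Rmult_le_pos; apply Rabs_pos.
    + apply Rabs_le_between in C1, C2. apply Rabs_le. lra.
  - rewrite (lsum_ext _ (fun t => E * lsum (fun u => Rabs (fst t) * Rabs (fst u)) l))
      by (intros; apply lsum_scal).
    rewrite lsum_scal, <- lsum_mul, Rmult_comm. apply Rmult_le_compat_r; [assumption|].
    assert (0 <= lsum (fun t => Rabs (fst t)) l) by (apply lsum_nonneg; intros; apply Rabs_pos).
    apply Rmult_le_compat; assumption.
Qed.

(** * Outer measure *)

(* The outer measure of [E] is at most [s]. *)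
Definition mle (E : R -> Prop) (s : R) : Prop :=
  forall delta, 0 < delta -> exists s', interval_cover_sum E s' /\ s' < s + delta.

Lemma mle_mono (E F : R -> Prop) (s t : R) :
  (forall x, F x -> E x) -> s <= t -> mle E s -> mle F t.
Proof.
  intros HEF Hst HE delta Hd. destruct (HE delta Hd) as [s' [[a [b [H1 [H2 H3]]]] Hs']].
  exists s'. split; [|lra]. exists a, b. auto.
Qed.

Lemma nonneg_series_cv (f : nat -> R) (S : R) :
  (forall i, 0 <= f i) -> (forall n, lsum f (seq 0 n) <= S) ->
  exists s, s <= S /\ infinite_sum f s.
Proof.
  intros Hf HS.
  destruct (growing_cv (sum_f_R0 f)) as [s Hs].
  - intros n. simpl. specialize (Hf (Datatypes.S n)). lra.
  - exists S. intros y [n ->]. rewrite sum_f_R0_lsum. apply HS.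
  - exists s. split; [|exact Hs].
    destruct (Rle_lt_dec s S) as [H|H]; [assumption|].
    destruct (Hs (s - S)) as [N HN]; [lra|]. specialize (HN N (le_n N)).
    unfold Rdist in HN. apply Rabs_def2 in HN.
    assert (HSN := HS (Datatypes.S N)). rewrite <- sum_f_R0_lsum in HSN. lra.
Qed.

Lemma partial_sum_le (f : nat -> R) (s : R) (n : nat) :
  (forall i, 0 <= f i) -> infinite_sum f s -> lsum f (seq 0 n) <= s.
Proof.
  intros Hf Hs. apply Rle_trans with (lsum f (seq 0 (S n))).
  - apply lsum_seq_mono; [lia|assumption].
  - rewrite <- sum_f_R0_lsum. now apply sum_incr.
Qed.

Lemma lsum_incl {A : Type} (f : A -> R) (l l' : list A) :
  (forall a, 0 <= f a) -> NoDup l -> incl l l' -> lsum f l <= lsum f l'.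
Proof.
  intros Hf. revert l'; induction l as [|a l IH]; intros l' Hnd Hinc.
  - simpl. apply lsum_nonneg; auto.
  - inversion Hnd as [|? ? Ha Hnd']; subst.
    destruct (in_split a l') as [l1 [l2 ->]]; [apply Hinc; now left|].
    rewrite lsum_app. simpl.
    assert (H : lsum f l <= lsum f (l1 ++ l2)).
    { apply IH; [assumption|]. intros x Hx.
      assert (Hx' : In x (l1 ++ a :: l2)) by (apply Hinc; now right).
      apply in_app_or in Hx'. apply in_or_app.
      destruct Hx' as [Hx'|[<-|Hx']]; [now left|contradiction|now right]. }
    rewrite lsum_app in H. lra.
Qed.

(** Countable subadditivity. The [n]-th set receives the extra allowance [delta / 4 * (1 / 2) ^ n],
    and the double family of intervals is enumerated by Cantor pairing. *)
Lemma mle_countable_union (E : nat -> R -> Prop) (s : nat -> R) (S : R) :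
  (forall n, mle (E n) (s n)) -> (forall m, lsum s (seq 0 m) <= S) ->
  mle (fun x => exists n, E n x) S.
Proof.
  intros HE HS delta Hd.
  assert (Hch : forall n, exists ab : (nat -> R) * (nat -> R),
    (forall i, fst ab i <= snd ab i) /\
    (forall x, E n x -> exists i, fst ab i < x < snd ab i) /\
    (forall m, lsum (fun i => snd ab i - fst ab i) (seq 0 m) <= s n + delta / 4 * (1 / 2) ^ n)).
  { intros n. assert (Hp : 0 < delta / 4 * (1 / 2) ^ n)
      by (apply Rmult_lt_0_compat; [lra|apply pow_lt; lra]).
    destruct (HE n _ Hp) as [s' [[a [b [H1 [H2 H3]]]] H4]]. exists (a, b). simpl.
    repeat split; [assumption|assumption|]. intros m. apply Rle_trans with s'; [|lra].
    apply (partial_sum_le (fun i => b i - a i)); [|exact H3].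
    intros i; specialize (H1 i); lra. }
  set (ab := fun n => proj1_sig (constructive_indefinite_description _ (Hch n))).
  assert (Hab : forall n, (forall i, fst (ab n) i <= snd (ab n) i) /\
    (forall x, E n x -> exists i, fst (ab n) i < x < snd (ab n) i) /\
    (forall m, lsum (fun i => snd (ab n) i - fst (ab n) i) (seq 0 m)
               <= s n + delta / 4 * (1 / 2) ^ n))
    by (intros n; exact (proj2_sig (constructive_indefinite_description _ (Hch n)))).
  clearbody ab.
  set (g := fun p : nat * nat => snd (ab (fst p)) (snd p) - fst (ab (fst p)) (snd p)).
  assert (Hg : forall p, 0 <= g p).
  { intros [n k]. destruct (Hab n) as [H _]. specialize (H k). unfold g; simpl. lra. }
  assert (Hbound : forall n, lsum (fun i => g (Cantor.of_nat i)) (seq 0 n) <= S + delta / 2).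
  { intros n. rewrite <- (lsum_map g Cantor.of_nat).
    (* Finitely many pairs lie in a square, over which the sum can be taken row by row. *)
    set (N := fold_right Nat.max 0%nat
       (map (fun p : nat * nat => Datatypes.S (fst p + snd p)) (map Cantor.of_nat (seq 0 n)))).
    assert (HN : forall p, In p (map Cantor.of_nat (seq 0 n)) -> (fst p < N /\ snd p < N)%nat).
    { unfold N. induction (map Cantor.of_nat (seq 0 n)) as [|q l IH]; [simpl; tauto|].
      intros p [->|Hp]; cbn [map fold_right]; [lia|]. specialize (IH p Hp). lia. }
    apply Rle_trans with (lsum g (list_prod (seq 0 N) (seq 0 N))).
    - apply lsum_incl; [assumption| |].
      + apply FinFun.Injective_map_NoDup; [|apply seq_NoDup].
        intros i j Hij. rewrite <- (Cantor.cancel_to_of i), <- (Cantor.cancel_to_of j). congruence.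
      + intros [p q] Hpq. destruct (HN _ Hpq). simpl in *.
        apply in_prod; apply in_seq; lia.
    - assert (Hprod : forall l, lsum g (list_prod l (seq 0 N))
                = lsum (fun p => lsum (fun q => g (p, q)) (seq 0 N)) l).
      { induction l as [|p l IH]; [reflexivity|]. simpl. now rewrite lsum_app, IH, lsum_map. }
      rewrite Hprod.
      apply Rle_trans with (lsum (fun p => s p + delta / 4 * (1 / 2) ^ p) (seq 0 N)).
      + apply lsum_le. intros p _. apply (proj2 (proj2 (Hab p))).
      + rewrite lsum_plus, (lsum_scal (delta / 4) (fun p => (1 / 2) ^ p)). specialize (HS N).
        assert (Hgeo : lsum (fun p => (1 / 2) ^ p) (seq 0 N) = 2 - 2 * (1 / 2) ^ N).
        { clear. induction N as [|N IH]; [simpl; ring|].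
          rewrite lsum_seq_S, IH. simpl. field. }
        assert (0 <= (1 / 2) ^ N) by (apply pow_le; lra). rewrite Hgeo. nra. }
  destruct (nonneg_series_cv (fun i => g (Cantor.of_nat i)) (S + delta / 2)) as [s0 [Hs0 Hsum]];
    [intros; apply Hg|assumption|].
  exists s0. split; [|lra].
  exists (fun i => fst (ab (fst (Cantor.of_nat i))) (snd (Cantor.of_nat i))),
         (fun i => snd (ab (fst (Cantor.of_nat i))) (snd (Cantor.of_nat i))).
  repeat split.
  - intros i. apply Hab.
  - intros x [n Hx]. destruct (Hab n) as [_ [H _]]. destruct (H x Hx) as [k Hk].
    exists (Cantor.to_nat (n, k)). rewrite Cantor.cancel_of_to. exact Hk.
  - exact Hsum.
Qed.

Lemma null_set_mle (E : R -> Prop) : mle E 0 -> null_set E.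
Proof. intros H eps He. destruct (H eps He) as [s [H1 H2]]. exists s. split; [assumption|lra]. Qed.

Lemma mle_null_set (E : R -> Prop) : null_set E -> mle E 0.
Proof. intros H eps He. destruct (H eps He) as [s [H1 H2]]. exists s. split; [assumption|lra]. Qed.

Lemma null_set_countable_union (E : nat -> R -> Prop) :
  (forall n, null_set (E n)) -> null_set (fun x => exists n, E n x).
Proof.
  intros H. apply null_set_mle, (mle_countable_union E (fun _ => 0)).
  - intros n; now apply mle_null_set.
  - intros m. rewrite lsum_const; lra.
Qed.

Lemma null_set_mono (E F : R -> Prop) : (forall x, F x -> E x) -> null_set E -> null_set F.
Proof.
  intros H HE. apply null_set_mle, (mle_mono E _ 0); [assumption|lra|now apply mle_null_set].
Qed.

Lemma null_set_or (E F : R -> Prop) :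
  null_set E -> null_set F -> null_set (fun x => E x \/ F x).
Proof.
  intros HE HF.
  apply (null_set_mono (fun x => exists n : nat, (if Nat.eq_dec n 0 then E else F) x)).
  - intros x [H|H]; [exists 0%nat|exists 1%nat]; exact H.
  - apply null_set_countable_union. intros n. destruct (Nat.eq_dec n 0); assumption.
Qed.

(** The first Borel-Cantelli lemma. Summability is expressed through finite pieces of the tail, the
    form that [tail_sum_small] provides. *)
Lemma borel_cantelli (E : nat -> R -> Prop) (s : nat -> R) (i1 : nat) :
  (forall i, (i1 <= i)%nat -> mle (E i) (s i)) ->
  (forall eps, 0 < eps -> exists i0, forall i m, (i0 <= i)%nat -> lsum s (seq i m) <= eps) ->
  null_set (fun x => forall i0, exists i, (i0 <= i)%nat /\ E i x).
Proof.
  intros HE Hs. apply null_set_mle. intros eps Heps.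
  destruct (Hs (eps / 2)) as [i0 Hi0]; [lra|].
  set (j0 := Nat.max i0 i1).
  assert (H : mle (fun x => exists n, E (j0 + n)%nat x) (eps / 2)).
  { apply (mle_countable_union _ (fun n => s (j0 + n)%nat)).
    - intros n. apply HE. lia.
    - intros m. specialize (Hi0 j0 m). rewrite <- (Nat.add_0_r j0) in Hi0 at 2.
      assert (Hsh : lsum s (seq (j0 + 0) m) = lsum (fun n => s (j0 + n)%nat) (seq 0 m)).
      { clear. induction m as [|m IH]; [reflexivity|].
        rewrite !lsum_seq_S, IH. do 2 f_equal. lia. }
      rewrite <- Hsh. apply Hi0. lia. }
  destruct (H (eps / 2)) as [s' [[a [b [H1 [H2 H3]]]] H4]]; [lra|].
  exists s'. split; [|lra]. exists a, b. repeat split; try assumption.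
  intros x Hx. apply H2. destruct (Hx j0) as [i [Hi HEi]]. exists (i - j0)%nat.
  now replace (j0 + (i - j0))%nat with i by lia.
Qed.

(** Induction on the number of intervals: removing one that contains the right end [v] leaves a
    cover of the segment from [u] to the left end of the removed interval. *)
Lemma finite_cover_length (L : list (R * R)) (u v : R) :
  (forall x, u <= x <= v -> exists I, In I L /\ fst I < x < snd I) ->
  (forall I, In I L -> fst I <= snd I) -> v - u <= lsum (fun I => snd I - fst I) L.
Proof.
  remember (length L) as n eqn:En. revert L v En.
  induction n as [|n IH]; intros L v En Hcov Hle.
  - destruct L; [|discriminate]. simpl. destruct (Rle_lt_dec u v) as [H|H]; [|lra].
    destruct (Hcov u) as [I [[] _]]; lra.
  - destruct (Rle_lt_dec u v) as [Huv|Huv].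
    2:{ assert (0 <= lsum (fun I => snd I - fst I) L); [|lra].
        apply lsum_nonneg. intros I HI. specialize (Hle I HI). lra. }
    destruct (Hcov v) as [I [HI Hv]]; [lra|].
    destruct (in_split I L HI) as [L1 [L2 ->]].
    assert (H : fst I - u <= lsum (fun I => snd I - fst I) (L1 ++ L2)).
    { apply IH.
      - rewrite length_app in *. simpl in En. lia.
      - intros x Hx. destruct (Hcov x) as [K [HK Hxk]]; [lra|].
        exists K. split; [|assumption]. apply in_app_or in HK. apply in_or_app.
        destruct HK as [HK|[<-|HK]]; [now left|lra|now right].
      - intros K HK. apply Hle. apply in_app_or in HK. apply in_or_app.
        simpl. tauto. }
    rewrite lsum_app in *. simpl. lra.
Qed.

(** Heine-Borel, by the supremum of the points up to which finitely many intervals suffice. *)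
Lemma unit_interval_finite_subcover (a b : nat -> R) :
  (forall x, 0 <= x <= 1 -> exists i, a i < x < b i) ->
  exists n, forall x, 0 <= x <= 1 -> exists i, (i < n)%nat /\ a i < x < b i.
Proof.
  intros Hcov.
  set (Pr := fun t => exists n, forall x, 0 <= x <= t -> exists i, (i < n)%nat /\ a i < x < b i).
  destruct (completeness (fun t => 0 <= t <= 1 /\ Pr t)) as [c [Hub Hlub]].
  - exists 1. intros t [Ht _]; lra.
  - exists 0. split; [lra|]. destruct (Hcov 0) as [i Hi]; [lra|].
    exists (S i). intros x Hx. exists i. split; [lia|]. replace x with 0 by lra. exact Hi.
  - assert (Hc1 : c <= 1) by (apply Hlub; intros t [Ht _]; lra).
    assert (Hc0 : 0 <= c).
    { apply Hub. split; [lra|]. destruct (Hcov 0) as [i Hi]; [lra|].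
      exists (S i). intros x Hx. exists i. split; [lia|]. replace x with 0 by lra. exact Hi. }
    destruct (Hcov c) as [i Hi]; [lra|].
    assert (Hext : forall t', t' < b i -> Pr t').
    { intros t' Ht'.
      assert (Hex : exists t, (0 <= t <= 1 /\ Pr t) /\ a i < t).
      { apply NNPP. intros Hno. assert (c <= a i); [|lra]. apply Hlub. intros t Ht.
        destruct (Rle_lt_dec t (a i)) as [H|H]; [assumption|]. exfalso. apply Hno. exists t; auto. }
      destruct Hex as [t [[Ht [n Hn]] Hat]].
      exists (Nat.max n (S i)). intros x Hx.
      destruct (Rle_lt_dec x t) as [Hxt|Hxt].
      - destruct (Hn x) as [j [Hj Hxj]]; [lra|]. exists j. split; [lia|assumption].
      - exists i. split; [lia|lra]. }
    destruct (Rlt_le_dec c 1) as [Hlt|Hge].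
    + exfalso. set (t' := Rmin 1 ((c + b i) / 2)).
      assert (Ht' : c < t' /\ t' <= 1 /\ t' < b i).
      { unfold t', Rmin; destruct (Rle_dec 1 ((c + b i) / 2)); lra. }
      assert (t' <= c); [|lra]. apply Hub. split; [lra|]. apply Hext; lra.
    + assert (E : c = 1) by lra. destruct (Hext 1) as [n Hn]; [lra|]. exists n. exact Hn.
Qed.

Lemma unit_interval_cover (s : R) : mle (fun x => 0 <= x <= 1) s -> 1 <= s.
Proof.
  intros H.
  assert (Hd : forall d, 0 < d -> 1 <= s + d).
  { intros d Hd. destruct (H d Hd) as [s' [[a [b [H1 [H2 H3]]]] H4]].
    destruct (unit_interval_finite_subcover a b H2) as [n Hn].
    assert (1 - 0 <= lsum (fun I => snd I - fst I) (map (fun i => (a i, b i)) (seq 0 n))).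
    { apply finite_cover_length.
      - intros x Hx. destruct (Hn x Hx) as [i [Hi Hxi]]. exists (a i, b i).
        split; [|exact Hxi]. apply (in_map (fun i => (a i, b i))), in_seq; lia.
      - intros I HI. apply in_map_iff in HI. destruct HI as [i [<- _]]. apply H1. }
    rewrite lsum_map in H0. simpl in H0.
    assert (lsum (fun i => b i - a i) (seq 0 n) <= s').
    { apply partial_sum_le; [|assumption]. intros i. specialize (H1 i). lra. }
    lra. }
  destruct (Rle_lt_dec 1 s) as [Hs|Hs]; [assumption|].
  specialize (Hd ((1 - s) / 2)). lra.
Qed.

(** Through this inequality an upper bound for a set gives a lower bound for its complement, in
    place of additivity on measurable sets. *)
Lemma mle_cover_unit (E F : R -> Prop) (s t : R) :
  (forall x, 0 <= x <= 1 -> E x \/ F x) -> mle E s -> mle F t -> 0 <= s -> 0 <= t -> 1 <= s + t.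
Proof.
  intros H HE HF Hs Ht. apply unit_interval_cover.
  apply (mle_mono (fun x => exists n : nat, (match n with O => E | S O => F | _ => fun _ => False end) x)
           _ (s + t)).
  - intros x Hx. destruct (H x Hx) as [HEx|HFx]; [exists 0%nat|exists 1%nat]; assumption.
  - lra.
  - apply (mle_countable_union _ (fun n => match n with O => s | S O => t | _ => 0 end)).
    + intros [|[|n]]; [assumption|assumption|]. intros d Hd. exists 0. split; [|lra].
      exists (fun _ => 0), (fun _ => 0). split; [intros; lra|split; [tauto|]].
      intros eps Heps. exists 0%nat. intros k _. rewrite (sum_eq _ (fun _ => 0)) by (intros; ring).
      rewrite sum_eq_R0 by reflexivity. rewrite Rdist_eq. assumption.
    + intros m. apply Rle_trans with
        (lsum (fun n => match n with O => s | S O => t | _ => 0 end) (seq 0 (S (S m)))).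
      * apply lsum_seq_mono; [lia|]. intros [|[|k]]; lra.
      * simpl. rewrite lsum_zero; [lra|]. intros k Hk. apply in_seq in Hk.
        destruct k as [|[|k]]; [lia|lia|reflexivity].
Qed.

Lemma outer_le_mle (E : R -> Prop) (m s : R) : lebesgue_outer_is E m -> mle E s -> m <= s.
Proof.
  intros [H _] Hs. destruct (Rle_lt_dec m s) as [Hle|Hlt]; [assumption|].
  destruct (Hs (m - s)) as [s' [H1 H2]]; [lra|]. specialize (H s' H1). lra.
Qed.

Lemma outer_mle (E : R -> Prop) (m : R) : lebesgue_outer_is E m -> mle E m.
Proof. intros [_ H]. exact H. Qed.

Lemma infinite_sum_finite (f : nat -> R) (N : nat) :
  (forall i, (N <= i)%nat -> f i = 0) -> infinite_sum f (lsum f (seq 0 N)).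
Proof.
  intros Hf eps Heps. exists N. intros n Hn. rewrite sum_f_R0_lsum.
  replace (S n) with (N + (S n - N))%nat by lia. rewrite seq_app, lsum_app.
  rewrite (lsum_zero f (seq (0 + N) _)).
  - rewrite Rplus_0_r, Rdist_eq. assumption.
  - intros i Hi. apply in_seq in Hi. apply Hf; lia.
Qed.

Lemma grid_cell (Q : nat) (x : R) : (0 < Q)%nat -> 0 <= x <= 1 ->
  exists i, (i < Q)%nat /\ INR i / INR Q <= x <= (INR i + 1) / INR Q.
Proof.
  intros HQ Hx. assert (HQ' : 0 < INR Q) by (apply lt_0_INR; lia).
  assert (H : forall n, (0 < n <= Q)%nat -> x <= INR n / INR Q ->
            exists i, (i < Q)%nat /\ INR i / INR Q <= x <= (INR i + 1) / INR Q).
  { induction n as [|n IH]; [lia|]. intros Hn Hxn. rewrite S_INR in Hxn.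
    destruct (Rle_lt_dec (INR n / INR Q) x) as [Hle|Hlt].
    - exists n. split; [lia|]. split; assumption.
    - apply IH; [|lra]. split; [|lia]. destruct n as [|n]; [|lia].
      simpl in Hlt. unfold Rdiv in Hlt. rewrite Rmult_0_l in Hlt. lra. }
  apply (H Q); [lia|]. rewrite Rdiv_diag; lra.
Qed.

(* Markov's inequality, with the grid average in place of the integral. *)
Lemma mle_avg (E : R -> Prop) (G : R -> R) (delta : R) :
  (forall x, continuity_pt G x) -> (forall x, 0 <= G x) ->
  (forall x, E x -> 0 <= x <= 1 /\ 1 <= G x) -> 0 < delta ->
  exists Q0, forall Q, (Q0 <= Q)%nat -> mle E (avg Q G + delta).
Proof.
  intros Hc HG HE Hd. set (d := delta / 4). assert (Hd' : 0 < d) by (unfold d; lra).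
  destruct (@Heine_cor2 G 0 1 (fun x _ => Hc x) (mkposreal d Hd')) as [[r Hr] Hunif]. simpl in Hunif.
  destruct (INR_unbounded (/ r)) as [Q0 HQ0]. exists (S Q0). intros Q HQ.
  assert (HQ' : 0 < INR Q) by (apply lt_0_INR; lia).
  assert (HQr : / INR Q < r).
  { assert (Hlt : / r < INR Q) by (eapply Rlt_le_trans; [exact HQ0|apply le_INR; lia]).
    rewrite <- (Rinv_inv r). apply Rinv_lt_contravar; [|assumption].
    apply Rmult_lt_0_compat; [now apply Rinv_0_lt_compat|assumption]. }
  (* Selected are the cells at whose left end [G] is at least [1 - d]; by uniform continuity they
     cover [E]. Each is widened by [d / Q] on both sides so that the open intervals contain the
     closed cells. *)
  set (sel := fun i => if le_lt_dec Q i then false else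
                if Rle_dec (1 - d) (G (INR i / INR Q)) then true else false).
  set (a := fun i => if sel i then (INR i - d) / INR Q else 0).
  set (b := fun i => if sel i then (INR i + 1 + d) / INR Q else 0).
  intros eps Heps. exists (lsum (fun i => b i - a i) (seq 0 Q)). split.
  - exists a, b. repeat split.
    + intros i. unfold a, b. destruct (sel i); [|lra].
      unfold Rdiv. apply Rmult_le_compat_r; [left; now apply Rinv_0_lt_compat|lra].
    + intros x Hx. destruct (HE x Hx) as [Hx01 HGx].
      destruct (grid_cell Q x) as [i [Hi [Hx1 Hx2]]]; [lia|assumption|]. exists i.
      assert (Hs : sel i = true).
      { unfold sel. destruct (le_lt_dec Q i); [lia|].
        destruct (Rle_dec (1 - d) (G (INR i / INR Q))) as [_|Hno]; [reflexivity|].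
        exfalso. apply Hno.
        assert (Hu : Rabs (G x - G (INR i / INR Q)) < d).
        { apply Hunif; [assumption| |].
          - split; [|lra]. apply Rdiv_le_0_compat; [apply pos_INR|assumption].
          - replace ((INR i + 1) / INR Q) with (INR i / INR Q + / INR Q) in Hx2 by (field; lra).
            rewrite Rabs_pos_eq; lra. }
        apply Rabs_def2 in Hu. lra. }
      unfold a, b. rewrite Hs. split.
      * eapply Rlt_le_trans; [|exact Hx1]. unfold Rdiv.
        apply Rmult_lt_compat_r; [now apply Rinv_0_lt_compat|lra].
      * eapply Rle_lt_trans; [exact Hx2|]. unfold Rdiv.
        apply Rmult_lt_compat_r; [now apply Rinv_0_lt_compat|lra].
    + apply infinite_sum_finite. intros i Hi. unfold a, b, sel.
      destruct (le_lt_dec Q i); [ring|lia].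
  - assert (Hsum : lsum (fun i => b i - a i) (seq 0 Q)
        <= lsum (fun i => / INR Q * (G (INR i / INR Q) + 3 * d)) (seq 0 Q)).
    { apply lsum_le. intros i Hi. apply in_seq in Hi. unfold a, b, sel.
      assert (Hq := Rinv_0_lt_compat _ HQ').
      assert (HGi := HG (INR i / INR Q)).
      destruct (le_lt_dec Q i); [lia|].
      destruct (Rle_dec (1 - d) (G (INR i / INR Q))) as [Hy|Hn].
      - replace ((INR i + 1 + d) / INR Q - (INR i - d) / INR Q) with (/ INR Q * (1 + 2 * d))
          by (field; lra).
        apply Rmult_le_compat_l; lra.
      - rewrite Rminus_0_r. apply Rmult_le_pos; lra. }
    rewrite lsum_scal, lsum_plus, lsum_const, length_seq in Hsum.
    rewrite Rmult_plus_distr_l in Hsum.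
    replace (/ INR Q * (3 * d * INR Q)) with (3 * d) in Hsum by (field; lra).
    unfold avg, Rdiv. rewrite Rmult_comm. unfold d in *. lra.
Qed.

(** * Gaussian integrals *)

(* Coquelicot states some equalities at a structure carrier convertible to [R], which [ring] and
   [field] do not recognize. *)
Ltac real_eq := match goal with |- ?a = ?b => change (@eq R a b) end.

Lemma continuous_of_ex_derive (f : R -> R) (x : R) : ex_derive f x -> continuous f x.
Proof. apply (ex_derive_continuous (K := R_AbsRing) (V := R_NormedModule)). Qed.

Lemma ex_RInt_cont (f : R -> R) (a b : R) : (forall x, continuous f x) -> ex_RInt f a b.
Proof. intros H. apply (ex_RInt_continuous (V := R_CompleteNormedModule)). intros; apply H. Qed.

Lemma is_derive_eq (f : R -> R) (x l l' : R) : is_derive f x l -> l = l' -> is_derive f x l'.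
Proof. now intros H <-. Qed.

Definition gexp (u : R) : R := exp (- u ^ 2).

Lemma gexp_pos (u : R) : 0 < gexp u.
Proof. apply exp_pos. Qed.

Lemma continuous_gexp (u : R) : continuous gexp u.
Proof.
  unfold gexp. apply continuous_of_ex_derive. auto_derive. exact I.
Qed.

Lemma exp_neg_small (eps : R) : 0 < eps -> exists M0, 0 < M0 /\
  forall M, M0 <= M -> exp (- M ^ 2) < eps.
Proof.
  intros He. exists (1 + / eps).
  assert (Hi := Rinv_0_lt_compat _ He). split; [lra|]. intros M HM.
  rewrite exp_Ropp. rewrite <- (Rinv_inv eps).
  apply Rinv_lt_contravar; [apply Rmult_lt_0_compat; [assumption|apply exp_pos]|].
  apply Rlt_le_trans with (M ^ 2); [|apply le_exp].
  assert (M <= M ^ 2) by (simpl; nra). lra.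
Qed.

Lemma const_of_zero_derivative (f : R -> R) (x : R) :
  (forall y, is_derive f y 0) -> f x = f 0.
Proof.
  intros H. destruct (Rtotal_order 0 x) as [Hx|[<-|Hx]]; [|reflexivity|].
  - destruct (MVT_cor2 f (fun _ => 0) 0 x Hx) as [c [Hc _]];
      [intros; apply is_derive_Reals, H|lra].
  - destruct (MVT_cor2 f (fun _ => 0) x 0 Hx) as [c [Hc _]];
      [intros; apply is_derive_Reals, H|lra].
Qed.

(** The left side is constant: the derivative of the square is [2 * gexp x] times the integral, and
    the substitution [u = x * t] shows that the derivative of the second term is its negative. At
    [x = 0] the value is [atan 1]. *)
Lemma gauss_square (x : R) :
  (RInt gexp 0 x) ^ 2 + RInt (fun t => exp (- x ^ 2 * (1 + t ^ 2)) / (1 + t ^ 2)) 0 1 = PI / 4.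
Proof.
  set (F := fun x => (RInt gexp 0 x) ^ 2 + RInt (fun t => exp (- x ^ 2 * (1 + t ^ 2)) / (1 + t ^ 2)) 0 1).
  assert (Hpos : forall t, 0 < 1 + t ^ 2) by (intros t; assert (H := pow2_ge_0 t); lra).
  assert (Hk : forall y t : R, is_derive (fun u => exp (- u ^ 2 * (1 + t ^ 2)) / (1 + t ^ 2)) y
                 (- (2 * y) * exp (- y ^ 2 * (1 + t ^ 2)))).
  { intros y t. specialize (Hpos t). auto_derive; [lra|].
    change (y ^ 2) with (y * (y * 1)). change (t ^ 2) with (t * (t * 1)) in *. field; lra. }
  assert (Hint : forall y, ex_RInt (fun t => exp (- y ^ 2 * (1 + t ^ 2)) / (1 + t ^ 2)) 0 1).
  { intros y. apply ex_RInt_cont. intros t.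
    apply continuous_of_ex_derive. specialize (Hpos t). auto_derive. lra. }
  assert (Hd : forall y : R, is_derive F y 0).
  { intros y. unfold F.
    assert (H1 : is_derive (fun x => RInt gexp 0 x) y (gexp y)).
    { apply (is_derive_RInt gexp _ 0); [|apply continuous_gexp].
      exists (mkposreal 1 Rlt_0_1). intros z _. apply (RInt_correct (V := R_CompleteNormedModule)), ex_RInt_cont, continuous_gexp. }
    assert (H2 : is_derive (fun x => RInt (fun t => exp (- x ^ 2 * (1 + t ^ 2)) / (1 + t ^ 2)) 0 1) y
              (RInt (fun t => Derive (fun u => exp (- u ^ 2 * (1 + t ^ 2)) / (1 + t ^ 2)) y) 0 1)).
    { apply (is_derive_RInt_param (fun u t => exp (- u ^ 2 * (1 + t ^ 2)) / (1 + t ^ 2))).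
      - exists (mkposreal 1 Rlt_0_1). intros z _ t _. eexists; apply Hk.
      - intros t _. apply (continuity_2d_pt_ext (fun u v => - (2 * u) * exp (- u ^ 2 * (1 + v ^ 2)))).
        + intros u v. symmetry. apply is_derive_unique, Hk.
        + apply continuity_2d_pt_mult.
          * apply continuity_2d_pt_opp, continuity_2d_pt_mult;
              [apply continuity_2d_pt_const|apply continuity_2d_pt_id1].
          * apply (continuity_1d_2d_pt_comp exp); [apply derivable_continuous_pt, derivable_pt_exp|].
            apply continuity_2d_pt_mult.
            -- apply continuity_2d_pt_opp. simpl.
               repeat (apply continuity_2d_pt_mult || apply continuity_2d_pt_id1 ||
                       apply continuity_2d_pt_const).
            -- apply continuity_2d_pt_plus; [apply continuity_2d_pt_const|]. simpl.
               repeat (apply continuity_2d_pt_mult || apply continuity_2d_pt_id2 ||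
                       apply continuity_2d_pt_const).
      - exists (mkposreal 1 Rlt_0_1). intros z _. apply Hint. }
    (* The summand [+ 0] gives the integrand the shape expected by the linear substitution
       [RInt_comp_lin]. *)
    rewrite (RInt_ext _ (fun t => - (2 * gexp y) * (y * gexp (y * t + 0)))) in H2.
    2:{ intros t _. etransitivity; [exact (is_derive_unique _ _ _ (Hk y t))|]. unfold gexp.
        replace (- y ^ 2 * (1 + t ^ 2)) with (- y ^ 2 + - (y * t + 0) ^ 2) by ring.
        rewrite exp_plus. real_eq. ring. }
    assert (Hlin : RInt (fun t => y * gexp (y * t + 0)) 0 1 = RInt gexp 0 y).
    { etransitivity; [apply (RInt_comp_lin gexp y 0 0 1), ex_RInt_cont, continuous_gexp|].
      f_equal; ring. }
    assert (Hsc : RInt (fun t => - (2 * gexp y) * (y * gexp (y * t + 0))) 0 1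
                  = - (2 * gexp y) * RInt gexp 0 y).
    { rewrite <- Hlin. apply (RInt_scal (fun t => y * gexp (y * t + 0)) 0 1 (- (2 * gexp y))).
      apply ex_RInt_cont. intros t. unfold gexp. apply continuous_of_ex_derive. auto_derive. exact I. }
    rewrite Hsc in H2.
    assert (H3 := is_derive_pow (fun x => RInt gexp 0 x) 2 y (gexp y) H1).
    assert (H4 := is_derive_plus (K := R_AbsRing) (V := R_NormedModule) _ _ y _ _ H3 H2).
    refine (is_derive_eq _ y _ _ H4 _). unfold plus; simpl. ring. }
  change (F x = PI / 4). rewrite (const_of_zero_derivative F x Hd). unfold F.
  rewrite RInt_point. change (@zero R_CompleteNormedModule) with 0.
  rewrite (RInt_ext _ (fun t => / (1 + t ^ 2))).
  - assert (Hat : is_RInt (fun t => / (1 + t ^ 2)) 0 1 (minus (atan 1) (atan 0))).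
    { apply (is_RInt_derive atan).
      - intros t _. apply is_derive_Reals, derivable_pt_lim_atan.
      - intros t _. apply continuous_of_ex_derive. specialize (Hpos t). auto_derive. lra. }
    rewrite (is_RInt_unique _ _ _ _ Hat). unfold minus, plus, opp; simpl.
    rewrite atan_1, atan_0. simpl; ring.
  - intros t _. real_eq. replace (- 0 ^ 2 * (1 + t ^ 2)) with 0 by ring. rewrite exp_0.
    unfold Rdiv; ring.
Qed.

(** With [s = sqrt PI / 2] and [A] the integral, [gauss_square] reads [(s - A) * (s + A) = B] where
    [0 <= B <= gexp x], and [s > 1 / 2] bounds the second factor from below. *)
Lemma RInt_gexp_bound (x : R) : 0 <= x ->
  sqrt PI / 2 - 2 * gexp x <= RInt gexp 0 x <= sqrt PI / 2.
Proof.
  intros Hx. assert (HP := PI_RGT_0).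
  assert (Hpos : forall t, 0 < 1 + t ^ 2) by (intros t; assert (H := pow2_ge_0 t); lra).
  set (A := RInt gexp 0 x).
  assert (HA : 0 <= A).
  { apply RInt_ge_0; [assumption|apply ex_RInt_cont, continuous_gexp|].
    intros; left; apply gexp_pos. }
  set (B := RInt (fun t => exp (- x ^ 2 * (1 + t ^ 2)) / (1 + t ^ 2)) 0 1).
  assert (Hex : ex_RInt (fun t => exp (- x ^ 2 * (1 + t ^ 2)) / (1 + t ^ 2)) 0 1).
  { apply ex_RInt_cont. intros t. apply continuous_of_ex_derive. specialize (Hpos t).
    auto_derive. lra. }
  assert (HB0 : 0 <= B).
  { apply RInt_ge_0; [lra|exact Hex|]. intros t _. specialize (Hpos t).
    apply Rdiv_le_0_compat; [left; apply exp_pos|assumption]. }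
  assert (HB1 : B <= gexp x).
  { replace (gexp x) with (RInt (fun _ => gexp x) 0 1)
      by (rewrite RInt_const; unfold scal; simpl; unfold mult; simpl; ring).
    apply RInt_le; [lra|exact Hex|apply ex_RInt_const|].
    intros t _. specialize (Hpos t). assert (Ht := pow2_ge_0 t). assert (Hx2 := pow2_ge_0 x).
    apply Rle_div_l; [assumption|]. unfold gexp.
    apply Rle_trans with (exp (- x ^ 2)); [apply exp_le_compat; nra|].
    assert (He := exp_pos (- x ^ 2)). nra. }
  assert (HE := gauss_square x). fold A B in HE.
  set (s := sqrt PI / 2).
  assert (Hs : s ^ 2 = PI / 4).
  { unfold s. replace ((sqrt PI / 2) ^ 2) with (sqrt PI * sqrt PI / 4) by field.
    rewrite sqrt_sqrt; lra. }
  assert (Hs1 : 1 / 2 < s).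
  { unfold s. assert (1 < sqrt PI); [|lra]. rewrite <- sqrt_1. apply sqrt_lt_1; try lra.
    generalize PI2_1; lra. }
  assert (HAs : A <= s) by nra. split; [|exact HAs].
  assert ((s - A) * (s + A) = B) by nra.
  assert (Hg := gexp_pos x). nra.
Qed.

Definition gint (f : R -> R) (a b : R) : R := RInt (fun u => f u * normal_half_density u) a b.

Lemma continuous_density (u : R) : continuous normal_half_density u.
Proof. apply continuous_of_ex_derive. unfold normal_half_density. auto_derive. exact I. Qed.

Lemma density_pos (u : R) : 0 < normal_half_density u.
Proof.
  apply Rmult_lt_0_compat; [apply Rinv_0_lt_compat, sqrt_lt_R0, PI_RGT_0|apply exp_pos].
Qed.

Lemma sqrt_PI_gt_1 : 1 < sqrt PI.
Proof. rewrite <- sqrt_1. apply sqrt_lt_1; generalize PI2_1; lra. Qed.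

Lemma density_le_gexp (u : R) : normal_half_density u <= gexp u.
Proof.
  unfold normal_half_density. fold (gexp u). assert (H := gexp_pos u).
  assert (Hs := sqrt_PI_gt_1). assert (/ sqrt PI < 1); [|nra].
  rewrite <- Rinv_1. apply Rinv_lt_contravar; lra.
Qed.

Lemma ex_gint (f : R -> R) (a b : R) :
  (forall u, continuous f u) -> ex_RInt (fun u => f u * normal_half_density u) a b.
Proof.
  intros Hf. apply ex_RInt_cont. intros u.
  apply (continuous_mult f normal_half_density); [apply Hf|apply continuous_density].
Qed.

Lemma gint_plus (f g : R -> R) (a b : R) :
  (forall u, continuous f u) -> (forall u, continuous g u) ->
  gint (fun u => f u + g u) a b = gint f a b + gint g a b.
Proof.
  intros Hf Hg. unfold gint.
  rewrite (RInt_ext _ (fun u => plus (f u * normal_half_density u) (g u * normal_half_density u)))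
    by (intros; real_eq; unfold plus; simpl; ring).
  apply (RInt_plus (V := R_CompleteNormedModule)); now apply ex_gint.
Qed.

Lemma gint_scal (c : R) (f : R -> R) (a b : R) :
  (forall u, continuous f u) -> gint (fun u => c * f u) a b = c * gint f a b.
Proof.
  intros Hf. unfold gint.
  rewrite (RInt_ext _ (fun u => scal c (f u * normal_half_density u)))
    by (intros; real_eq; unfold scal; simpl; unfold mult; simpl; ring).
  apply (RInt_scal (V := R_CompleteNormedModule)); now apply ex_gint.
Qed.

Lemma gint_le (f g : R -> R) (a b : R) :
  a <= b -> (forall u, continuous f u) -> (forall u, continuous g u) ->
  (forall u, a < u < b -> f u <= g u) -> gint f a b <= gint g a b.
Proof.
  intros Hab Hf Hg H. unfold gint.
  apply RInt_le; [assumption|now apply ex_gint|now apply ex_gint|].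
  intros u Hu. apply Rmult_le_compat_r; [left; apply density_pos|auto].
Qed.

Lemma gint_Chasles (f : R -> R) (a b c : R) :
  (forall u, continuous f u) -> gint f a b + gint f b c = gint f a c.
Proof.
  intros Hf. unfold gint. apply (RInt_Chasles (V := R_CompleteNormedModule)); now apply ex_gint.
Qed.

Lemma gint_nonneg (f : R -> R) (a b : R) :
  a <= b -> (forall u, continuous f u) -> (forall u, a < u < b -> 0 <= f u) -> 0 <= gint f a b.
Proof.
  intros Hab Hf H. unfold gint. apply RInt_ge_0; [assumption|now apply ex_gint|].
  intros u Hu. apply Rmult_le_pos; [auto|left; apply density_pos].
Qed.

Lemma continuous_cst (c u : R) : continuous (fun _ : R => c) u.
Proof. apply continuous_const. Qed.

Lemma gint_one (a b : R) : gint (fun _ => 1) a b = / sqrt PI * RInt gexp a b.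
Proof.
  unfold gint.
  rewrite (RInt_ext _ (fun u => scal (/ sqrt PI) (gexp u))).
  - apply (RInt_scal (V := R_CompleteNormedModule)), ex_RInt_cont, continuous_gexp.
  - intros u _. real_eq. unfold normal_half_density, gexp, scal; simpl. unfold mult; simpl. ring.
Qed.

Lemma RInt_opp_arg (f : R -> R) (a b : R) :
  (forall u, continuous f u) -> RInt f (- a) (- b) = - RInt (fun u => f (- u)) a b.
Proof.
  intros Hf.
  assert (H : is_RInt f (- a) (- b) (RInt f (- a) (- b)))
    by (apply (RInt_correct (V := R_CompleteNormedModule)), ex_RInt_cont, Hf).
  apply is_RInt_comp_opp in H.
  rewrite <- (is_RInt_unique (V := R_CompleteNormedModule) _ _ _ _ H).
  apply (RInt_opp (V := R_CompleteNormedModule) (fun u => f (- u))). apply ex_RInt_cont.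
  intros u. apply (continuous_comp Ropp f); [|apply Hf].
  apply (continuous_opp (fun x : R => x)), continuous_id.
Qed.

Lemma RInt_sym_even (f : R -> R) (M : R) :
  (forall u, continuous f u) -> (forall u, f (- u) = f u) -> RInt f (- M) M = 2 * RInt f 0 M.
Proof.
  intros Hf He.
  assert (H : RInt f (- M) 0 + RInt f 0 M = RInt f (- M) M)
    by (apply (RInt_Chasles (V := R_CompleteNormedModule)); apply ex_RInt_cont; exact Hf).
  rewrite <- H. assert (H0 := RInt_opp_arg f M 0 Hf). rewrite Ropp_0 in H0. rewrite H0.
  rewrite (RInt_ext _ f) by (intros; apply He).
  assert (Hs : RInt f M 0 = - RInt f 0 M).
  { symmetry. apply (opp_RInt_swap (V := R_CompleteNormedModule)). apply ex_RInt_cont; exact Hf. }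
  rewrite Hs. real_eq. ring.
Qed.

Lemma RInt_sym_odd (f : R -> R) (M : R) :
  (forall u, continuous f u) -> (forall u, f (- u) = - f u) -> RInt f (- M) M = 0.
Proof.
  intros Hf Ho.
  assert (H := RInt_opp_arg f M (- M) Hf). rewrite Ropp_involutive in H.
  rewrite (RInt_ext (fun u => f (- u)) (fun u => opp (f u))) in H by (intros; apply Ho).
  rewrite (RInt_opp (V := R_CompleteNormedModule) f) in H by (apply ex_RInt_cont; exact Hf).
  assert (Hs : RInt f M (- M) = - RInt f (- M) M).
  { symmetry. apply (opp_RInt_swap (V := R_CompleteNormedModule)). apply ex_RInt_cont; exact Hf. }
  rewrite Hs in H. unfold opp in H; simpl in H. lra.
Qed.

Lemma gexp_even (u : R) : gexp (- u) = gexp u.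
Proof. unfold gexp. f_equal. ring. Qed.

Lemma gint_total (M : R) : 0 <= M -> 1 - 4 * gexp M <= gint (fun _ => 1) (- M) M <= 1.
Proof.
  intros HM. rewrite gint_one, RInt_sym_even by (apply continuous_gexp || apply gexp_even).
  destruct (RInt_gexp_bound M HM) as [H1 H2]. assert (Hs := sqrt_PI_gt_1).
  assert (Hg := gexp_pos M). set (I := RInt gexp 0 M) in *.
  split.
  - apply Rle_trans with (/ sqrt PI * (sqrt PI - 4 * gexp M)).
    + rewrite Rmult_minus_distr_l, Rinv_l by lra.
      assert (/ sqrt PI < 1) by (rewrite <- Rinv_1; apply Rinv_lt_contravar; lra). nra.
    + apply Rmult_le_compat_l; [left; apply Rinv_0_lt_compat; lra|lra].
  - apply Rle_trans with (/ sqrt PI * sqrt PI); [|rewrite Rinv_l; lra].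
    apply Rmult_le_compat_l; [left; apply Rinv_0_lt_compat; lra|lra].
Qed.

(** Differentiation under the integral, then integration by parts with the primitive
    [1 / 2 * sin (tau * u) * gexp u]. The truncated transform satisfies a linear first order
    equation with a boundary term. *)
Lemma gexp_cos_derive (M tau : R) :
  is_derive (fun t => RInt (fun u => cos (t * u) * gexp u) (- M) M) tau
    (sin (tau * M) * gexp M - tau / 2 * RInt (fun u => cos (tau * u) * gexp u) (- M) M).
Proof.
  assert (Hk : forall y u : R, is_derive (fun t => cos (t * u) * gexp u) y
                 (- u * sin (y * u) * gexp u)).
  { intros y u. auto_derive; [exact I|ring]. }
  assert (Hc : forall y u : R, continuous (fun u => cos (y * u) * gexp u) u).
  { intros y u. apply continuous_of_ex_derive. unfold gexp. auto_derive. exact I. }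
  assert (Hcs : forall y u : R, continuous (fun u => - u * sin (y * u) * gexp u) u).
  { intros y u. apply continuous_of_ex_derive. unfold gexp. auto_derive. exact I. }
  assert (H : is_derive (fun t => RInt (fun u => cos (t * u) * gexp u) (- M) M) tau
     (RInt (fun u => Derive (fun t => cos (t * u) * gexp u) tau) (- M) M)).
  { apply (is_derive_RInt_param (fun t u => cos (t * u) * gexp u)).
    - exists (mkposreal 1 Rlt_0_1). intros z _ t _. eexists; apply Hk.
    - intros t _. apply (continuity_2d_pt_ext (fun y u => - u * sin (y * u) * gexp u)).
      + intros y u. symmetry. apply is_derive_unique, Hk.
      + apply continuity_2d_pt_mult; [apply continuity_2d_pt_mult|].
        * apply continuity_2d_pt_opp, continuity_2d_pt_id2.
        * apply (continuity_1d_2d_pt_comp sin); [apply continuity_sin|].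
          apply continuity_2d_pt_mult; [apply continuity_2d_pt_id1|apply continuity_2d_pt_id2].
        * apply (continuity_1d_2d_pt_comp gexp); [|apply continuity_2d_pt_id2].
          apply continuity_pt_filterlim, continuous_gexp.
    - exists (mkposreal 1 Rlt_0_1). intros z _. apply ex_RInt_cont. apply Hc. }
  rewrite (RInt_ext _ (fun u => - u * sin (tau * u) * gexp u)) in H
    by (intros u _; apply is_derive_unique, Hk).
  assert (Hprim : forall u : R, is_derive (fun u => 1 / 2 * sin (tau * u) * gexp u) u
            (- u * sin (tau * u) * gexp u + tau / 2 * (cos (tau * u) * gexp u))).
  { intros u. unfold gexp. auto_derive; [exact I|]. change (u ^ 2) with (u * (u * 1)). field. }
  assert (Hibp : is_RInt (fun u => plus (- u * sin (tau * u) * gexp u)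
                            (scal (tau / 2) (cos (tau * u) * gexp u))) (- M) M
                 (minus (1 / 2 * sin (tau * M) * gexp M) (1 / 2 * sin (tau * - M) * gexp (- M)))).
  { apply (is_RInt_derive (fun u => 1 / 2 * sin (tau * u) * gexp u)).
    - intros u _. apply Hprim.
    - intros u _. apply (continuous_plus (V := R_NormedModule)); [apply Hcs|].
      apply (continuous_scal_r (V := R_NormedModule)), Hc. }
  assert (Hsplit : RInt (fun u => plus (- u * sin (tau * u) * gexp u)
                            (scal (tau / 2) (cos (tau * u) * gexp u))) (- M) M
          = RInt (fun u => - u * sin (tau * u) * gexp u) (- M) M
            + tau / 2 * RInt (fun u => cos (tau * u) * gexp u) (- M) M).
  { etransitivity.
    - apply (RInt_plus (V := R_CompleteNormedModule)); apply ex_RInt_cont; [apply Hcs|].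
      intros u. apply (continuous_scal_r (V := R_NormedModule)), Hc.
    - apply (f_equal (fun z => RInt (fun u => - u * sin (tau * u) * gexp u) (- M) M + z)).
      apply (RInt_scal (V := R_CompleteNormedModule)), ex_RInt_cont, Hc. }
  rewrite (is_RInt_unique _ _ _ _ Hibp) in Hsplit.
  unfold minus, plus, opp in Hsplit; simpl in Hsplit.
  rewrite gexp_even, Ropp_mult_distr_r_reverse, sin_neg in Hsplit.
  assert (Hval : RInt (fun u => - u * sin (tau * u) * gexp u) (- M) M
    = sin (tau * M) * gexp M - tau / 2 * RInt (fun u => cos (tau * u) * gexp u) (- M) M) by lra.
  rewrite <- Hval. exact H.
Qed.

(** The integrating factor [exp (t ^ 2 / 4)] removes the linear term of that equation, and the mean
    value theorem bounds the contribution of the boundary term. *)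
Lemma gexp_cos_estimate (M tau : R) :
  Rabs (RInt (fun u => cos (tau * u) * gexp u) (- M) M - exp (- (tau ^ 2 / 4)) * RInt gexp (- M) M)
  <= Rabs tau * gexp M.
Proof.
  set (g := fun t => RInt (fun u => cos (t * u) * gexp u) (- M) M).
  set (h := fun t => exp (t ^ 2 / 4) * g t).
  assert (Hh : forall t, derivable_pt_lim h t (exp (t ^ 2 / 4) * (sin (t * M) * gexp M))).
  { intros t. apply is_derive_Reals. unfold h.
    replace (exp (t ^ 2 / 4) * (sin (t * M) * gexp M))
      with (t / 2 * exp (t ^ 2 / 4) * g t +
            exp (t ^ 2 / 4) * (sin (t * M) * gexp M - t / 2 * g t)) by ring.
    apply (is_derive_mult (fun t => exp (t ^ 2 / 4)) g).
    - auto_derive; [exact I|]. real_eq. unfold Rdiv. change (t ^ 2) with (t * (t * 1)). field.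
    - apply gexp_cos_derive.
    - intros; apply Rmult_comm. }
  assert (Hg0 : g 0 = RInt gexp (- M) M).
  { apply RInt_ext. intros u _. rewrite Rmult_0_l, cos_0. real_eq. ring. }
  assert (Hmvt : Rabs (h tau - h 0) <= Rabs tau * (exp (tau ^ 2 / 4) * gexp M)).
  { assert (Hb : forall c, Rabs c <= Rabs tau ->
       Rabs (exp (c ^ 2 / 4) * (sin (c * M) * gexp M)) <= exp (tau ^ 2 / 4) * gexp M).
    { intros c Hc. rewrite !Rabs_mult. rewrite (Rabs_pos_eq (exp _)) by (left; apply exp_pos).
      rewrite (Rabs_pos_eq (gexp M)) by (left; apply gexp_pos).
      assert (Rabs (sin (c * M)) <= 1) by (apply Rabs_le, SIN_bound).
      assert (Hg := gexp_pos M). assert (Hs := Rabs_pos (sin (c * M))).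
      apply Rmult_le_compat; [left; apply exp_pos|nra| |nra].
      apply exp_le_compat. assert (Hq := sqr_le_of_abs c _ Hc). rewrite pow2_abs in Hq. lra. }
    destruct (Rtotal_order 0 tau) as [Ht|[<-|Ht]].
    - destruct (MVT_cor2 h _ 0 tau Ht (fun c _ => Hh c)) as [c [Hc1 Hc2]].
      rewrite Hc1, Rabs_mult, Rmult_comm, Rminus_0_r.
      apply Rmult_le_compat_l; [apply Rabs_pos|]. apply Hb.
      rewrite !Rabs_pos_eq; lra.
    - rewrite Rminus_diag, Rabs_R0. lra.
    - destruct (MVT_cor2 h _ tau 0 Ht (fun c _ => Hh c)) as [c [Hc1 Hc2]].
      rewrite Rabs_minus_sym, Hc1, Rabs_mult, Rmult_comm, Rminus_0_l, Rabs_Ropp.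
      apply Rmult_le_compat_l; [apply Rabs_pos|]. apply Hb.
      rewrite !Rabs_left1; lra. }
  unfold h in Hmvt. replace (0 ^ 2 / 4) with 0 in Hmvt by field. rewrite exp_0, Rmult_1_l, Hg0 in Hmvt.
  set (e := exp (tau ^ 2 / 4)) in *. assert (He : 0 < e) by apply exp_pos.
  rewrite exp_Ropp. fold e. fold (g tau).
  apply (Rmult_le_reg_l e); [assumption|].
  rewrite <- (Rabs_pos_eq e) at 1 by lra. rewrite <- Rabs_mult.
  replace (e * (g tau - / e * RInt gexp (- M) M)) with (e * g tau - RInt gexp (- M) M) by (field; lra).
  lra.
Qed.

(** The Gaussian mean as a limit over symmetric intervals, on which odd parts cancel. *)
Definition glim (f : R -> R) (g : R) : Prop :=
  forall eps, 0 < eps -> exists M0, forall M, M0 <= M -> Rabs (gint f (- M) M - g) < eps.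

Lemma glim_cos (tau phi : R) :
  glim (fun u => cos (tau * u + phi)) (cos phi * exp (- (tau ^ 2 / 4))).
Proof.
  intros eps Heps.
  assert (Hpos : 0 < eps / (Rabs tau + 5))
    by (apply Rdiv_lt_0_compat; [assumption|generalize (Rabs_pos tau); lra]).
  destruct (exp_neg_small _ Hpos) as [M0 [HM0 HM]]. exists M0. intros M HMM.
  assert (Hc : forall u, continuous (fun u => cos (tau * u) * gexp u) u).
  { intros u. apply continuous_of_ex_derive. unfold gexp. auto_derive. exact I. }
  assert (Hs : forall u, continuous (fun u => sin (tau * u) * gexp u) u).
  { intros u. apply continuous_of_ex_derive. unfold gexp. auto_derive. exact I. }
  assert (E : gint (fun u => cos (tau * u + phi)) (- M) M
              = cos phi * (/ sqrt PI * RInt (fun u => cos (tau * u) * gexp u) (- M) M)).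
  { unfold gint.
    rewrite (RInt_ext _ (fun u => plus (scal (cos phi * / sqrt PI) (cos (tau * u) * gexp u))
                                  (scal (- sin phi * / sqrt PI) (sin (tau * u) * gexp u)))).
    - etransitivity.
      + apply (RInt_plus (V := R_CompleteNormedModule)); apply ex_RInt_cont; intros u;
          apply (continuous_scal_r (V := R_NormedModule)); [apply Hc|apply Hs].
      + rewrite (RInt_scal (V := R_CompleteNormedModule) (fun u => cos (tau * u) * gexp u))
          by (apply ex_RInt_cont, Hc).
        rewrite (RInt_scal (V := R_CompleteNormedModule) (fun u => sin (tau * u) * gexp u))
          by (apply ex_RInt_cont, Hs).
        rewrite (RInt_sym_odd (fun u => sin (tau * u) * gexp u)).
        * unfold plus, scal; simpl; unfold mult; simpl. ring.
        * apply Hs.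
        * intros u. rewrite gexp_even, Ropp_mult_distr_r_reverse, sin_neg. ring.
    - intros u _. real_eq. rewrite cos_plus. unfold normal_half_density. fold (gexp u).
      unfold plus, scal; simpl; unfold mult; simpl. ring. }
  rewrite E. set (I := RInt (fun u => cos (tau * u) * gexp u) (- M) M).
  assert (H1 := gexp_cos_estimate M tau). fold I in H1.
  assert (H2 := gint_total M). rewrite gint_one in H2. set (T := RInt gexp (- M) M) in *.
  set (e := exp (- (tau ^ 2 / 4))) in *. set (s := / sqrt PI) in *.
  assert (Hs0 : 0 < s < 1).
  { assert (H := sqrt_PI_gt_1). unfold s. split; [apply Rinv_0_lt_compat; lra|].
    rewrite <- Rinv_1. apply Rinv_lt_contravar; lra. }
  assert (He : 0 < e <= 1).
  { split; [apply exp_pos|]. unfold e. rewrite <- exp_0. apply exp_le_compat.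
    assert (H := pow2_ge_0 tau). lra. }
  assert (Hg : 0 < gexp M) by apply gexp_pos.
  assert (HgM := HM M HMM). fold (gexp M) in HgM.
  replace (cos phi * (s * I) - cos phi * e) with (cos phi * (s * (I - e * T) + e * (s * T - 1))) by ring.
  rewrite Rabs_mult.
  assert (Rabs (cos phi) <= 1) by (apply Rabs_le, COS_bound).
  assert (Hin : Rabs (s * (I - e * T) + e * (s * T - 1)) <= (Rabs tau + 4) * gexp M).
  { eapply Rle_trans; [apply Rabs_triang|]. rewrite !Rabs_mult, (Rabs_pos_eq s), (Rabs_pos_eq e) by lra.
    assert (Rabs (s * T - 1) <= 4 * gexp M) by (apply Rabs_le; destruct H2; lra).
    assert (Hp := Rabs_pos (I - e * T)). assert (Hp' := Rabs_pos (s * T - 1)). nra. }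
  apply Rle_lt_trans with ((Rabs tau + 4) * gexp M).
  - generalize (Rabs_pos (cos phi)) (Rabs_pos (s * (I - e * T) + e * (s * T - 1))). nra.
  - assert (Ht := Rabs_pos tau). apply Rlt_div_r in HgM; [|lra]. nra.
Qed.

Lemma continuous_tev (l : list (R * (R * R))) (u : R) : continuous (tev l) u.
Proof.
  induction l as [|t l IH].
  - apply continuous_cst.
  - apply (continuous_plus (V := R_NormedModule)
      (fun w => fst t * cos (fst (snd t) * w + snd (snd t))) (tev l)); [|exact IH].
    apply continuous_of_ex_derive. auto_derive. exact I.
Qed.

Lemma glim_tev (l : list (R * (R * R))) : glim (tev l) (gam l).
Proof.
  induction l as [|t l IH]; intros eps Heps.
  - exists 0. intros M _. unfold gint. rewrite (RInt_ext _ (fun _ => 0)).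
    + rewrite RInt_const. unfold scal, gam; simpl; unfold mult; simpl.
      rewrite Rmult_0_r, Rminus_diag, Rabs_R0. assumption.
    + intros u _. real_eq. unfold tev; simpl; ring.
  - set (c := fst t). set (tau := fst (snd t)). set (phi := snd (snd t)).
    assert (Hp : 0 < eps / (2 * (Rabs c + 1)))
      by (apply Rdiv_lt_0_compat; [assumption|generalize (Rabs_pos c); lra]).
    destruct (glim_cos tau phi _ Hp) as [M1 H1].
    destruct (IH (eps / 2)) as [M2 H2]; [lra|].
    exists (Rmax M1 M2). intros M HM.
    specialize (H1 M (Rle_trans _ _ _ (Rmax_l _ _) HM)).
    specialize (H2 M (Rle_trans _ _ _ (Rmax_r _ _) HM)).
    assert (Hcc : forall u, continuous (fun u => cos (tau * u + phi)) u).
    { intros u. apply continuous_of_ex_derive. auto_derive. exact I. }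
    change (tev (t :: l)) with (fun w => c * cos (tau * w + phi) + tev l w).
    change (gam (t :: l)) with (c * (cos phi * exp (- (tau ^ 2 / 4))) + gam l).
    rewrite gint_plus, gint_scal.
    + set (x := gint _ _ _) in *. set (y := gint _ _ _) in H2 |- *.
      replace (c * x + y - (c * (cos phi * exp (- (tau ^ 2 / 4))) + gam l))
        with (c * (x - cos phi * exp (- (tau ^ 2 / 4))) + (y - gam l)) by ring.
      eapply Rle_lt_trans; [apply Rabs_triang|]. rewrite Rabs_mult.
      assert (Hc0 := Rabs_pos c). assert (Hx := Rabs_pos (x - cos phi * exp (- (tau ^ 2 / 4)))).
      apply Rlt_div_r in H1; [|lra]. nra.
    + exact Hcc.
    + intros u. apply (continuous_scal_r (V := R_NormedModule) c (fun u => cos (tau * u + phi))), Hcc.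
    + apply continuous_tev.
Qed.

(** The formal mean [gam] is an integral, so means of test functions can be estimated by pointwise
    bounds. *)
Lemma tpoly_glim (A T f g : _) : tpoly A T f g -> (forall u, continuous f u) /\ glim f g.
Proof.
  intros [l [_ [_ [H <-]]]]. split.
  - intros u. apply (continuous_ext (tev l)); [intros; symmetry; apply H|apply continuous_tev].
  - intros eps Heps. destruct (glim_tev l eps Heps) as [M0 HM]. exists M0. intros M HMM.
    replace (gint f (- M) M) with (gint (tev l) (- M) M); [now apply HM|].
    apply RInt_ext. intros u _. now rewrite H.
Qed.

(** The density decreases on the positive axis, so on the interval it is at least its value at [b];
    the rest of the integral is nonnegative. *)
Lemma glim_lower (f : R -> R) (g a b c : R) :
  (forall u, continuous f u) -> glim f g -> (forall u, 0 <= f u) ->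
  0 <= a <= b -> 0 <= c -> (forall u, a < u < b -> c <= f u) ->
  c * (b - a) * (/ sqrt PI * gexp b) <= g.
Proof.
  intros Hf Hg H0 Hab Hc Hcf.
  set (v := c * (b - a) * (/ sqrt PI * gexp b)).
  destruct (Rle_lt_dec v g) as [Hle|Hlt]; [assumption|]. exfalso.
  destruct (Hg (v - g)) as [M0 HM]; [lra|].
  set (M := Rmax M0 b). assert (HMM : M0 <= M) by apply Rmax_l. assert (HbM : b <= M) by apply Rmax_r.
  specialize (HM M HMM). apply Rabs_def2 in HM.
  assert (E1 := gint_Chasles f (- M) a M Hf). assert (E2 := gint_Chasles f a b M Hf).
  assert (P1 : 0 <= gint f (- M) a) by (apply gint_nonneg; [lra|assumption|auto]).
  assert (P2 : 0 <= gint f b M) by (apply gint_nonneg; [lra|assumption|auto]).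
  assert (P3 : v <= gint f a b); [|lra].
  unfold gint. replace v with (RInt (fun _ => c * (/ sqrt PI * gexp b)) a b)
    by (rewrite RInt_const; unfold scal, v; simpl; unfold mult; simpl; ring).
  apply RInt_le; [lra|apply ex_RInt_const|now apply ex_gint|].
  intros u Hu. assert (Hs := Rinv_0_lt_compat _ (Rlt_trans _ _ _ Rlt_0_1 sqrt_PI_gt_1)).
  assert (Hg0 := gexp_pos b).
  apply Rmult_le_compat; [assumption|nra|auto|].
  unfold normal_half_density. apply Rmult_le_compat_l; [lra|].
  apply exp_le_compat. assert (u ^ 2 <= b ^ 2) by (apply pow_incr; lra). lra.
Qed.

(** * Central limit theorem *)

Definition cdf_lim (t p : R) : Prop :=
  forall eps, 0 < eps -> exists M0, forall M, M0 <= M -> Rabs (gint (fun _ => 1) (- M) t - p) < eps.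

Lemma cdf_lim_of_def (t p : R) : normal_half_cdf_is t p -> cdf_lim t p.
Proof.
  intros H eps Heps. destruct (H eps Heps) as [M0 HM]. exists M0. intros M HMM.
  assert (Hex : ex_RInt normal_half_density (- M) t)
    by (apply ex_RInt_cont; apply continuous_density).
  assert (pr := ex_RInt_Reals_0 _ _ _ Hex). specialize (HM M HMM pr).
  rewrite <- RInt_Reals in HM. replace (gint (fun _ => 1) (- M) t) with (RInt normal_half_density (- M) t);
    [exact HM|].
  apply RInt_ext. intros u _. real_eq. ring.
Qed.

Lemma cdf_lim_range (t p : R) : cdf_lim t p -> 0 <= p <= 1.
Proof.
  intros H. split.
  - destruct (Rle_lt_dec 0 p) as [Hp|Hp]; [assumption|]. exfalso.
    destruct (H (- p)) as [M0 HM]; [lra|].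
    set (M := Rmax M0 (Rabs t)). specialize (HM M (Rmax_l _ _)).
    assert (HtM : Rabs t <= M) by apply Rmax_r. apply Rabs_le_between in HtM.
    assert (0 <= gint (fun _ => 1) (- M) t)
      by (apply gint_nonneg; [lra|intros; apply continuous_cst|intros; lra]).
    apply Rabs_def2 in HM. lra.
  - destruct (Rle_lt_dec p 1) as [Hp|Hp]; [assumption|]. exfalso.
    destruct (H (p - 1)) as [M0 HM]; [lra|].
    set (M := Rmax M0 (Rabs t)). specialize (HM M (Rmax_l _ _)).
    assert (HtM : Rabs t <= M) by apply Rmax_r.
    assert (H0 := Rabs_pos t). destruct (gint_total M) as [_ HT]; [lra|].
    apply Rabs_le_between in HtM.
    rewrite <- (gint_Chasles _ (- M) t M) in HT by (intros; apply continuous_cst).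
    assert (0 <= gint (fun _ => 1) t M)
      by (apply gint_nonneg; [lra|intros; apply continuous_cst|intros; lra]).
    apply Rabs_def2 in HM. lra.
Qed.

Lemma gint_const (c a b : R) : gint (fun _ => c) a b = c * gint (fun _ => 1) a b.
Proof.
  rewrite <- gint_scal by (intros; apply continuous_cst).
  apply RInt_ext. intros u _. real_eq. ring.
Qed.

Lemma cdf_lim_opp (t p : R) : cdf_lim t p -> cdf_lim (- t) (1 - p).
Proof.
  intros H eps Heps. destruct (H (eps / 2)) as [M1 H1]; [lra|].
  assert (He8 : 0 < eps / 8) by lra. destruct (exp_neg_small _ He8) as [M2 [HM2 H2]].
  exists (Rmax M1 M2). intros M HM.
  specialize (H1 M (Rle_trans _ _ _ (Rmax_l _ _) HM)).
  assert (HM2' : M2 <= M) by (eapply Rle_trans; [apply Rmax_r|exact HM]).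
  specialize (H2 M HM2'). fold (gexp M) in H2.
  destruct (gint_total M) as [T1 T2]; [lra|].
  rewrite <- (gint_Chasles _ (- M) t M) in T1, T2 by (intros; apply continuous_cst).
  assert (E : gint (fun _ => 1) (- M) (- t) = gint (fun _ => 1) t M).
  { rewrite !gint_one. f_equal. rewrite RInt_opp_arg by apply continuous_gexp.
    rewrite (RInt_ext _ gexp) by (intros; apply gexp_even).
    apply (opp_RInt_swap (V := R_CompleteNormedModule)). apply ex_RInt_cont, continuous_gexp. }
  rewrite E. apply Rabs_def2 in H1. apply Rabs_def1; lra.
Qed.

(** The polynomial [1 - (1 - q^n)^(2^n)] of Brosowski and Deutsch approximates the indicator of
    [q > 1/2]. *)
Definition step_poly (n : nat) (q : R) : R := 1 - (1 - q ^ n) ^ (2 ^ n).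

Lemma bernoulli_minus (y : R) (N : nat) : 0 <= y <= 1 -> 1 - INR N * y <= (1 - y) ^ N.
Proof.
  intros Hy. induction N as [|N IH]; [simpl; lra|]. rewrite S_INR. simpl.
  assert (0 <= (1 - y) * ((1 - y) ^ N - (1 - INR N * y))) by (apply Rmult_le_pos; lra).
  assert (0 <= INR N) by apply pos_INR. nra.
Qed.

Lemma INR_pow2 (n : nat) : INR (2 ^ n) = 2 ^ n.
Proof. rewrite pow_INR. reflexivity. Qed.

Lemma step_poly_bounds (n : nat) (q : R) : 0 <= q <= 1 -> 0 <= step_poly n q <= 1.
Proof.
  intros Hq. unfold step_poly. assert (0 <= q ^ n <= 1).
  { split; [now apply pow_le|]. rewrite <- (pow1 n). now apply pow_incr. }
  assert (0 <= (1 - q ^ n) ^ (2 ^ n)) by (apply pow_le; lra).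
  assert ((1 - q ^ n) ^ (2 ^ n) <= 1 ^ (2 ^ n)) by (apply pow_incr; lra).
  rewrite pow1 in *. lra.
Qed.

Lemma step_poly_small (n : nat) (q : R) : 0 <= q <= 1 -> step_poly n q <= (2 * q) ^ n.
Proof.
  intros Hq. unfold step_poly.
  assert (Hy : 0 <= q ^ n <= 1).
  { split; [now apply pow_le|]. rewrite <- (pow1 n). now apply pow_incr. }
  assert (H := bernoulli_minus (q ^ n) (2 ^ n) Hy). rewrite INR_pow2 in H.
  rewrite Rpow_mult_distr. lra.
Qed.

(** From [(1 - y) ^ N * (1 + y) ^ N <= 1] and Bernoulli's inequality [1 + N * y <= (1 + y) ^ N],
    where [N * y = (2 * q) ^ n]. *)
Lemma step_poly_large (n : nat) (q : R) : 0 < q <= 1 -> 1 - / (2 * q) ^ n <= step_poly n q.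
Proof.
  intros Hq. unfold step_poly.
  assert (Hy : 0 < q ^ n <= 1).
  { split; [apply pow_lt; lra|]. rewrite <- (pow1 n). apply pow_incr; lra. }
  set (y := q ^ n) in *. set (N := (2 ^ n)%nat).
  assert (H1 : (1 - y) ^ N * (1 + y) ^ N <= 1).
  { rewrite <- Rpow_mult_distr. apply Rle_trans with (1 ^ N); [apply pow_incr; nra|].
    rewrite pow1; lra. }
  assert (H2 : 1 + INR N * y <= (1 + y) ^ N) by (apply poly; lra).
  unfold N in H2 at 1. rewrite INR_pow2 in H2.
  assert (H3 : (2 * q) ^ n = 2 ^ n * y) by apply Rpow_mult_distr.
  assert (H4 : 0 < (2 * q) ^ n) by (apply pow_lt; lra).
  assert (H5 : 0 <= (1 - y) ^ N) by (apply pow_le; lra).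
  assert (H6 : (1 - y) ^ N <= / (2 * q) ^ n); [|lra].
  apply (Rmult_le_reg_r ((2 * q) ^ n)); [assumption|]. rewrite Rinv_l by lra. nra.
Qed.

Definition is_tpoly (f : R -> R) : Prop := exists A T g, tpoly A T f g.

Lemma is_tpoly_step (n : nat) (theta psi kappa : R) :
  is_tpoly (fun w => step_poly n (1 / 2 + 1 / 2 * cos (theta * w + psi)) + kappa).
Proof.
  assert (Hadd : forall f f', is_tpoly f -> is_tpoly f' -> is_tpoly (fun w => f w + f' w)).
  { intros f f' [A [T [g H]]] [A' [T' [g' H']]]. do 3 eexists. apply tpoly_add; eassumption. }
  assert (Hmul : forall f f', is_tpoly f -> is_tpoly f' -> is_tpoly (fun w => f w * f' w)).
  { intros f f' [A [T [g H]]] [A' [T' [g' H']]].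
    destruct (tpoly_mul _ _ _ _ _ _ _ _ H H') as [g2 H2]. do 3 eexists. exact H2. }
  assert (Hpow : forall f k, is_tpoly f -> is_tpoly (fun w => f w ^ k)).
  { intros f k [A [T [g H]]]. destruct (tpoly_pow _ _ _ _ k H) as [g2 H2]. do 3 eexists. exact H2. }
  assert (Hconst : forall c, is_tpoly (fun _ => c)).
  { intros c. do 3 eexists. apply tpoly_const. }
  assert (Hcos : is_tpoly (fun w => cos (theta * w + psi))).
  { do 3 eexists. apply tpoly_cos. }
  assert (Hq : is_tpoly (fun w => 1 / 2 + 1 / 2 * cos (theta * w + psi))).
  { apply (Hadd (fun _ => 1 / 2)); [apply Hconst|].
    apply (Hmul (fun _ => 1 / 2)); [apply Hconst|exact Hcos]. }
  assert (H : is_tpoly (fun w => (1 + -1 * (1 + -1 * (1 / 2 + 1 / 2 * cos (theta * w + psi)) ^ n) ^ (2 ^ n))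
                                 + kappa)).
  { apply (Hadd (fun w => 1 + -1 * (1 + -1 * (1 / 2 + 1 / 2 * cos (theta * w + psi)) ^ n) ^ (2 ^ n)));
      [|apply Hconst].
    apply (Hadd (fun _ => 1)); [apply Hconst|].
    apply (Hmul (fun _ => -1)); [apply Hconst|]. apply (Hpow (fun w => _)).
    apply (Hadd (fun _ => 1)); [apply Hconst|].
    apply (Hmul (fun _ => -1)); [apply Hconst|]. apply (Hpow (fun w => _)). exact Hq. }
  destruct H as [A [T [g H]]]. exists A, T, g. eapply tpoly_ext; [|exact H].
  intros w. unfold step_poly.
  replace (1 + -1 * (1 / 2 + 1 / 2 * cos (theta * w + psi)) ^ n)
    with (1 - (1 / 2 + 1 / 2 * cos (theta * w + psi)) ^ n) by ring.
  ring.
Qed.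

Lemma pow_small (x kappa : R) : 0 <= x < 1 -> 0 < kappa ->
  exists n0, forall n, (n0 <= n)%nat -> x ^ n <= kappa.
Proof.
  intros Hx Hk. destruct (pow_lt_1_zero x) with (y := kappa) as [n0 Hn]; [|assumption|].
  - rewrite Rabs_pos_eq; lra.
  - exists n0. intros n Hnn. specialize (Hn n Hnn). apply Rabs_def2 in Hn. lra.
Qed.

Lemma cos_near (y a : R) : 0 <= a <= PI / 2 -> Rabs y <= PI / 2 - a -> sin a <= cos y.
Proof.
  intros Ha Hy. assert (HP := PI_RGT_0).
  assert (Hc : cos y = cos (Rabs y)).
  { unfold Rabs. destruct (Rcase_abs y); [now rewrite cos_neg|reflexivity]. }
  rewrite Hc, <- cos_shift. apply cos_decr_1; generalize (Rabs_pos y); lra.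
Qed.

(** On [-rho, rho] the test function is close to the indicator of the half line below [t]. The inner
    function [q] has period [4 * rho]; it exceeds 1/2 on an interval of length [2 * rho] ending at
    [t + k] and is below 1/2 on the next one, and [step_poly] pushes these values towards 1 and 0.
    Outside [-rho, rho] the quadratic term takes over, at a cost governed by second moments and the
    Gaussian tail. *)
Lemma clt_test_function (t p eps : R) :
  cdf_lim t p -> 0 < eps <= 1 ->
  exists A T f g rho, tpoly A T f g /\ 0 < rho /\ / rho ^ 2 <= eps /\ (forall w, 0 <= f w) /\
    (forall w, w <= t -> 1 <= f w + w ^ 2 / rho ^ 2) /\ g <= p + eps.
Proof.
  intros Hcdf Heps. set (k := eps / 16).
  assert (HP := PI_RGT_0).
  assert (He64 : 0 < eps / 64) by lra. destruct (exp_neg_small _ He64) as [M0 [HM0 HM]].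
  set (rho := Rmax M0 (Rabs t + 2 + / eps)).
  assert (Hr1 : M0 <= rho) by apply Rmax_l.
  assert (Hr2 : Rabs t + 2 + / eps <= rho) by apply Rmax_r.
  assert (Hie : 1 <= / eps) by (rewrite <- Rinv_1; apply Rinv_le_contravar; lra).
  assert (Ht := Rle_abs t). assert (Ht' := Rle_abs (- t)). rewrite Rabs_Ropp in Ht'.
  assert (Ht0 := Rabs_pos t).
  set (theta := PI / (2 * rho)). assert (Hth : 0 < theta) by (apply Rdiv_lt_0_compat; lra).
  assert (Hthr : theta * rho = PI / 2) by (unfold theta; field; lra).
  set (s0 := sin (theta * k)).
  assert (Htk : 0 < theta * k < PI / 2).
  { split; [apply Rmult_lt_0_compat; unfold k; lra|]. rewrite <- Hthr.
    apply Rmult_lt_compat_l; [assumption|unfold k; lra]. }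
  assert (Hs0 : 0 < s0 < 1).
  { unfold s0. split; [apply sin_gt_0; lra|]. rewrite <- sin_PI2. apply sin_increasing_1; lra. }
  assert (Hkpos : 0 < k) by (unfold k; lra).
  destruct (pow_small (1 - s0) k) as [n1 Hn1]; [lra|assumption|].
  destruct (pow_small (/ (1 + s0)) k) as [n2 Hn2].
  { split; [left; apply Rinv_0_lt_compat; lra|]. rewrite <- Rinv_1.
    apply Rinv_lt_contravar; lra. }
  { assumption. }
  set (n := Nat.max n1 n2). specialize (Hn1 n (Nat.le_max_l _ _)). specialize (Hn2 n (Nat.le_max_r _ _)).
  (* This centre makes [q] equal to 1/2 at [t + k]; the margin [k] on both sides keeps the cosine
     away from zero. *)
  set (c := t + k - rho). set (q := fun w => 1 / 2 + 1 / 2 * cos (theta * w + - (theta * c))).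
  assert (Hq : forall w, 0 <= q w <= 1).
  { intros w. unfold q. assert (H := COS_bound (theta * w + - (theta * c))). lra. }
  (* Adding [k] lifts the values [1 - k] of the step to at least 1. *)
  set (f := fun w => step_poly n (q w) + k).
  assert (Hf : forall w, k <= f w <= 1 + k).
  { intros w. unfold f. assert (H := step_poly_bounds n (q w) (Hq w)). lra. }
  assert (Harg : forall w, theta * w + - (theta * c) = theta * (w - c)) by (intros; ring).
  assert (Hin : forall w, - rho <= w <= t -> 1 <= f w).
  { intros w Hw. assert (Hcos : s0 <= cos (theta * w + - (theta * c))).
    { unfold s0. apply cos_near; [lra|]. rewrite Harg, Rabs_mult, (Rabs_pos_eq theta) by lra.
      rewrite <- Hthr, <- Rmult_minus_distr_l. apply Rmult_le_compat_l; [lra|].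
      apply Rabs_le. unfold c, k in *. lra. }
    assert (Hqw : (1 + s0) / 2 <= q w) by (unfold q; lra).
    assert (H := step_poly_large n (q w)). specialize (Hq w). unfold f.
    assert (/ (2 * q w) ^ n <= k).
    { eapply Rle_trans; [|exact Hn2]. rewrite pow_inv. apply Rinv_le_contravar.
      - apply pow_lt; lra.
      - apply pow_incr; lra. }
    lra. }
  assert (Hout : forall w, t + 2 * k <= w <= rho -> f w <= 2 * k).
  { intros w Hw. assert (Hcos : cos (theta * w + - (theta * c)) <= - s0).
    { replace (cos (theta * w + - (theta * c))) with (- cos (theta * (w - c) - PI)).
      - apply Ropp_le_contravar. unfold s0. apply cos_near; [lra|].
        replace (theta * (w - c) - PI) with (theta * (w - c - 2 * rho)) by lra.
        rewrite Rabs_mult, (Rabs_pos_eq theta) by lra.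
        rewrite <- Hthr, <- Rmult_minus_distr_l. apply Rmult_le_compat_l; [lra|].
        apply Rabs_le. unfold c, k in *. lra.
      - rewrite Harg, cos_minus, cos_PI, sin_PI. ring. }
    assert (Hqw : q w <= (1 - s0) / 2) by (unfold q; lra).
    assert (H := step_poly_small n (q w) (Hq w)). specialize (Hq w). unfold f.
    assert ((2 * q w) ^ n <= (1 - s0) ^ n) by (apply pow_incr; lra). lra. }
  destruct (is_tpoly_step n theta (- (theta * c)) k) as [A [T [g Hg]]].
  exists A, T, f, g, rho. split; [exact Hg|]. split; [lra|]. split; [|split; [|split]].
  - assert (H1 : / rho ^ 2 <= / rho).
    { apply Rinv_le_contravar; [lra|]. simpl. nra. }
    assert (H2 : / rho <= / / eps) by (apply Rinv_le_contravar; lra).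
    rewrite Rinv_inv in H2. lra.
  - intros w. specialize (Hf w). lra.
  - intros w Hw. assert (Hr2p : 0 < rho ^ 2) by (apply pow_lt; lra).
    assert (H0 : 0 <= w ^ 2 / rho ^ 2) by (apply Rdiv_le_0_compat; [apply pow2_ge_0|assumption]).
    destruct (Rle_lt_dec (- rho) w) as [H|H].
    + specialize (Hin w (conj H Hw)). lra.
    + assert (1 <= w ^ 2 / rho ^ 2).
      { apply Rle_div_r; [assumption|]. rewrite Rmult_1_l. simpl. nra. }
      specialize (Hf w). lra.
  - destruct (tpoly_glim _ _ _ _ Hg) as [Hcont Hlim].
    change (forall u, continuous f u) in Hcont. change (glim f g) in Hlim.
    destruct (Hlim k Hkpos) as [M1 H1]. destruct (Hcdf k Hkpos) as [M2 H2].
    set (M := Rmax rho (Rmax M1 M2)).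
    assert (A0 : rho <= M) by apply Rmax_l.
    assert (A1 : M1 <= M) by (eapply Rle_trans; [apply Rmax_l|apply Rmax_r]).
    assert (A2 : M2 <= M) by (eapply Rle_trans; [apply Rmax_r|apply Rmax_r]).
    specialize (H1 M A1). specialize (H2 M A2). apply Rabs_def2 in H1, H2.
    assert (Hc1 : forall c0 u : R, continuous (fun _ : R => c0) u) by (intros; apply continuous_cst).
    set (b := t + 2 * k) in *. assert (Hb : - M <= b <= rho) by (unfold b, k in *; lra).
    assert (E1 := gint_Chasles f (- M) b M Hcont). assert (E2 := gint_Chasles f b rho M Hcont).
    assert (F1 : gint f (- M) b <= (1 + k) * gint (fun _ => 1) (- M) b).
    { rewrite <- gint_const. apply gint_le; [lra|assumption|auto|]. intros u _. apply Hf. }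
    assert (F2 : gint f b rho <= 2 * k * gint (fun _ => 1) b rho).
    { rewrite <- gint_const. apply gint_le; [lra|assumption|auto|]. intros u Hu. apply Hout; lra. }
    assert (F3 : gint f rho M <= 2 * gint (fun _ => 1) rho M).
    { rewrite <- gint_const. apply gint_le; [lra|assumption|auto|]. intros u _.
      specialize (Hf u). unfold k in *. lra. }
    assert (B1 : gint (fun _ => 1) (- M) b = gint (fun _ => 1) (- M) t + gint (fun _ => 1) t b)
      by (symmetry; apply gint_Chasles; auto).
    assert (B2 : gint (fun _ => 1) t b <= 2 * k).
    { unfold gint. replace (2 * k) with (RInt (fun _ => 1) t b)
        by (rewrite RInt_const; unfold scal, b; simpl; unfold mult; simpl; ring).
      apply RInt_le; [unfold b; lra|now apply ex_gint|apply ex_RInt_const|].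
      intros u _. rewrite Rmult_1_l. eapply Rle_trans; [apply density_le_gexp|].
      unfold gexp. rewrite <- exp_0. apply exp_le_compat. assert (Hu := pow2_ge_0 u). lra. }
    destruct (gint_total M) as [_ T1]; [lra|]. destruct (gint_total rho) as [T2 _]; [lra|].
    specialize (HM rho Hr1). fold (gexp rho) in HM.
    assert (C1 : gint (fun _ => 1) (- M) b + gint (fun _ => 1) b M = gint (fun _ => 1) (- M) M)
      by (apply gint_Chasles; auto).
    assert (C2 : gint (fun _ => 1) b rho + gint (fun _ => 1) rho M = gint (fun _ => 1) b M)
      by (apply gint_Chasles; auto).
    assert (C3 : gint (fun _ => 1) (- M) (- rho) + gint (fun _ => 1) (- rho) M = gint (fun _ => 1) (- M) M)
      by (apply gint_Chasles; auto).
    assert (C4 : gint (fun _ => 1) (- rho) rho + gint (fun _ => 1) rho M = gint (fun _ => 1) (- rho) M)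
      by (apply gint_Chasles; auto).
    assert (P0 : forall a a', a <= a' -> 0 <= gint (fun _ => 1) a a')
      by (intros; apply gint_nonneg; [assumption|auto|intros; lra]).
    assert (P1 := P0 (- M) b (proj1 Hb)). assert (P2 := P0 b rho (proj2 Hb)).
    assert (P3 := P0 rho M A0). assert (P4 : 0 <= gint (fun _ => 1) (- M) (- rho)) by (apply P0; lra).
    set (x1 := gint (fun _ => 1) (- M) b) in *. set (x2 := gint (fun _ => 1) b rho) in *.
    set (x3 := gint (fun _ => 1) rho M) in *.
    assert (x1 <= 1) by lra. assert (x2 <= 1) by lra. unfold k in *. nra.
Qed.

(** The threshold for the grid may depend on [N], because the frequencies involved can grow with
    [N]. *)
Definition char_fun_converges (w : nat -> R -> R) : Prop :=
  forall tau phi eps, 0 < eps -> exists N0, forall N, (N0 <= N)%nat ->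
    exists Q0, forall Q, (Q0 <= Q)%nat ->
      Rabs (avg Q (fun x => cos (tau * w N x + phi)) - cos phi * exp (- (tau ^ 2 / 4))) <= eps.

Lemma avg_tev_converges (w : nat -> R -> R) (l : list (R * (R * R))) (eps : R) :
  char_fun_converges w -> 0 < eps -> exists N0, forall N, (N0 <= N)%nat ->
    exists Q0, forall Q, (Q0 <= Q)%nat -> Rabs (avg Q (fun x => tev l (w N x)) - gam l) <= eps.
Proof.
  intros Hw. revert eps. induction l as [|t l IH]; intros eps Heps.
  - exists 0%nat. intros N _. exists 1%nat. intros Q HQ. unfold tev, gam; simpl lsum.
    rewrite avg_const by lia. rewrite Rminus_diag, Rabs_R0. lra.
  - assert (Hc := Rabs_pos (fst t)).
    assert (Hp : 0 < eps / (2 * (Rabs (fst t) + 1))) by (apply Rdiv_lt_0_compat; lra).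
    destruct (Hw (fst (snd t)) (snd (snd t)) _ Hp) as [N1 H1].
    destruct (IH (eps / 2)) as [N2 H2]; [lra|].
    exists (Nat.max N1 N2). intros N HN.
    destruct (H1 N) as [Q1 HQ1]; [lia|]. destruct (H2 N) as [Q2 HQ2]; [lia|].
    exists (Nat.max Q1 Q2). intros Q HQ.
    specialize (HQ1 Q ltac:(lia)). specialize (HQ2 Q ltac:(lia)).
    change (gam (t :: l)) with
      (fst t * (cos (snd (snd t)) * exp (- (fst (snd t) ^ 2 / 4))) + gam l).
    rewrite (avg_ext Q _ (fun x => fst t * cos (fst (snd t) * w N x + snd (snd t)) + tev l (w N x)))
      by (intros; reflexivity).
    rewrite avg_plus, avg_scal.
    set (a := avg Q _) in *. set (b := avg Q _) in HQ2 |- *.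
    set (v := cos _ * exp _) in *.
    replace (fst t * a + b - (fst t * v + gam l)) with (fst t * (a - v) + (b - gam l)) by ring.
    eapply Rle_trans; [apply Rabs_triang|]. rewrite Rabs_mult.
    assert (Hv := Rabs_pos (a - v)). apply Rle_div_r in HQ1; [|lra]. nra.
Qed.

Lemma continuity_tpoly_comp (A T f g : _) (w : R -> R) :
  tpoly A T f g -> (forall x, continuity_pt w x) -> forall x, continuity_pt (fun x => f (w x)) x.
Proof.
  intros Hf Hw x. apply (continuity_pt_comp w f); [apply Hw|].
  apply continuity_pt_filterlim. apply (tpoly_glim _ _ _ _ Hf).
Qed.

(** Markov's inequality for the test function plus its quadratic correction. The opposite bound
    comes from the same statement for [- w] at [- t]. *)
Lemma clt_upper (w : nat -> R -> R) (t p eps : R) :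
  (forall N x, continuity_pt (w N) x) -> char_fun_converges w ->
  (exists N0, forall N, (N0 <= N)%nat -> exists Q0, forall Q, (Q0 <= Q)%nat ->
      avg Q (fun x => w N x ^ 2) <= 3) ->
  cdf_lim t p -> 0 < eps ->
  exists N0, forall N, (N0 <= N)%nat -> mle (fun x => 0 <= x <= 1 /\ w N x <= t) (p + eps).
Proof.
  intros Hcont Hchar [N1 Hsq] Hcdf Heps.
  set (e := Rmin 1 (eps / 8)).
  assert (He : 0 < e <= 1 /\ 8 * e <= eps).
  { unfold e, Rmin. destruct (Rle_dec 1 (eps / 8)); lra. }
  destruct (clt_test_function t p e Hcdf (proj1 He)) as [A [T [f [g [rho [Hf [Hr [Hr2 [Hf0 [Hf1 Hg]]]]]]]]]].
  assert (Hf' := Hf). destruct Hf' as [l [_ [_ [Hfl Hgl]]]].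
  destruct (avg_tev_converges w l e Hchar) as [N2 HN2]; [lra|].
  exists (Nat.max N1 N2). intros N HN.
  destruct (Hsq N) as [Q1 HQ1]; [lia|]. destruct (HN2 N) as [Q2 HQ2]; [lia|].
  assert (Hrp : 0 < rho ^ 2) by (apply pow_lt; lra).
  set (G := fun x => f (w N x) + / rho ^ 2 * w N x ^ 2).
  assert (Hi : 0 < / rho ^ 2) by now apply Rinv_0_lt_compat.
  destruct (mle_avg (fun x => 0 <= x <= 1 /\ w N x <= t) G e) as [Q3 HQ3].
  - intros x. apply (continuity_pt_plus (fun x => f (w N x))).
    + now apply (continuity_tpoly_comp A T f g).
    + apply continuity_pt_scal. apply (continuity_pt_comp (w N) (fun y => y ^ 2)); [apply Hcont|].
      apply derivable_continuous_pt, derivable_pt_pow.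
  - intros x. unfold G. assert (H := pow2_ge_0 (w N x)). specialize (Hf0 (w N x)). nra.
  - intros x [Hx Hwx]. split; [assumption|]. specialize (Hf1 _ Hwx). unfold G.
    unfold Rdiv in Hf1. lra.
  - lra.
  - set (Q := Nat.max Q1 (Nat.max Q2 Q3)).
    specialize (HQ1 Q ltac:(lia)). specialize (HQ2 Q ltac:(lia)). specialize (HQ3 Q ltac:(lia)).
    eapply mle_mono; [| |exact HQ3]; [tauto|].
    unfold G. rewrite avg_plus, avg_scal. rewrite (avg_ext Q _ _ (fun x => Hfl (w N x))).
    rewrite Hgl in HQ2. apply Rabs_le_between in HQ2.
    assert (/ rho ^ 2 * avg Q (fun x => w N x ^ 2) <= 3 * e) by nra. lra.
Qed.

(** * Deletion of the indices in a hitting set *)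

Definition bad (sigma : nat -> nat) (B : list nat) (k : nat) : bool :=
  if in_dec Nat.eq_dec (sigma k) B then true else false.

Definition good (sigma : nat -> nat) (B l : list nat) : list nat :=
  filter (fun k => negb (bad sigma B k)) l.

Lemma bad_spec (sigma : nat -> nat) (B : list nat) (k : nat) :
  bad sigma B k = true <-> In (sigma k) B.
Proof. unfold bad. destruct (in_dec Nat.eq_dec (sigma k) B); split; congruence || tauto. Qed.

(** Injectivity makes the bound independent of the list, hence of how far the sum extends. *)
Lemma bad_count (sigma : nat -> nat) (B l : list nat) :
  (forall i j, sigma i = sigma j -> i = j) -> NoDup l ->
  (length (filter (bad sigma B) l) <= length B)%nat.
Proof.
  intros Hinj Hl. rewrite <- (length_map sigma). apply NoDup_incl_length.
  - apply FinFun.Injective_map_NoDup; [exact Hinj|]. now apply NoDup_filter.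
  - intros y Hy. apply in_map_iff in Hy. destruct Hy as [k [<- Hk]].
    apply filter_In in Hk. now apply bad_spec.
Qed.

Lemma length_good (sigma : nat -> nat) (B l : list nat) :
  (forall i j, sigma i = sigma j -> i = j) -> NoDup l ->
  INR (length l) - INR (length B) <= INR (length (good sigma B l)) <= INR (length l).
Proof.
  intros Hinj Hl. assert (H := bad_count sigma B l Hinj Hl).
  assert (H2 := filter_length (bad sigma B) l). fold (good sigma B l) in H2.
  apply le_INR in H. apply (f_equal INR) in H2. rewrite plus_INR in H2.
  assert (H3 := pos_INR (length (filter (bad sigma B) l))). lra.
Qed.

Lemma bsum_abs (nu : nat -> nat) (l : list nat) (x : R) : Rabs (bsum nu l x) <= INR (length l).
Proof.
  unfold bsum. eapply Rle_trans; [apply lsum_abs|].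
  rewrite <- (Rmult_1_l (INR _)), <- lsum_const. apply lsum_le. intros k _.
  apply Rabs_le, xcos_bound.
Qed.

Lemma bsum_good (nu sigma : nat -> nat) (B l : list nat) (x : R) :
  (forall i j, sigma i = sigma j -> i = j) -> NoDup l ->
  Rabs (bsum nu l x - bsum nu (good sigma B l) x) <= INR (length B).
Proof.
  intros Hinj Hl. unfold bsum. rewrite (lsum_filter_split _ (bad sigma B) l).
  fold (good sigma B l). unfold Rminus. rewrite Rplus_assoc, Rplus_opp_r, Rplus_0_r.
  eapply Rle_trans; [apply (bsum_abs nu)|]. apply le_INR. now apply bad_count.
Qed.

Lemma bsum_seq (n sigma : nat -> nat) (N : nat) (x : R) :
  trig_sum n sigma N x = bsum (fun k => n (sigma k)) (seq 0 N) x.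
Proof. unfold trig_sum. apply psum_lsum. Qed.

Lemma list_bound (f : nat -> nat) (l : list nat) :
  exists M, (0 < M)%nat /\ forall k, In k l -> (f k <= M)%nat.
Proof.
  induction l as [|a l [M [H1 H2]]]; [exists 1%nat; simpl; split; [lia|tauto]|].
  exists (Nat.max (f a) M). split; [lia|]. intros k [<-|Hk]; [lia|]. specialize (H2 k Hk). lia.
Qed.

Lemma adm_off (n sigma : nat -> nat) (P : nat) (B l : list nat) :
  (forall k, (0 < n k)%nat) -> (forall i j, sigma i = sigma j -> i = j) -> (2 <= P)%nat ->
  hits n P B -> NoDup l -> (forall k, In k l -> bad sigma B k = false) ->
  exists M Q0, forall Q, (Q0 <= Q)%nat -> adm (fun k => n (sigma k)) P M Q (blk 1 l).
Proof.
  intros npos Hinj HP HB Hl Hbad. destruct (list_bound (fun k => n (sigma k)) l) as [M [HM1 HM2]].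
  exists M, (S (P * M)). intros Q HQ. unfold adm. rewrite map_snd_blk.
  repeat split; try assumption; try lia; auto.
  apply (hits_off n sigma P B l Hinj HB Hl).
  intros k Hk Hin. apply bad_spec in Hin. rewrite Hbad in Hin by assumption. discriminate.
Qed.

Lemma good_not_bad (sigma : nat -> nat) (B l : list nat) (k : nat) :
  In k (good sigma B l) -> In k l /\ bad sigma B k = false.
Proof.
  intros Hk. apply filter_In in Hk. destruct Hk as [H1 H2]. split; [assumption|].
  now destruct (bad sigma B k).
Qed.

Lemma adm_scale (nu : nat -> nat) (P M Q : nat) (c c' : R) (l : list nat) :
  adm nu P M Q (blk c l) -> adm nu P M Q (blk c' l).
Proof. unfold adm. now rewrite !map_snd_blk. Qed.

Lemma bsum_even_moment (nu : nat -> nat) (P M Q : nat) (l : list nat) (q : nat) :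
  adm nu P M Q (blk 1 l) -> (2 * q <= P)%nat ->
  avg Q (fun x => bsum nu l x ^ (2 * q)) <= INR (fact q) * INR (length l) ^ q.
Proof.
  intros H Hq. assert (E := even_moment_bound nu P M Q (blk 1 l) q H Hq).
  rewrite qvar_blk in E.
  replace (4 * (1 ^ 2 / 4 * INR (length l))) with (INR (length l)) in E by field.
  erewrite avg_ext; [exact E|]. intros x. simpl. rewrite wsum_blk, Rmult_1_l. reflexivity.
Qed.

Lemma cos_lipschitz (a b : R) : Rabs (cos a - cos b) <= Rabs (a - b).
Proof.
  destruct (Rtotal_order a b) as [H|[->|H]].
  - destruct (MVT_cor2 cos (fun c => - sin c) a b H) as [c [Hc _]];
      [intros; apply derivable_pt_lim_cos|].
    rewrite Rabs_minus_sym, Hc, Rabs_mult, Rabs_Ropp, (Rabs_minus_sym a b).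
    assert (Rabs (sin c) <= 1) by (apply Rabs_le, SIN_bound). generalize (Rabs_pos (b - a)). nra.
  - rewrite !Rminus_diag, Rabs_R0. lra.
  - destruct (MVT_cor2 cos (fun c => - sin c) b a H) as [c [Hc _]];
      [intros; apply derivable_pt_lim_cos|].
    rewrite Hc, Rabs_mult, Rabs_Ropp.
    assert (Rabs (sin c) <= 1) by (apply Rabs_le, SIN_bound). generalize (Rabs_pos (a - b)). nra.
Qed.

Lemma exp_opp_diff (a b : R) : 0 <= a <= b -> 0 <= exp (- a) - exp (- b) <= b - a.
Proof.
  intros H. split; [assert (exp (- b) <= exp (- a)) by (apply exp_le_compat; lra); lra|].
  replace (exp (- b)) with (exp (- a) * exp (- (b - a))) by (rewrite <- exp_plus; f_equal; ring).
  assert (H1 := exp_ineq1_le (- (b - a))). assert (H2 := exp_pos (- a)).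
  assert (exp (- a) <= 1) by (rewrite <- exp_0; apply exp_le_compat; lra).
  assert (exp (- a) * (1 - exp (- (b - a))) <= 1 * (b - a)); [|lra].
  apply Rmult_le_compat; try lra.
  assert (exp (- (b - a)) <= 1) by (rewrite <- exp_0; apply exp_le_compat; lra). lra.
Qed.

Lemma pw_tends_to_0 (x eps : R) : 0 <= x -> 0 < eps -> exists m, pw m x <= eps.
Proof.
  intros Hx He. destruct (cv_speed_pow_fact x eps He) as [m Hm].
  exists m. specialize (Hm m (le_n m)). unfold Rdist in Hm.
  rewrite Rminus_0_r in Hm. apply Rabs_def2 in Hm. unfold pw. lra.
Qed.

Lemma large_sqrt_inv (C eps : R) : 0 < eps -> exists N0, forall N, (N0 <= N)%nat ->
  C * / sqrt (INR (S N)) <= eps.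
Proof.
  intros He. set (D := Rabs C + 1).
  assert (HD : 0 < D) by (unfold D; generalize (Rabs_pos C); lra).
  destruct (INR_unbounded ((D / eps) ^ 2)) as [N0 HN]. exists N0. intros N HNN.
  assert (Hle : INR N0 <= INR (S N)) by (apply le_INR; lia).
  assert (Hde : 0 < D / eps) by (apply Rdiv_lt_0_compat; assumption).
  assert (Hs : D / eps <= sqrt (INR (S N))).
  { rewrite <- (sqrt_pow2 (D / eps)) by lra. apply sqrt_le_1_alt. lra. }
  apply Rle_trans with (D * / sqrt (INR (S N))).
  - apply Rmult_le_compat_r; [left; apply Rinv_0_lt_compat; lra|].
    unfold D. generalize (Rle_abs C). lra.
  - apply Rle_div_l; [lra|]. apply Rle_div_l in Hs; [|assumption]. lra.
Qed.

(** The shift by one keeps the divisor positive. *)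
Definition normalized (n sigma : nat -> nat) (N : nat) (x : R) : R :=
  trig_sum n sigma (S N) x / sqrt (INR (S N)).

(** The Taylor order [m] is fixed by the limiting exponent [tau ^ 2 / 4], and with it the finite set
    [B]. The remaining errors then decay like the inverse square root of the number of terms. *)
Lemma normalized_char_fun (n sigma : nat -> nat) :
  (forall k, (0 < n k)%nat) -> condR n -> (forall i j, sigma i = sigma j -> i = j) ->
  char_fun_converges (normalized n sigma).
Proof.
  intros npos hR Hinj tau phi eps Heps.
  assert (Hv : 0 <= tau ^ 2 / 4) by (generalize (pow2_ge_0 tau); lra).
  destruct (pw_tends_to_0 (tau ^ 2 / 4) (eps / 6)) as [m Hm]; [assumption|lra|].
  set (P := (2 * m + 2)%nat). destruct (condR_hitting n P hR) as [B HB]; [lia|].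
  set (b := INR (length B)). assert (Hb : 0 <= b) by apply pos_INR.
  (* The summands bound the non-Gaussian defect, the change of the sum by deletion, and the variance
     lost by deletion. *)
  set (C := tau ^ 4 / 32 * exp (tau ^ 2 / 4) + Rabs tau * b + tau ^ 2 / 4 * b).
  destruct (large_sqrt_inv C (eps / 2)) as [N0 HN0]; [lra|].
  exists N0. intros N HN. specialize (HN0 N HN).
  set (nu := fun k => n (sigma k)). set (l := seq 0 (S N)). set (ks := good sigma B l).
  assert (Hl : NoDup l) by apply seq_NoDup.
  destruct (adm_off n sigma P B ks npos Hinj) as [M [Q0 HQ0]]; try assumption; try lia.
  { apply NoDup_filter, Hl. }
  { intros k Hk. now apply good_not_bad in Hk. }
  exists (S Q0). intros Q HQ. specialize (HQ0 Q ltac:(lia)). fold nu in HQ0.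
  set (r := sqrt (INR (S N))).
  assert (HN1 : 1 <= INR (S N)) by (rewrite S_INR; generalize (pos_INR N); lra).
  assert (Hrr : r * r = INR (S N)) by (apply sqrt_sqrt; lra).
  assert (Hr : 1 <= r) by (rewrite <- sqrt_1; apply sqrt_le_1_alt; lra).
  set (h := INR (length ks)).
  assert (Hh : INR (S N) - b <= h <= INR (S N)).
  { assert (H := length_good sigma B l Hinj Hl). unfold l in H at 1 4. rewrite length_seq in H. exact H. }
  assert (Hh0 : 0 <= h) by apply pos_INR.
  set (c := tau / r).
  assert (Hc2 : c ^ 2 = tau ^ 2 / INR (S N)) by (unfold c; rewrite <- Hrr; field; lra).
  assert (Hcf := char_fun_estimate nu P M Q (blk c ks) m phi (adm_scale _ _ _ _ _ c _ HQ0) ltac:(lia)).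
  set (q := qvar (blk c ks)) in *. set (d := qdef (blk c ks)) in *.
  set (z := / r) in *.
  assert (Hz : 0 < z <= 1).
  { unfold z. split; [apply Rinv_0_lt_compat; lra|]. rewrite <- Rinv_1. apply Rinv_le_contravar; lra. }
  assert (HzN : / INR (S N) = z * z) by (unfold z; rewrite <- Hrr; field; lra).
  assert (Hq : q = tau ^ 2 / 4 * (h * (z * z))).
  { unfold q. rewrite qvar_blk, Hc2, <- HzN. fold h. unfold Rdiv. ring. }
  assert (Hzz : h * (z * z) <= 1).
  { rewrite <- HzN. apply Rle_div_l; lra. }
  assert (Hhz : 1 - b * z <= h * (z * z)).
  { assert (INR (S N) * (z * z) = 1) by (rewrite <- HzN; field; lra).
    assert ((INR (S N) - b) * (z * z) <= h * (z * z)) by (apply Rmult_le_compat_r; nra).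
    assert (b * (z * z) <= b * z) by nra. lra. }
  assert (Hq0 : 0 <= q <= tau ^ 2 / 4).
  { rewrite Hq. split; [apply Rmult_le_pos; [assumption|]|]; nra. }
  assert (Hqd : tau ^ 2 / 4 - q <= tau ^ 2 / 4 * b * z) by (rewrite Hq; nra).
  assert (Hd : 0 <= d <= tau ^ 4 / 32 * z).
  { split; [apply qdef_nonneg|]. unfold d. rewrite qdef_blk, Hc2. fold h. unfold Rdiv.
    rewrite HzN.
    replace ((tau ^ 2 * (z * z) * / 4) ^ 2 * / 2 * h) with (tau ^ 4 * / 32 * ((z * z) * (h * (z * z))))
      by field.
    assert (0 <= tau ^ 4 * / 32) by (replace (tau ^ 4) with (tau ^ 2 * tau ^ 2) by ring; nra).
    apply Rmult_le_compat_l; [assumption|]. nra. }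
  assert (Hpw : pw m q <= eps / 6) by (eapply Rle_trans; [now apply pw_mono|exact Hm]).
  assert (Hexp : exp q <= exp (tau ^ 2 / 4)) by (apply exp_le_compat; lra).
  assert (Hdiff := exp_opp_diff q (tau ^ 2 / 4) Hq0).
  assert (Hrep : Rabs (avg Q (fun x => cos (tau * normalized n sigma N x + phi))
                       - avg Q (fun x => cos (wsum nu (blk c ks) x + phi))) <= Rabs tau * b * z).
  { rewrite <- avg_minus. eapply Rle_trans; [apply avg_abs; lia|].
    rewrite <- (avg_const Q (Rabs tau * b * z)) by lia. apply avg_le; [lia|]. intros x _.
    eapply Rle_trans; [apply cos_lipschitz|].
    rewrite wsum_blk. unfold normalized. rewrite bsum_seq. fold nu l r. unfold c.
    replace (tau * (bsum nu l x / r) + phi - (tau / r * bsum nu ks x + phi))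
      with (tau * z * (bsum nu l x - bsum nu ks x)) by (unfold z; field; lra).
    rewrite !Rabs_mult, (Rabs_pos_eq z) by lra.
    replace (Rabs tau * b * z) with (Rabs tau * z * b) by ring.
    apply Rmult_le_compat_l; [apply Rmult_le_pos; [apply Rabs_pos|lra]|].
    now apply bsum_good. }
  set (a1 := avg Q _) in *. set (a2 := avg Q _) in Hrep |- *.
  assert (Hde : d * exp q <= tau ^ 4 / 32 * z * exp (tau ^ 2 / 4)).
  { apply Rmult_le_compat; [apply Hd|left; apply exp_pos|apply Hd|exact Hexp]. }
  assert (Hcos : Rabs (cos phi * exp (- q) - cos phi * exp (- (tau ^ 2 / 4))) <= tau ^ 2 / 4 * b * z).
  { rewrite <- Rmult_minus_distr_l, Rabs_mult.
    assert (Rabs (cos phi) <= 1) by (apply Rabs_le, COS_bound).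
    rewrite (Rabs_pos_eq (exp _ - _)) by lra. assert (Hp := Rabs_pos (cos phi)). nra. }
  assert (Htot : tau ^ 4 / 32 * z * exp (tau ^ 2 / 4) + Rabs tau * b * z + tau ^ 2 / 4 * b * z = C * z)
    by (unfold C; ring).
  assert (HN0' : C * z <= eps / 2) by exact HN0.
  apply Rabs_le_between in Hcf, Hrep, Hcos. apply Rabs_le. lra.
Qed.

(** Any fixed bound would serve the quadratic term of the test function. The 3 arises from
    [y ^ 2 <= 2 * y' ^ 2 + 2 * b ^ 2], where [y'] is the sum over the retained indices. *)
Lemma normalized_second_moment (n sigma : nat -> nat) :
  (forall k, (0 < n k)%nat) -> condR n -> (forall i j, sigma i = sigma j -> i = j) ->
  exists N0, forall N, (N0 <= N)%nat -> exists Q0, forall Q, (Q0 <= Q)%nat ->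
    avg Q (fun x => normalized n sigma N x ^ 2) <= 3.
Proof.
  intros npos hR Hinj. destruct (condR_hitting n 2 hR) as [B HB]; [lia|].
  set (b := INR (length B)). assert (Hb : 0 <= b) by apply pos_INR.
  destruct (large_sqrt_inv (2 * b ^ 2) 1) as [N0 HN0]; [lra|].
  exists N0. intros N HN. specialize (HN0 N HN).
  set (nu := fun k => n (sigma k)). set (l := seq 0 (S N)). set (ks := good sigma B l).
  assert (Hl : NoDup l) by apply seq_NoDup.
  destruct (adm_off n sigma 2 B ks npos Hinj) as [M [Q0 HQ0]]; try assumption; try lia.
  { apply NoDup_filter, Hl. }
  { intros k Hk. now apply good_not_bad in Hk. }
  exists (S Q0). intros Q HQ. specialize (HQ0 Q ltac:(lia)). fold nu in HQ0.
  assert (HN1 : 1 <= INR (S N)) by (rewrite S_INR; generalize (pos_INR N); lra).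
  set (z := / sqrt (INR (S N))) in *.
  assert (Hsq : 1 <= sqrt (INR (S N))) by (rewrite <- sqrt_1; apply sqrt_le_1_alt; lra).
  assert (Hz : 0 < z <= 1).
  { unfold z. split; [apply Rinv_0_lt_compat; lra|]. rewrite <- Rinv_1. apply Rinv_le_contravar; lra. }
  assert (HzN : z * z = / INR (S N)) by (unfold z; rewrite <- Rinv_mult, sqrt_sqrt; lra).
  assert (Hmom := bsum_even_moment nu 2 M Q ks 1 HQ0 (le_n 2)).
  change (2 * 1)%nat with 2%nat in Hmom. simpl (INR (fact 1)) in Hmom. rewrite pow_1, Rmult_1_l in Hmom.
  assert (Hlen : INR (length ks) <= INR (S N)).
  { destruct (length_good sigma B l Hinj Hl) as [_ H]. unfold l in H at 2. rewrite length_seq in H. exact H. }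
  apply Rle_trans with (avg Q (fun x => 2 * (z * z) * bsum nu ks x ^ 2 + 2 * b ^ 2 * (z * z))).
  - apply avg_le; [lia|]. intros x _. unfold normalized. rewrite bsum_seq. fold nu l.
    assert (H := bsum_good nu sigma B l x Hinj Hl). fold ks b in H.
    replace (bsum nu l x / sqrt (INR (S N))) with (z * bsum nu l x) by (unfold z; unfold Rdiv; ring).
    set (y := bsum nu l x) in *. set (y' := bsum nu ks x) in *.
    assert (He := sqr_le_of_abs _ _ H).
    assert (y ^ 2 <= 2 * y' ^ 2 + 2 * b ^ 2) by (assert (Hs := pow2_ge_0 (y - 2 * y')); nra).
    replace ((z * y) ^ 2) with (z * z * y ^ 2) by ring.
    assert (0 <= z * z) by nra. nra.
  - rewrite avg_plus, avg_scal, avg_const by lia.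
    assert (2 * (z * z) * avg Q (fun x => bsum nu ks x ^ 2) <= 2 * (z * z) * INR (S N))
      by (apply Rmult_le_compat_l; nra).
    assert (z * z * INR (S N) = 1) by (rewrite HzN; field; lra).
    assert (Hb2 := pow2_ge_0 b).
    assert (b ^ 2 * (z * z) <= b ^ 2 * z) by (apply Rmult_le_compat_l; nra). lra.
Qed.

Lemma continuity_trig_sum (n sigma : nat -> nat) (N : nat) (x : R) :
  continuity_pt (trig_sum n sigma N) x.
Proof.
  apply (continuity_pt_ext (fun x => lsum (fun k => xcos (fun k => n (sigma k)) k x) (seq 0 N))).
  - intros y. symmetry. apply bsum_seq.
  - apply (lsum_continuity_pt (fun k x => xcos (fun k => n (sigma k)) k x)). intros k _.
    unfold xcos. apply (continuity_pt_comp (fun x => 2 * PI * INR (n (sigma k)) * x) cos);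
      [|apply continuity_cos].
    apply continuity_pt_scal, derivable_continuous_pt, derivable_pt_id.
Qed.

Lemma outer_nonneg (E : R -> Prop) (m : R) : lebesgue_outer_is E m -> 0 <= m.
Proof.
  intros [_ H]. destruct (Rle_lt_dec 0 m) as [Hm|Hm]; [assumption|]. exfalso.
  destruct (H (- m)) as [s [[a [b [H1 [_ H3]]]] Hs]]; [lra|].
  assert (lsum (fun i => b i - a i) (seq 0 0) <= s)
    by (apply partial_sum_le; [intros i; specialize (H1 i); lra|assumption]).
  simpl in H0. lra.
Qed.

Theorem permuted_clt (n sigma : nat -> nat) (t p : R) (m : nat -> R) :
  (forall k, (0 < n k)%nat) -> condR n -> (forall i j, sigma i = sigma j -> i = j) ->
  normal_half_cdf_is t p ->
  (forall N, lebesgue_outer_is (fun x => 0 <= x <= 1 /\ normalized n sigma N x <= t) (m N)) ->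
  Un_cv m p.
Proof.
  intros npos hR Hinj Hcdf Hm eps Heps. apply cdf_lim_of_def in Hcdf.
  assert (Hchar := normalized_char_fun n sigma npos hR Hinj).
  assert (Hsq := normalized_second_moment n sigma npos hR Hinj).
  assert (Hcont : forall N x, continuity_pt (normalized n sigma N) x).
  { intros N x. unfold normalized, Rdiv.
    apply (continuity_pt_mult (trig_sum n sigma (S N)) (fun _ => / sqrt (INR (S N)))).
    - apply continuity_trig_sum.
    - apply continuity_pt_const. intros ? ?; reflexivity. }
  destruct (clt_upper (normalized n sigma) t p (eps / 2) Hcont Hchar Hsq Hcdf) as [N1 HN1]; [lra|].
  destruct (clt_upper (fun N x => - normalized n sigma N x) (- t) (1 - p) (eps / 2)) as [N2 HN2].
  - intros N x. apply continuity_pt_opp, Hcont.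
  - intros tau phi e He. destruct (Hchar (- tau) phi e He) as [N0 HN0]. exists N0. intros N HN.
    destruct (HN0 N HN) as [Q0 HQ0]. exists Q0. intros Q HQ. specialize (HQ0 Q HQ).
    replace ((- tau) ^ 2) with (tau ^ 2) in HQ0 by ring.
    erewrite avg_ext; [exact HQ0|]. intros x. simpl. f_equal. ring.
  - destruct Hsq as [N0 HN0]. exists N0. intros N HN. destruct (HN0 N HN) as [Q0 HQ0].
    exists Q0. intros Q HQ. specialize (HQ0 Q HQ). erewrite avg_ext; [exact HQ0|].
    intros x. simpl. ring.
  - now apply cdf_lim_opp.
  - lra.
  - exists (Nat.max N1 N2). intros N HN. specialize (HN1 N ltac:(lia)). specialize (HN2 N ltac:(lia)).
    assert (H1 : m N <= p + eps / 2) by (eapply outer_le_mle; [apply Hm|exact HN1]).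
    assert (Hp := cdf_lim_range t p Hcdf).
    (* The two events cover [0,1], so the upper bound for the second is a lower bound for the
       first. *)
    assert (H2 : 1 <= m N + (1 - p + eps / 2)).
    { eapply mle_cover_unit; [|apply (outer_mle _ _ (Hm N))|exact HN2| |].
      - intros x Hx. destruct (Rle_lt_dec (normalized n sigma N x) t); [left|right]; split; lra.
      - eapply outer_nonneg, Hm.
      - lra. }
    unfold Rdist. apply Rabs_def1; lra.
Qed.

(** * Upper half of the law of the iterated logarithm *)

Lemma mle_limit (E : R -> Prop) (s : R) : (forall delta, 0 < delta -> mle E (s + delta)) -> mle E s.
Proof.
  intros H delta Hd. destruct (H (delta / 2) ltac:(lra) (delta / 2) ltac:(lra)) as [s' [H1 H2]].
  exists s'. split; [assumption|lra].
Qed.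

Lemma adm_sub (nu : nat -> nat) (P M Q : nat) (l l' : list nat) :
  adm nu P M Q (blk 1 l) -> NoDup l' -> incl l' l -> adm nu P M Q (blk 1 l').
Proof.
  unfold adm. rewrite !map_snd_blk. intros [H1 [H2 H3]] Hnd Hinc.
  split; [now apply (off_sub nu P l)|]. split; [auto|assumption].
Qed.

Lemma good_app (sigma : nat -> nat) (B l l' : list nat) :
  good sigma B (l ++ l') = good sigma B l ++ good sigma B l'.
Proof. apply filter_app. Qed.

Lemma continuity_bsum (nu : nat -> nat) (l : list nat) (x : R) : continuity_pt (bsum nu l) x.
Proof.
  apply (lsum_continuity_pt (fun k x => xcos nu k x)). intros k _.
  unfold xcos. apply (continuity_pt_comp (fun x => 2 * PI * INR (nu k) * x) cos);
    [|apply continuity_cos].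
  apply continuity_pt_scal, derivable_continuous_pt, derivable_pt_id.
Qed.

(** Markov's inequality with moments of order [2 * q], summed over the items; an item is a start, a
    length and a threshold. *)
Lemma block_union_bound (n sigma : nat -> nat) (P q N : nat) (B : list nat)
    (items : list (nat * nat * R)) :
  (forall k, (0 < n k)%nat) -> (forall i j, sigma i = sigma j -> i = j) -> hits n P B ->
  (2 <= P)%nat -> (2 * q <= P)%nat ->
  (forall a len thr, In (a, len, thr) items -> (a + len <= N)%nat /\ 0 < thr) ->
  mle (fun x => 0 <= x <= 1 /\ exists a len thr, In (a, len, thr) items /\
         thr <= Rabs (bsum (fun k => n (sigma k)) (good sigma B (seq a len)) x))
      (lsum (fun it => INR (fact q) * (INR (snd (fst it)) / snd it ^ 2) ^ q) items).
Proof.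
  intros npos Hinj HB HP Hq Hit. set (nu := fun k => n (sigma k)).
  set (v := fun (it : nat * nat * R) x => bsum nu (good sigma B (seq (fst (fst it)) (snd (fst it)))) x).
  set (G := fun x => lsum (fun it => (/ snd it) ^ (2 * q) * v it x ^ (2 * q)) items).
  destruct (adm_off n sigma P B (good sigma B (seq 0 N)) npos Hinj HP HB) as [M [Q0 HQ0]].
  { apply NoDup_filter, seq_NoDup. }
  { intros k Hk. now apply good_not_bad in Hk. }
  fold nu in HQ0. apply mle_limit. intros delta Hd.
  destruct (mle_avg (fun x => 0 <= x <= 1 /\ exists a len thr, In (a, len, thr) items /\
         thr <= Rabs (bsum nu (good sigma B (seq a len)) x)) G delta) as [Q1 HQ1].
  - intros x. apply (lsum_continuity_pt (fun it x => (/ snd it) ^ (2 * q) * v it x ^ (2 * q))).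
    intros it _. apply continuity_pt_scal.
    apply (continuity_pt_comp (v it) (fun y => y ^ (2 * q))); [apply continuity_bsum|].
    apply derivable_continuous_pt, derivable_pt_pow.
  - intros x. apply lsum_nonneg. intros it _. apply Rmult_le_pos; apply pow_even_nonneg.
  - intros x [Hx [a [len [thr [Hin Hthr]]]]]. split; [assumption|].
    apply Rle_trans with ((/ thr) ^ (2 * q) * v (a, len, thr) x ^ (2 * q)).
    + rewrite <- Rpow_mult_distr, pow_mult. rewrite <- (pow1 q) at 1. apply pow_incr. split; [lra|].
      destruct (Hit a len thr Hin) as [_ Ht].
      assert (Hge : 1 <= Rabs (/ thr * v (a, len, thr) x)).
      { rewrite Rabs_mult, (Rabs_pos_eq (/ thr)) by (left; now apply Rinv_0_lt_compat).
        apply (Rmult_le_reg_l thr); [assumption|]. rewrite <- Rmult_assoc, Rinv_r by lra.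
        unfold v; simpl. lra. }
      rewrite <- (pow2_abs (_ * _)). nra.
    + apply (lsum_pick (fun it => (/ snd it) ^ (2 * q) * v it x ^ (2 * q)) items (a, len, thr));
        [|assumption]. intros it _. apply Rmult_le_pos; apply pow_even_nonneg.
  - assumption.
  - set (Q := S (Nat.max Q0 Q1)). specialize (HQ0 Q ltac:(lia)). specialize (HQ1 Q ltac:(lia)).
    eapply mle_mono; [| |exact HQ1]; [tauto|]. apply Rplus_le_compat_r.
    unfold G. rewrite (avg_lsum Q (fun it x => (/ snd it) ^ (2 * q) * v it x ^ (2 * q))).
    apply lsum_le. intros [[a len] thr] Hin. destruct (Hit a len thr Hin) as [Hlen Ht]. simpl snd. simpl fst.
    rewrite avg_scal.
    assert (Hadm : adm nu P M Q (blk 1 (good sigma B (seq a len)))).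
    { apply (adm_sub nu P M Q _ _ HQ0); [apply NoDup_filter, seq_NoDup|].
      intros k Hk. apply filter_In in Hk. apply filter_In. destruct Hk as [Hk1 Hk2].
      split; [|assumption]. apply in_seq in Hk1. apply in_seq. lia. }
    assert (Hmom := bsum_even_moment nu P M Q _ q Hadm Hq).
    assert (Hl : INR (length (good sigma B (seq a len))) <= INR len).
    { destruct (length_good sigma B (seq a len) Hinj (seq_NoDup _ _)) as [_ H].
      rewrite length_seq in H. exact H. }
    unfold Rdiv. rewrite Rpow_mult_distr, (pow_mult (/ thr)).
    replace ((/ thr) ^ 2) with (/ thr ^ 2) by (rewrite pow_inv; reflexivity).
    rewrite (Rmult_comm (INR len ^ q)), <- Rmult_assoc, (Rmult_comm (INR (fact q))), Rmult_assoc.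
    assert (Hi : 0 <= (/ thr ^ 2) ^ q).
    { apply pow_le. left. apply Rinv_0_lt_compat, pow_lt, Ht. }
    apply Rmult_le_compat_l; [assumption|].
    eapply Rle_trans; [exact Hmom|]. apply Rmult_le_compat_l; [apply pos_INR|].
    apply pow_incr. split; [apply pos_INR|exact Hl].
Qed.

(** * Dyadic chaining *)

(** Initial segments ending at [2 ^ d] equally spaced points of the dyadic range. Their number does
    not grow with [e], so the almost sharp threshold is affordable. *)
Definition chain_top (eps L : R) (d e : nat) : list (nat * nat * R) :=
  map (fun b => (0%nat, (2 ^ (d + e) + b * 2 ^ e)%nat,
                 (1 + eps) * sqrt (INR (2 ^ (d + e) + b * 2 ^ e) * L))) (seq 0 (2 ^ d)).

(** The ratio 9/10 is below 1, so the thresholds add up to at most 9 times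
    [eps * sqrt (2 ^ (d + e) * L)]. Its fourth power exceeds 1/2, so fourth and higher moments beat
    the doubling of the number of blocks per level. *)
Definition chain_thr (eps L : R) (d e j : nat) : R :=
  eps * (9 / 10) ^ j * sqrt (INR (2 ^ (d + e)) * L).

Definition chain_level (eps L : R) (d e j : nat) : list (nat * nat * R) :=
  map (fun b => ((2 ^ (d + e) + b * 2 ^ (e - j))%nat, (2 ^ (e - j))%nat, chain_thr eps L d e j))
      (seq 0 (2 ^ (d + j))).

Definition chain_items (eps L : R) (d e : nat) : list (nat * nat * R) :=
  chain_top eps L d e ++ flat_map (chain_level eps L d e) (seq 1 e).

Lemma chain_items_range (eps L : R) (d e a len : nat) (thr : R) :
  0 < eps -> 0 < L -> In (a, len, thr) (chain_items eps L d e) ->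
  (a + len <= 2 * 2 ^ (d + e))%nat /\ 0 < thr.
Proof.
  intros Heps HL Hin.
  assert (Hpos : forall m, (0 < 2 ^ m)%nat) by (intros; apply Nat.neq_0_lt_0, Nat.pow_nonzero; lia).
  apply in_app_or in Hin. destruct Hin as [Hin|Hin].
  - apply in_map_iff in Hin. destruct Hin as [b [E Hb]]. inversion E; subst. apply in_seq in Hb.
    split.
    + rewrite Nat.pow_add_r. specialize (Hpos e). nia.
    + apply Rmult_lt_0_compat; [lra|]. apply sqrt_lt_R0, Rmult_lt_0_compat; [|assumption].
      apply lt_0_INR. specialize (Hpos (d + e)%nat). lia.
  - apply in_flat_map in Hin. destruct Hin as [j [Hj Hin]]. apply in_seq in Hj.
    apply in_map_iff in Hin. destruct Hin as [b [E Hb]]. inversion E; subst. apply in_seq in Hb.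
    split.
    + assert (H : (2 ^ (d + e) = 2 ^ (d + j) * 2 ^ (e - j))%nat)
        by (rewrite <- Nat.pow_add_r; f_equal; lia).
      specialize (Hpos (e - j)%nat). nia.
    + unfold chain_thr. apply Rmult_lt_0_compat.
      * apply Rmult_lt_0_compat; [assumption|apply pow_lt; lra].
      * apply sqrt_lt_R0, Rmult_lt_0_compat; [|assumption]. apply lt_0_INR, Hpos.
Qed.

Lemma geometric_bound (r : R) (m : nat) : 0 <= r < 1 -> lsum (fun j => r ^ j) (seq 1 m) <= r / (1 - r).
Proof.
  intros Hr. assert (E : lsum (fun j => r ^ j) (seq 1 m) = (r - r ^ S m) / (1 - r)).
  { induction m as [|m IH]; [simpl; field; lra|]. rewrite lsum_seq_S, IH.
    replace (1 + m)%nat with (S m) by lia. simpl. field. lra. }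
  rewrite E. unfold Rdiv. apply Rmult_le_compat_r; [left; apply Rinv_0_lt_compat; lra|].
  assert (0 <= r ^ S m) by (apply pow_le; lra). lra.
Qed.

(* Chaining: an arbitrary [N] in the dyadic range is reached from one of the [2^d] top level points
   by adding at most one block at each finer dyadic level. *)
Lemma chaining (nu sigma : nat -> nat) (B : list nat) (eps L x : R) (d e N : nat) :
  0 < eps -> 0 < L ->
  (forall a len thr, In (a, len, thr) (chain_items eps L d e) ->
     Rabs (bsum nu (good sigma B (seq a len)) x) <= thr) ->
  (2 ^ (d + e) <= N < 2 * 2 ^ (d + e))%nat ->
  Rabs (bsum nu (good sigma B (seq 0 N)) x) <= (1 + 10 * eps) * sqrt (INR N * L).
Proof.
  intros Heps HL Hit HN. set (M := (2 ^ (d + e))%nat) in *.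
  assert (Hpos : forall m, (0 < 2 ^ m)%nat) by (intros; apply Nat.neq_0_lt_0, Nat.pow_nonzero; lia).
  assert (Hj : forall j b, (j <= e)%nat -> (b < 2 ^ (d + j))%nat ->
     Rabs (bsum nu (good sigma B (seq 0 (M + b * 2 ^ (e - j)))) x)
     <= (1 + eps) * sqrt (INR (M + b * 2 ^ (e - j)) * L) + lsum (chain_thr eps L d e) (seq 1 j)).
  { induction j as [|j IH]; intros b Hje Hb.
    - rewrite Nat.sub_0_r, Nat.add_0_r in *. simpl lsum. rewrite Rplus_0_r.
      apply Hit. apply in_or_app. left. apply in_map_iff. exists b. split; [reflexivity|].
      apply in_seq. lia.
    - rewrite lsum_seq_S. replace (1 + j)%nat with (S j) by lia.
      assert (Hthr : 0 <= chain_thr eps L d e (S j)).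
      { unfold chain_thr. apply Rmult_le_pos; [|apply sqrt_pos].
        apply Rmult_le_pos; [lra|apply pow_le; lra]. }
      assert (He : (2 ^ (e - j) = 2 * 2 ^ (e - S j))%nat).
      { replace (e - j)%nat with (S (e - S j)) by lia. apply Nat.pow_succ_r'. }
      replace (d + S j)%nat with (S (d + j)) in Hb by lia. rewrite Nat.pow_succ_r' in Hb.
      set (u := (2 ^ (e - S j))%nat) in *.
      destruct (Nat.Even_or_Odd b) as [[b' ->]|[b' ->]].
      + assert (H := IH b' ltac:(lia) ltac:(lia)). rewrite He in H.
        replace (M + 2 * b' * u)%nat with (M + b' * (2 * u))%nat by lia. lra.
      + assert (H := IH b' ltac:(lia) ltac:(lia)). rewrite He in H.
        set (a := (M + b' * (2 * u))%nat) in *.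
        replace (M + (2 * b' + 1) * u)%nat with (a + u)%nat by (unfold a; lia).
        rewrite seq_app, good_app. unfold bsum. rewrite lsum_app.
        fold (bsum nu (good sigma B (seq 0 a)) x). fold (bsum nu (good sigma B (seq (0 + a) u)) x).
        rewrite Nat.add_0_l. eapply Rle_trans; [apply Rabs_triang|].
        assert (Hblk : Rabs (bsum nu (good sigma B (seq a u)) x) <= chain_thr eps L d e (S j)).
        { apply Hit. apply in_or_app. right. apply in_flat_map. exists (S j).
          split; [apply in_seq; lia|]. apply in_map_iff. exists (2 * b')%nat. split.
          - fold M u. f_equal. f_equal. unfold a; lia.
          - apply in_seq. replace (d + S j)%nat with (S (d + j)) by lia.
            rewrite Nat.pow_succ_r'. lia. }
        assert (Hsq : sqrt (INR a * L) <= sqrt (INR (a + u) * L)).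
        { apply sqrt_le_1_alt. apply Rmult_le_compat_r; [lra|]. apply le_INR; lia. }
        nra. }
  assert (H := Hj e (N - M)%nat (le_n e) ltac:(fold M; lia)).
  rewrite Nat.sub_diag in H. replace (M + (N - M) * 2 ^ 0)%nat with N in H by (simpl; lia).
  assert (Hsum : lsum (chain_thr eps L d e) (seq 1 e) <= 9 * eps * sqrt (INR N * L)).
  { unfold chain_thr. fold M.
    rewrite (lsum_ext _ (fun j => eps * sqrt (INR M * L) * (9 / 10) ^ j)) by (intros; ring).
    rewrite lsum_scal. assert (Hg := geometric_bound (9 / 10) e ltac:(lra)).
    replace (9 / 10 / (1 - 9 / 10)) with 9 in Hg by field.
    assert (Hsq : sqrt (INR M * L) <= sqrt (INR N * L)).
    { apply sqrt_le_1_alt. apply Rmult_le_compat_r; [lra|]. apply le_INR; lia. }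
    assert (H0 := sqrt_pos (INR M * L)).
    assert (Hes : eps * sqrt (INR M * L) <= eps * sqrt (INR N * L)) by (apply Rmult_le_compat_l; lra).
    apply Rle_trans with (eps * sqrt (INR M * L) * 9); [|lra].
    apply Rmult_le_compat_l; [apply Rmult_le_pos; lra|exact Hg]. }
  lra.
Qed.

(** The condition on [d] makes the thresholds of the finer levels, relative to block length, no
    weaker than at the top. The top level contributes one share [2 ^ d * Y], and all other levels
    together at most four, by the geometric series in 4/5. *)
Lemma chain_items_sum (eps L y : R) (d e q : nat) :
  0 < eps -> 0 < L -> y = (1 + eps) ^ 2 * L -> (1 + eps) ^ 2 <= eps ^ 2 * 2 ^ d -> (2 <= q)%nat ->
  lsum (fun it => INR (fact q) * (INR (snd (fst it)) / snd it ^ 2) ^ q) (chain_items eps L d e)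
  <= 5 * 2 ^ d * (INR (fact q) * (/ y) ^ q).
Proof.
  intros Heps HL Hy Hd Hq. set (Y := INR (fact q) * (/ y) ^ q).
  assert (Hy0 : 0 < y) by (rewrite Hy; apply Rmult_lt_0_compat; [apply pow_lt; lra|assumption]).
  assert (HY : 0 <= Y).
  { apply Rmult_le_pos; [apply pos_INR|apply pow_le; left; now apply Rinv_0_lt_compat]. }
  assert (Hpos : forall m, 0 < INR (2 ^ m)) by (intros; rewrite INR_pow2; apply pow_lt; lra).
  unfold chain_items. rewrite lsum_app.
  assert (Htop : lsum (fun it => INR (fact q) * (INR (snd (fst it)) / snd it ^ 2) ^ q)
                   (chain_top eps L d e) = 2 ^ d * Y).
  { unfold chain_top. rewrite lsum_map. simpl fst; simpl snd.
    rewrite (lsum_ext _ (fun _ => Y)).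
    - rewrite lsum_const, length_seq, INR_pow2. ring.
    - intros b _. unfold Y. do 2 f_equal. rewrite Hy.
      set (N := INR (2 ^ (d + e) + b * 2 ^ e)).
      assert (HN : 0 < N).
      { unfold N. rewrite plus_INR. assert (H := Hpos (d + e)%nat).
        assert (H' := pos_INR (b * 2 ^ e)). lra. }
      rewrite Rpow_mult_distr. replace (sqrt (N * L) ^ 2) with (N * L)
        by (rewrite pow2_sqrt; nra). field. lra. }
  assert (Hlev : forall j, In j (seq 1 e) ->
     lsum (fun it => INR (fact q) * (INR (snd (fst it)) / snd it ^ 2) ^ q) (chain_level eps L d e j)
     <= 2 ^ d * Y * (4 / 5) ^ j).
  { intros j Hj. apply in_seq in Hj. unfold chain_level. rewrite lsum_map. simpl fst; simpl snd.
    rewrite lsum_const, length_seq, (INR_pow2 (d + j)).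
    (* The inverse of [2 * (9 / 10) ^ 2]: the factor by which length over squared threshold shrinks
       per level. What matters is that [2 * w ^ 2] is below 4/5. *)
    set (w := 50 / 81).
    assert (Hr : INR (2 ^ (e - j)) / chain_thr eps L d e j ^ 2 <= / y * w ^ j).
    { unfold chain_thr. rewrite !Rpow_mult_distr.
      replace (sqrt (INR (2 ^ (d + e)) * L) ^ 2) with (INR (2 ^ (d + e)) * L)
        by (rewrite pow2_sqrt; [reflexivity|]; assert (H := Hpos (d + e)%nat); nra).
      rewrite !INR_pow2.
      replace (d + e)%nat with (d + (j + (e - j)))%nat by lia. rewrite !pow_add.
      assert (H2 : 0 < 2 ^ (e - j)) by (apply pow_lt; lra).
      assert (H2j : 0 < 2 ^ j) by (apply pow_lt; lra).
      assert (H2d : 0 < 2 ^ d) by (apply pow_lt; lra).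
      assert (H9 : 0 < (9 / 10) ^ j) by (apply pow_lt; lra).
      assert (He2 : 0 < eps ^ 2) by (apply pow_lt; lra).
      assert (Hw : w ^ j = / (((9 / 10) ^ j) ^ 2 * 2 ^ j)).
      { rewrite <- pow_mult, (Nat.mul_comm j 2), pow_mult, <- Rpow_mult_distr, <- pow_inv.
        f_equal. unfold w. field. }
      replace (2 ^ (e - j) / (eps ^ 2 * ((9 / 10) ^ j) ^ 2 * (2 ^ d * (2 ^ j * 2 ^ (e - j)) * L)))
        with (/ (eps ^ 2 * 2 ^ d * L) * w ^ j).
      - apply Rmult_le_compat_r.
        + apply pow_le; unfold w; lra.
        + apply Rinv_le_contravar; [assumption|]. rewrite Hy. apply Rmult_le_compat_r; lra.
      - rewrite Hw. field. repeat split; lra. }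
    assert (Hr0 : 0 <= INR (2 ^ (e - j)) / chain_thr eps L d e j ^ 2).
    { assert (Ht : 0 < chain_thr eps L d e j).
      { unfold chain_thr. apply Rmult_lt_0_compat.
        - apply Rmult_lt_0_compat; [assumption|apply pow_lt; lra].
        - apply sqrt_lt_R0, Rmult_lt_0_compat; [apply Hpos|assumption]. }
      apply Rdiv_le_0_compat; [left; apply Hpos|apply pow_lt; assumption]. }
    assert (Hw0 : 0 <= w ^ j <= 1).
    { split; [apply pow_le; unfold w; lra|]. rewrite <- (pow1 j). apply pow_incr. unfold w; lra. }
    assert (Hq2 : (/ y * w ^ j) ^ q <= (/ y) ^ q * (w ^ j) ^ 2).
    { rewrite Rpow_mult_distr. apply Rmult_le_compat_l.
      - apply pow_le. left; now apply Rinv_0_lt_compat.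
      - replace q with (2 + (q - 2))%nat by lia. rewrite pow_add.
        rewrite <- (Rmult_1_r ((w ^ j) ^ 2)) at 2. apply Rmult_le_compat_l; [apply pow2_ge_0|].
        rewrite <- (pow1 (q - 2)). now apply pow_incr. }
    assert (Hpq := pow_incr _ _ q (conj Hr0 Hr)).
    apply Rle_trans with (Y * (w ^ j) ^ 2 * 2 ^ (d + j)).
    - apply Rmult_le_compat_r; [left; apply pow_lt; lra|]. unfold Y. rewrite Rmult_assoc.
      apply Rmult_le_compat_l; [apply pos_INR|lra].
    - rewrite pow_add. replace (Y * (w ^ j) ^ 2 * (2 ^ d * 2 ^ j)) with (2 ^ d * Y * ((w ^ j) ^ 2 * 2 ^ j))
        by ring.
      apply Rmult_le_compat_l; [apply Rmult_le_pos; [apply pow_le; lra|assumption]|].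
      rewrite <- pow_mult, (Nat.mul_comm j 2), pow_mult, <- Rpow_mult_distr.
      apply pow_incr. unfold w. lra. }
  assert (Hall : lsum (fun it => INR (fact q) * (INR (snd (fst it)) / snd it ^ 2) ^ q)
                  (flat_map (chain_level eps L d e) (seq 1 e)) <= 2 ^ d * Y * 4).
  { apply Rle_trans with (lsum (fun j => 2 ^ d * Y * (4 / 5) ^ j) (seq 1 e)).
    - revert Hlev. generalize (seq 1 e). induction l as [|j l IH]; intros Hlev; [simpl; lra|].
      simpl flat_map. rewrite lsum_app. simpl lsum. apply Rplus_le_compat.
      + apply Hlev. now left.
      + apply IH. intros i Hi. apply Hlev. now right.
    - rewrite lsum_scal. apply Rmult_le_compat_l.
      + apply Rmult_le_pos; [apply pow_le; lra|assumption].
      + eapply Rle_trans; [apply geometric_bound; lra|]. lra. }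
  rewrite Htop. lra.
Qed.

(** * Factorials, logarithms and growth estimates *)

(** A weak form of Stirling's formula, by induction from [e <= (1 + 1 / a) ^ (a + 1)]. *)
Lemma fact_upper (q : nat) : (1 <= q)%nat -> INR (fact q) * exp (INR q) <= exp 1 * INR q * INR q ^ q.
Proof.
  intros Hq. induction q as [|q IH]; [lia|].
  destruct q as [|q]; [simpl; lra|]. specialize (IH ltac:(lia)).
  rewrite fact_simpl, mult_INR, (S_INR (S q)), exp_plus.
  set (a := INR (S q)) in *. assert (Ha : 1 <= a) by (unfold a; rewrite S_INR; generalize (pos_INR q); lra).
  assert (Hkey : exp 1 * a * a ^ S q <= (a + 1) * (a + 1) ^ S q).
  { assert (H1 : exp (/ (a + 1)) <= (a + 1) / a).
    { assert (H := exp_ineq1_le (- / (a + 1))). rewrite exp_Ropp in H.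
      assert (Hp := exp_pos (/ (a + 1))).
      assert (Hx : a / (a + 1) <= / exp (/ (a + 1))).
      { replace (a / (a + 1)) with (1 + - / (a + 1)) by (field; lra). exact H. }
      apply Rinv_le_contravar in Hx; [|apply Rdiv_lt_0_compat; lra].
      rewrite Rinv_inv in Hx. replace ((a + 1) / a) with (/ (a / (a + 1))) by (field; lra). exact Hx. }
    assert (H2 : exp 1 <= ((a + 1) / a) ^ S (S q)).
    { replace 1 with (/ (a + 1) * INR (S (S q))) at 1
        by (rewrite (S_INR (S q)); fold a; field; lra).
      rewrite exp_mult_INR. apply pow_incr. split; [left; apply exp_pos|exact H1]. }
    assert (Hap : 0 < a ^ S (S q)) by (apply pow_lt; lra).
    replace (exp 1 * a * a ^ S q) with (exp 1 * a ^ S (S q)) by (simpl; ring).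
    replace ((a + 1) * (a + 1) ^ S q) with (((a + 1) / a) ^ S (S q) * a ^ S (S q)).
    - apply Rmult_le_compat_r; lra.
    - rewrite <- Rpow_mult_distr. replace ((a + 1) / a * a) with (a + 1) by (field; lra). reflexivity. }
  assert (He := exp_pos 1).
  apply Rle_trans with ((a + 1) * exp 1 * (exp 1 * a * a ^ S q)).
  - replace ((a + 1) * INR (fact (S q)) * (exp a * exp 1))
      with ((a + 1) * exp 1 * (INR (fact (S q)) * exp a)) by ring.
    apply Rmult_le_compat_l; [nra|exact IH].
  - replace (exp 1 * (a + 1) * (a + 1) ^ S (S q)) with ((a + 1) * exp 1 * ((a + 1) * (a + 1) ^ S q))
      by (simpl; ring).
    apply Rmult_le_compat_l; [nra|exact Hkey].
Qed.

(** Taking [q] as the integer part of [y] nearly minimizes [q! / y ^ q]. The result is the Gaussian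
    tail up to a linear factor, which is what gives the sharp constant in the upper half. *)
Lemma fact_tail (q : nat) (y : R) : (1 <= q)%nat -> INR q <= y < INR q + 1 ->
  INR (fact q) * (/ y) ^ q <= exp 2 * (y * exp (- y)).
Proof.
  intros Hq Hy. assert (Hq1 : 1 <= INR q) by (change 1 with (INR 1); now apply le_INR).
  assert (H := fact_upper q Hq). set (a := INR q) in *.
  assert (Hap : 0 < a ^ q) by (apply pow_lt; lra).
  assert (Hea := exp_pos a).
  apply Rle_trans with (INR (fact q) * (/ a) ^ q).
  - apply Rmult_le_compat_l; [apply pos_INR|]. apply pow_incr. split.
    + left; apply Rinv_0_lt_compat; lra.
    + apply Rinv_le_contravar; lra.
  - rewrite pow_inv. apply Rle_trans with (exp 1 * a * exp (- a)).
    + rewrite exp_Ropp. apply Rle_div_l; [assumption|].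
      apply (Rmult_le_reg_r (exp a)); [assumption|].
      replace (exp 1 * a * / exp a * a ^ q * exp a) with (exp 1 * a * a ^ q) by (field; lra).
      exact H.
    + assert (E : exp (- a) <= exp 1 * exp (- y)) by (rewrite <- exp_plus; apply exp_le_compat; lra).
      assert (H1 := exp_pos 1). assert (H2 := exp_pos (- a)).
      replace (exp 2) with (exp 1 * exp 1) by (rewrite <- exp_plus; f_equal; ring).
      apply Rle_trans with (exp 1 * y * (exp 1 * exp (- y))); [|right; ring].
      apply Rmult_le_compat; nra.
Qed.

Lemma pow_below_exp (C : R) (k : nat) : exists z0, 1 <= z0 /\ forall z, z0 <= z -> C * z ^ k <= exp z.
Proof.
  set (F := INR (fact (S k))). assert (HF : 0 < F) by apply INR_fact_lt_0.
  exists (Rmax 1 (Rabs C * F)). split; [apply Rmax_l|]. intros z Hz.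
  assert (H1 : 1 <= z) by (eapply Rle_trans; [apply Rmax_l|exact Hz]).
  assert (H2 : Rabs C * F <= z) by (eapply Rle_trans; [apply Rmax_r|exact Hz]).
  eapply Rle_trans; [|apply (pw_le_exp (S k)); lra]. unfold pw. fold F.
  apply (proj1 (Rle_div_r _ _ _ HF)). assert (Hp : 0 < z ^ k) by (apply pow_lt; lra).
  replace (C * z ^ k * F) with (C * F * z ^ k) by ring. simpl.
  apply Rmult_le_compat_r; [lra|]. generalize (Rle_abs C). nra.
Qed.

Lemma ln_unbounded (z : R) : exists i0 : nat, (2 <= i0)%nat /\ forall i, (i0 <= i)%nat -> z <= ln (INR i).
Proof.
  destruct (INR_unbounded (exp z)) as [i0 Hi]. exists (i0 + 2)%nat. split; [lia|]. intros i Hii.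
  rewrite <- (ln_exp z). assert (INR i0 <= INR i) by (apply le_INR; lia).
  left. apply ln_increasing; [apply exp_pos|lra].
Qed.

Lemma exp_ln_INR (i : nat) : (1 <= i)%nat -> exp (ln (INR i)) = INR i.
Proof. intros H. apply exp_ln, lt_0_INR. lia. Qed.

Lemma sqrt_pow2_exp (i : nat) : sqrt (INR (2 ^ i)) = exp (INR i * (ln 2 / 2)).
Proof.
  rewrite INR_pow2. replace (2 ^ i) with (exp (INR i * (ln 2 / 2)) * exp (INR i * (ln 2 / 2))).
  - apply sqrt_square. left; apply exp_pos.
  - rewrite <- exp_plus. replace (INR i * (ln 2 / 2) + INR i * (ln 2 / 2)) with (ln 2 * INR i) by field.
    rewrite exp_mult_INR, exp_ln; lra.
Qed.

(** The left side is exponential in a power of [ln i], the right side in [i] itself. *)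
Lemma bad_indices_negligible (C eps c : R) (k : nat) : 0 < C -> 0 < eps -> 0 < c ->
  exists i0, forall i, (i0 <= i)%nat ->
    exp (C * (c * ln (INR i)) ^ k) <= eps * sqrt (INR (2 ^ i)).
Proof.
  intros HC He Hc. set (D := 4 * (C * c ^ k + Rabs (ln eps))).
  destruct (pow_below_exp D k) as [z0 [Hz1 Hz]]. destruct (ln_unbounded z0) as [i0 [Hi0 Hi]].
  exists i0. intros i Hii. specialize (Hi i Hii). specialize (Hz _ Hi).
  rewrite exp_ln_INR in Hz by lia. set (L := ln (INR i)) in *.
  rewrite sqrt_pow2_exp. rewrite <- (exp_ln eps) by assumption. rewrite <- exp_plus.
  apply exp_le_compat. rewrite Rpow_mult_distr.
  assert (HLk : 1 <= L ^ k) by (apply pow_R1_Rle; lra).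
  assert (Hl2 := ln_lt_2).
  assert (Ha : - ln eps <= Rabs (ln eps) * L ^ k).
  { assert (H := Rle_abs (- ln eps)). rewrite Rabs_Ropp in H. assert (H' := Rabs_pos (ln eps)). nra. }
  assert (Hi4 : INR i * / 4 <= INR i * (ln 2 / 2)).
  { apply Rmult_le_compat_l; [apply pos_INR|lra]. }
  unfold D in Hz. nra.
Qed.

(** The tail of the series of [k ^ (-1 - eps)] telescopes against [k ^ (- eps)]; the inequality
    [1 + x <= exp x] replaces the comparison with an integral. *)
Lemma tail_sum_small (eps K delta : R) : 0 < eps -> 0 <= K -> 0 < delta ->
  exists i0, forall i m, (i0 <= i)%nat ->
    lsum (fun k => K * exp (- ((1 + eps) * ln (INR k)))) (seq i m) <= delta.
Proof.
  intros He HK Hd.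
  set (E := fun k => exp (- (eps * ln (INR k)))).
  assert (Hstep : forall k, (1 <= k)%nat -> eps * exp (- ((1 + eps) * ln (INR (S k)))) <= E k - E (S k)).
  { intros k Hk. unfold E. assert (Hk0 : 0 < INR k) by (apply lt_0_INR; lia).
    assert (HSk : INR (S k) = INR k + 1) by apply S_INR.
    set (l1 := ln (INR (S k))). set (l0 := ln (INR k)).
    replace (exp (- (eps * l0))) with (exp (- (eps * l1)) * exp (eps * (l1 - l0)))
      by (rewrite <- exp_plus; f_equal; ring).
    replace (exp (- ((1 + eps) * l1))) with (exp (- (eps * l1)) * exp (- l1))
      by (rewrite <- exp_plus; f_equal; ring).
    assert (H1 : exp (- l1) <= l1 - l0).
    { rewrite exp_Ropp. unfold l1 at 1. rewrite exp_ln by lra.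
      assert (H := exp_ineq1_le (- (l1 - l0))).
      replace (exp (- (l1 - l0))) with (INR k / INR (S k)) in H.
      - replace (INR k / INR (S k)) with (1 - / INR (S k)) in H by (rewrite HSk; field; lra). lra.
      - rewrite exp_Ropp. unfold Rminus. rewrite exp_plus, exp_Ropp. unfold l0, l1.
        rewrite !exp_ln by lra. field. split; lra. }
    assert (H2 := exp_ineq1_le (eps * (l1 - l0))). assert (H3 := exp_pos (- (eps * l1))).
    assert (eps * exp (- l1) <= exp (eps * (l1 - l0)) - 1).
    { apply Rle_trans with (eps * (l1 - l0)); [apply Rmult_le_compat_l; lra|lra]. }
    nra. }
  assert (Htel : forall m i, (1 <= i)%nat ->
     eps * lsum (fun k => exp (- ((1 + eps) * ln (INR k)))) (seq (S i) m) <= E i - E (i + m)%nat).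
  { induction m as [|m IH]; intros i Hi.
    - simpl. rewrite Nat.add_0_r. lra.
    - rewrite lsum_seq_S. specialize (IH i Hi). assert (H := Hstep (i + m)%nat ltac:(lia)).
      replace (S i + m)%nat with (S (i + m)) by lia.
      replace (i + S m)%nat with (S (i + m)) by lia. lra. }
  destruct (ln_unbounded (- ln (eps * delta / (K + 1)) / eps)) as [i0 [Hi2 Hi0]].
  exists (S i0). intros i m Hi. destruct i as [|i]; [lia|].
  rewrite lsum_scal. specialize (Htel m i ltac:(lia)). specialize (Hi0 i ltac:(lia)).
  set (s := lsum _ _) in *.
  assert (HEm : 0 < E (i + m)%nat) by apply exp_pos.
  assert (Hpos : 0 < eps * delta / (K + 1)) by (apply Rdiv_lt_0_compat; nra).
  assert (HE : E i <= eps * delta / (K + 1)).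
  { rewrite <- (exp_ln (eps * delta / (K + 1))) by assumption. apply exp_le_compat.
    apply Rle_div_l in Hi0; [|assumption]. lra. }
  assert (Hs : s <= delta / (K + 1)).
  { apply (Rmult_le_reg_l eps); [assumption|]. unfold Rdiv in *. lra. }
  assert (0 <= s) by (apply lsum_nonneg; intros; left; apply exp_pos).
  apply Rle_trans with ((K + 1) * s); [nra|].
  apply Rle_trans with ((K + 1) * (delta / (K + 1))); [apply Rmult_le_compat_l; lra|].
  right; field; lra.
Qed.

(** The iterated logarithm is replaced by [ln i], constant on the dyadic range, so that all
    thresholds of one range share the same [L]; [ln_ln_dyadic] compares the two. *)
Definition lil_exceeds (n sigma : nat -> nat) (c : R) (i : nat) (x : R) : Prop :=
  0 <= x <= 1 /\ exists N, (2 ^ i <= N < 2 * 2 ^ i)%nat /\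
    c * sqrt (INR N * ln (INR i)) < Rabs (trig_sum n sigma N x).

(** Moments of order [2 * q] with [q] the integer part of [y = (1 + eps) ^ 2 * ln i] give a tail of
    order [y * exp (- y)]. The linear factor is absorbed by [exp (eps * ln i)], which leaves an
    exponent of at least [1 + eps]. Of the [11 * eps], ten come from chaining and one from the
    deleted indices. *)
Lemma lil_dyadic_measure (n sigma : nat -> nat) (eps : R) :
  (forall k, (0 < n k)%nat) -> condRstar n -> (forall i j, sigma i = sigma j -> i = j) ->
  0 < eps <= 1 ->
  exists K i0, 0 <= K /\ forall i, (i0 <= i)%nat ->
    mle (lil_exceeds n sigma (1 + 11 * eps) i) (K * exp (- ((1 + eps) * ln (INR i)))).
Proof.
  intros npos hR Hinj Heps.
  destruct (condRstar_hitting n hR) as [C [kappa [HC Hhit]]].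
  destruct (INR_unbounded (4 / eps ^ 2)) as [d Hd].
  assert (Hd2 : (1 + eps) ^ 2 <= eps ^ 2 * 2 ^ d).
  { assert (He2 : 0 < eps ^ 2) by (apply pow_lt; lra).
    assert (INR d <= 2 ^ d).
    { clear. induction d as [|d IH]; [simpl; lra|]. rewrite S_INR. simpl.
      assert (1 <= 2 ^ d) by (apply pow_R1_Rle; lra). lra. }
    apply Rlt_div_l in Hd; [|assumption]. nra. }
  (* The 8 is there because [P = 2 * q] is at most [2 * y], and [y] is at most [4 * ln i]. *)
  destruct (bad_indices_negligible C eps 8 kappa HC) as [i1 Hi1]; [lra|lra|].
  destruct (ln_unbounded 2) as [i2 [Hi2 Hln]].
  set (K := 5 * 2 ^ d * (exp 2 * (4 / eps))).
  exists K, (i1 + i2 + d)%nat. split.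
  { unfold K. apply Rmult_le_pos; [apply Rmult_le_pos; [lra|apply pow_le; lra]|].
    apply Rmult_le_pos; [left; apply exp_pos|apply Rdiv_le_0_compat; lra]. }
  intros i Hi. specialize (Hi1 i ltac:(lia)). specialize (Hln i ltac:(lia)).
  set (L := ln (INR i)) in *. set (y := (1 + eps) ^ 2 * L).
  assert (H1e : 1 <= (1 + eps) ^ 2 <= 4) by (split; simpl; nra).
  assert (Hy : L <= y <= 4 * L) by (unfold y; split; nra).
  destruct (nfloor_ex y ltac:(lra)) as [q [Hq1 Hq2]].
  assert (Hq : (2 <= q)%nat).
  { assert (H : INR 1 < INR q) by (simpl; lra). apply INR_lt in H. lia. }
  set (P := (2 * q)%nat). destruct (Hhit P ltac:(lia)) as [B [HB HBl]].
  assert (HBsmall : INR (length B) <= eps * sqrt (INR (2 ^ i))).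
  { eapply Rle_trans; [exact HBl|]. eapply Rle_trans; [|exact Hi1]. apply exp_le_compat.
    apply Rmult_le_compat_l; [lra|]. apply pow_incr. split; [apply pos_INR|].
    unfold P. rewrite mult_INR. change (INR 2) with 2. lra. }
  set (e := (i - d)%nat). assert (Hde : (d + e = i)%nat) by (unfold e; lia).
  assert (Hmle := block_union_bound n sigma P q (2 * 2 ^ i) B (chain_items eps L d e) npos Hinj HB
                    ltac:(lia) (le_n _)).
  assert (Hrange : forall a len thr, In (a, len, thr) (chain_items eps L d e) ->
            (a + len <= 2 * 2 ^ i)%nat /\ 0 < thr).
  { intros a len thr Hin. rewrite <- Hde. apply (chain_items_range eps L d e); [lra|lra|assumption]. }
  specialize (Hmle Hrange). eapply mle_mono; [| |exact Hmle].
  - intros x [Hx [N [HN Hbig]]]. split; [assumption|]. apply NNPP. intros Hno.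
    assert (Hc : Rabs (bsum (fun k => n (sigma k)) (good sigma B (seq 0 N)) x)
                 <= (1 + 10 * eps) * sqrt (INR N * L)).
    { apply (chaining _ sigma B eps L x d e N); [lra|lra| |rewrite Hde; exact HN].
      intros a len thr Hin.
      destruct (Rle_lt_dec (Rabs (bsum (fun k => n (sigma k)) (good sigma B (seq a len)) x)) thr)
        as [H|H]; [assumption|]. exfalso. apply Hno. exists a, len, thr. split; [assumption|lra]. }
    assert (Hg := bsum_good (fun k => n (sigma k)) sigma B (seq 0 N) x Hinj (seq_NoDup _ _)).
    rewrite <- bsum_seq in Hg.
    assert (Hs : sqrt (INR (2 ^ i)) <= sqrt (INR N * L)).
    { apply sqrt_le_1_alt. assert (INR (2 ^ i) <= INR N) by (apply le_INR; lia).
      assert (0 <= INR (2 ^ i)) by apply pos_INR. nra. }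
    assert (Htri := Rabs_triang_inv (trig_sum n sigma N x)
                      (bsum (fun k => n (sigma k)) (good sigma B (seq 0 N)) x)).
    assert (0 <= sqrt (INR N * L)) by apply sqrt_pos. fold L in Hbig. nra.
  - eapply Rle_trans; [apply (chain_items_sum eps L y); try assumption; try lra; reflexivity|].
    unfold K. rewrite !Rmult_assoc. apply Rmult_le_compat_l; [lra|].
    apply Rmult_le_compat_l; [apply pow_le; lra|].
    eapply Rle_trans; [apply fact_tail; [lia|lra]|].
    apply Rmult_le_compat_l; [left; apply exp_pos|].
    assert (HyL : y <= 4 / eps * exp (eps * L)).
    { assert (H := le_exp (eps * L)).
      apply Rle_trans with (4 / eps * (eps * L)); [|apply Rmult_le_compat_l; [apply Rdiv_le_0_compat; lra|assumption]].
      replace (4 / eps * (eps * L)) with (4 * L) by (field; lra). lra. }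
    apply Rle_trans with (4 / eps * exp (eps * L) * exp (- y)).
    + apply Rmult_le_compat_r; [left; apply exp_pos|assumption].
    + rewrite Rmult_assoc, <- exp_plus.
      apply Rmult_le_compat_l; [apply Rdiv_le_0_compat; lra|]. apply exp_le_compat.
      unfold y. simpl. nra.
Qed.

(** As [ln 2] is at least 1/2, [ln N] is at least [i / 2], and the outer logarithm loses [ln 2],
    which is at most 1. *)
Lemma ln_ln_dyadic (i N : nat) : (2 <= i)%nat -> (2 ^ i <= N)%nat -> ln (INR i) - 1 <= ln (ln (INR N)).
Proof.
  intros Hi HN.
  assert (H2i : 0 < INR (2 ^ i)) by (rewrite INR_pow2; apply pow_lt; lra).
  assert (Hi0 : 0 < INR i) by (apply lt_0_INR; lia).
  assert (H1 : INR i * / 2 <= ln (INR N)).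
  { apply Rle_trans with (ln (INR (2 ^ i))).
    - rewrite INR_pow2, ln_pow by lra. apply Rmult_le_compat_l; [lra|]. left; apply ln_lt_2.
    - apply ln_le; [assumption|now apply le_INR]. }
  apply Rle_trans with (ln (INR i * / 2)).
  - rewrite ln_mult, ln_Rinv by lra.
    assert (ln 2 <= 1); [|lra]. rewrite <- (ln_exp 1). apply ln_le; [lra|].
    generalize (exp_ineq1_le 1). lra.
  - apply ln_le; [lra|assumption].
Qed.

Definition lil_bounded (n sigma : nat -> nat) (c x : R) : Prop :=
  exists N0, forall N, (N0 <= N)%nat ->
    Rabs (trig_sum n sigma N x) <= c * sqrt (INR N * ln (ln (INR N))).

Theorem lil_upper (n sigma : nat -> nat) (eps : R) :
  (forall k, (0 < n k)%nat) -> condRstar n -> (forall i j, sigma i = sigma j -> i = j) -> 0 < eps ->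
  null_set (fun x => 0 <= x <= 1 /\ ~ lil_bounded n sigma (1 + eps) x).
Proof.
  (* The 18 comes from [(1 + 11 * e) * (1 + e) <= 1 + 18 * e] for [e] at most 1/2; the factor
     [1 + e] is the price of passing from [ln i] to the iterated logarithm of [N]. *)
  intros npos hR Hinj Heps. set (e := Rmin (1 / 2) (eps / 18)).
  assert (He : 0 < e <= 1 / 2 /\ 18 * e <= eps).
  { unfold e, Rmin. destruct (Rle_dec (1 / 2) (eps / 18)); lra. }
  destruct (lil_dyadic_measure n sigma e npos hR Hinj ltac:(lra)) as [K [i1 [HK Hmle]]].
  assert (Hbc : null_set (fun x => forall i0, exists i, (i0 <= i)%nat /\
                  lil_exceeds n sigma (1 + 11 * e) i x)).
  { apply (borel_cantelli _ (fun i => K * exp (- ((1 + e) * ln (INR i)))) i1 Hmle).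
    intros delta Hd. apply tail_sum_small; lra. }
  eapply null_set_mono; [|exact Hbc]. intros x [Hx Hno] i0. apply NNPP. intros Hnone.
  apply Hno. destruct (ln_unbounded (/ e)) as [i2 [Hi2 Hln]].
  exists (2 ^ (i0 + i2))%nat. intros N HN.
  assert (HN0 : (0 < N)%nat).
  { assert (0 < 2 ^ (i0 + i2))%nat by (apply Nat.neq_0_lt_0, Nat.pow_nonzero; lia). lia. }
  set (i := Nat.log2 N). destruct (Nat.log2_spec N HN0) as [Hlo Hhi]. fold i in Hlo, Hhi.
  rewrite Nat.pow_succ_r' in Hhi.
  assert (Hi : (i0 + i2 <= i)%nat).
  { unfold i. rewrite <- (Nat.log2_pow2 (i0 + i2)) by lia. now apply Nat.log2_le_mono. }
  assert (Hb : Rabs (trig_sum n sigma N x) <= (1 + 11 * e) * sqrt (INR N * ln (INR i))).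
  { destruct (Rle_lt_dec (Rabs (trig_sum n sigma N x)) ((1 + 11 * e) * sqrt (INR N * ln (INR i))))
      as [H|H]; [assumption|]. exfalso. apply Hnone. exists i. split; [lia|].
    split; [assumption|]. exists N. split; [lia|exact H]. }
  specialize (Hln i ltac:(lia)). assert (Hll := ln_ln_dyadic i N ltac:(lia) Hlo).
  set (L := ln (INR i)) in *. set (LL := ln (ln (INR N))) in *.
  assert (Hie : 1 <= e * L).
  { apply (Rmult_le_compat_l e) in Hln; [|lra]. rewrite Rinv_r in Hln; lra. }
  assert (HLe : L <= (1 + e) ^ 2 * LL).
  { assert (H1 : (1 - e) * L <= LL) by lra.
    assert (H2 : 1 <= (1 + e) ^ 2 * (1 - e)) by (simpl; nra).
    assert (H3 : 0 < L) by nra.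
    apply Rle_trans with ((1 + e) ^ 2 * ((1 - e) * L)); [nra|].
    apply Rmult_le_compat_l; [apply pow2_ge_0|assumption]. }
  assert (HNp : 0 <= INR N) by apply pos_INR.
  assert (Hsq : sqrt (INR N * L) <= (1 + e) * sqrt (INR N * LL)).
  { rewrite <- (sqrt_pow2 (1 + e)) by lra. rewrite <- sqrt_mult_alt by apply pow2_ge_0.
    apply sqrt_le_1_alt. nra. }
  assert (H0 := sqrt_pos (INR N * LL)). eapply Rle_trans; [exact Hb|].
  apply Rle_trans with ((1 + 11 * e) * ((1 + e) * sqrt (INR N * LL))).
  - apply Rmult_le_compat_l; lra.
  - rewrite <- Rmult_assoc. apply Rmult_le_compat_r; [assumption|]. nra.
Qed.

(** * Lower half of the law of the iterated logarithm *)

(** Values in [0,1] satisfy [F ^ 2 <= F], so the diagonal contributes about [gamma] per index and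
    not a constant, which matters because [gamma] will be small. Off the diagonal each centred
    product averages to at most [3 * e]. *)
Lemma second_moment_of_blocks (Q : nat) (js : list nat) (F : nat -> R -> R) (gamma e : R) :
  (0 < Q)%nat -> NoDup js -> 0 <= gamma <= 1 -> 0 <= e ->
  (forall j x, 0 <= F j x <= 1) ->
  (forall j, In j js -> Rabs (avg Q (F j) - gamma) <= e) ->
  (forall i j, In i js -> In j js -> i <> j ->
     Rabs (avg Q (fun x => F i x * F j x) - gamma * gamma) <= e) ->
  avg Q (fun x => (lsum (fun j => F j x - gamma) js) ^ 2)
  <= INR (length js) * gamma + 3 * e * INR (length js) ^ 2.
Proof.
  intros HQ Hnd Hg He HF H1 H2.
  rewrite (avg_ext Q _ (fun x => lsum (fun i => lsum (fun j => (F i x - gamma) * (F j x - gamma)) js) js))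
    by (intros x; rewrite <- lsum_mul; ring).
  rewrite (avg_lsum Q (fun i x => lsum (fun j => (F i x - gamma) * (F j x - gamma)) js)).
  assert (Hprod : forall i j, avg Q (fun x => (F i x - gamma) * (F j x - gamma))
     = avg Q (fun x => F i x * F j x) - gamma * avg Q (F i) - gamma * avg Q (F j) + gamma * gamma).
  { intros i j.
    rewrite (avg_ext Q _ (fun x => (F i x * F j x - gamma * F i x) - gamma * F j x + gamma * gamma))
      by (intros x; ring).
    rewrite avg_plus, !avg_minus, !avg_scal, avg_const by assumption. ring. }
  assert (Hdelta : forall i, lsum (fun j => if Nat.eq_dec i j then gamma else 0) js <= gamma).
  { intros i. clear - Hnd Hg. induction js as [|j js IH]; [simpl; lra|].
    inversion Hnd as [|? ? Hj Hnd']; subst. simpl. destruct (Nat.eq_dec i j) as [->|Hne].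
    - rewrite lsum_zero; [lra|]. intros k Hk. destruct (Nat.eq_dec j k) as [->|]; [contradiction|reflexivity].
    - specialize (IH Hnd'). lra. }
  apply Rle_trans with (lsum (fun i => gamma + 3 * e * INR (length js)) js).
  2:{ rewrite lsum_const. right; ring. }
  apply lsum_le. intros i Hi.
  rewrite (avg_lsum Q (fun j x => (F i x - gamma) * (F j x - gamma))).
  apply Rle_trans with (lsum (fun j => (if Nat.eq_dec i j then gamma else 0) + 3 * e) js).
  2:{ rewrite lsum_plus, lsum_const. specialize (Hdelta i). lra. }
  apply lsum_le. intros j Hj. rewrite Hprod.
  assert (A := H1 i Hi). assert (B := H1 j Hj). apply Rabs_le_between in A, B.
  destruct (Nat.eq_dec i j) as [<-|Hne].
  - assert (Hsq : avg Q (fun x => F i x * F i x) <= avg Q (F i)).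
    { apply avg_le; [assumption|]. intros x _. specialize (HF i x). nra. }
    nra.
  - assert (D := H2 i j Hi Hj Hne). apply Rabs_le_between in D. nra.
Qed.

Definition lil_block (Theta j : nat) : list nat :=
  seq (Theta ^ (j - 1)) (Theta ^ j - Theta ^ (j - 1)).

(** The kernel [cos (theta * (w - s)) ^ (2 * r)] with [theta = 1 / (8 * sqrt g)],
    [s = (1 - eps) * sqrt g] and [r = R0 * g]. The 8 stretches the period, so that no second peak
    occurs while [|w|] is at most [10 * sqrt g]. *)
Definition lil_test (eps : R) (R0 g : nat) (w : R) : R :=
  cos (/ (8 * sqrt (INR g)) * w + - ((1 - eps) / 8)) ^ (2 * (R0 * g)).

(** The largest frequency of [lil_test]. Its square is proportional to [g], so Taylor polynomials of
    degree proportional to [g] suffice. *)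
Definition lil_freq (R0 g : nat) : R := INR (2 * (R0 * g)) * / (8 * sqrt (INR g)).

Lemma lil_freq_sqr (R0 g : nat) : (1 <= g)%nat -> lil_freq R0 g ^ 2 = INR R0 ^ 2 / 16 * INR g.
Proof.
  intros Hg. assert (HG : 0 < INR g) by (apply lt_0_INR; lia).
  assert (Hs : 0 < sqrt (INR g)) by now apply sqrt_lt_R0.
  assert (Hss : sqrt (INR g) * sqrt (INR g) = INR g) by (apply sqrt_sqrt; lra).
  unfold lil_freq. rewrite !mult_INR. change (INR 2) with 2.
  replace ((2 * (INR R0 * INR g) * / (8 * sqrt (INR g))) ^ 2)
    with (INR R0 ^ 2 / 16 * (INR g * INR g) / (sqrt (INR g) * sqrt (INR g))) by (field; lra).
  rewrite Hss. field. lra.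
Qed.

Lemma lil_test_tpoly (eps : R) (R0 g : nat) : (1 <= g)%nat ->
  exists gamma, tpoly 1 (lil_freq R0 g) (lil_test eps R0 g) gamma.
Proof.
  intros Hg. assert (HG : 0 < sqrt (INR g)) by (apply sqrt_lt_R0, lt_0_INR; lia).
  destruct (tpoly_pow _ _ _ _ (2 * (R0 * g)) (tpoly_cos (/ (8 * sqrt (INR g))) (- ((1 - eps) / 8))))
    as [gamma H].
  exists gamma. rewrite pow1, Rabs_pos_eq in H; [exact H|].
  left. apply Rinv_0_lt_compat. lra.
Qed.

Lemma lil_test_bounds (eps : R) (R0 g : nat) (w : R) : 0 <= lil_test eps R0 g w <= 1.
Proof.
  unfold lil_test. split; [apply pow_even_nonneg|]. rewrite pow_mult.
  apply Rle_trans with (1 ^ (R0 * g)); [|rewrite pow1; lra].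
  apply pow_incr. split; [apply pow2_ge_0|].
  assert (H := COS_bound (/ (8 * sqrt (INR g)) * w + - ((1 - eps) / 8))). nra.
Qed.

Lemma cos_sqr_lower (y : R) : 1 - y ^ 2 <= cos y ^ 2.
Proof.
  assert (H := sin2_cos2 y). unfold Rsqr in H.
  assert (Hs : sin y ^ 2 <= y ^ 2).
  { rewrite <- (pow2_abs y), <- (pow2_abs (sin y)). apply pow_incr. split; [apply Rabs_pos|].
    destruct (Rle_lt_dec 0 y) as [Hy|Hy].
    - destruct Hy as [Hy| <-]; [|rewrite sin_0, !Rabs_R0; lra].
      destruct (MVT_cor2 sin cos 0 y Hy) as [c [Hc _]]; [intros; apply derivable_pt_lim_sin|].
      rewrite sin_0, !Rminus_0_r in Hc. rewrite Hc, Rabs_mult.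
      assert (Rabs (cos c) <= 1) by (apply Rabs_le, COS_bound). generalize (Rabs_pos y). nra.
    - destruct (MVT_cor2 sin cos y 0 Hy) as [c [Hc _]]; [intros; apply derivable_pt_lim_sin|].
      rewrite sin_0 in Hc. replace (sin y) with (cos c * y) by lra. rewrite Rabs_mult.
      assert (Rabs (cos c) <= 1) by (apply Rabs_le, COS_bound). generalize (Rabs_pos y). nra. }
  lra.
Qed.

(** At distance less than [1 / R0] below the peak the test function is at least 1/2 by Bernoulli's
    inequality, and the density there is at least its value at [s = (1 - eps) * sqrt g]. The
    constant [c1] does not depend on [g]. *)
Lemma lil_test_mean (eps : R) (R0 : nat) : 0 < eps <= 1 / 10 -> (1 <= R0)%nat ->
  exists c1, 0 < c1 /\ forall g gamma, (4 <= g)%nat ->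
    tpoly 1 (lil_freq R0 g) (lil_test eps R0 g) gamma ->
    c1 * exp (- ((1 - eps) ^ 2 * INR g)) <= gamma <= 1.
Proof.
  intros Heps HR0. assert (Hr : 1 <= INR R0) by (change 1 with (INR 1); now apply le_INR).
  assert (Hpi := sqrt_PI_gt_1).
  assert (Hpi' : 0 < / sqrt PI) by (apply Rinv_0_lt_compat; lra).
  set (u0 := / INR R0). assert (Hu0 : 0 < u0 <= 1).
  { unfold u0. split; [apply Rinv_0_lt_compat; lra|]. rewrite <- Rinv_1. apply Rinv_le_contravar; lra. }
  exists (1 / 2 * u0 * / sqrt PI). split; [apply Rmult_lt_0_compat; [lra|assumption]|].
  intros g gamma Hg Hgam. split.
  2:{ apply tpoly_gam_bound in Hgam. apply Rabs_le_between in Hgam. lra. }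
  destruct (tpoly_glim _ _ _ _ Hgam) as [Hc Hlim].
  set (G := INR g). assert (HG : 4 <= G) by (unfold G; replace 4 with (INR 4) by (simpl; ring); now apply le_INR).
  set (r := sqrt G). assert (Hrr : r * r = G) by (apply sqrt_sqrt; lra).
  assert (Hr2 : 2 <= r) by (rewrite <- (sqrt_pow2 2) by lra; apply sqrt_le_1_alt; simpl; lra).
  set (s := (1 - eps) * r). assert (Hs1 : 1 <= s) by (unfold s; nra).
  assert (H := glim_lower (lil_test eps R0 g) gamma (s - u0) s (1 / 2) Hc Hlim
                 (fun w => proj1 (lil_test_bounds eps R0 g w)) ltac:(lra) ltac:(lra)).
  replace (1 / 2 * u0 * / sqrt PI * exp (- ((1 - eps) ^ 2 * G)))
    with (1 / 2 * (s - (s - u0)) * (/ sqrt PI * gexp s)).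
  - apply H. intros u Hu. unfold lil_test. fold G r.
    rewrite pow_mult.
    set (y := / (8 * r) * u + - ((1 - eps) / 8)).
    assert (Hy : y = (u - s) / (8 * r)) by (unfold y, s; field; lra).
    assert (Hy2 : 0 <= y ^ 2 <= u0 ^ 2 / (64 * G)).
    { split; [apply pow2_ge_0|]. rewrite Hy, <- Hrr.
      replace (((u - s) / (8 * r)) ^ 2) with ((u - s) ^ 2 * / (64 * (r * r))) by (field; lra).
      unfold Rdiv. apply Rmult_le_compat_r.
      - left; apply Rinv_0_lt_compat; nra.
      - nra. }
    assert (HyR : INR (R0 * g) * y ^ 2 <= 1 / 2).
    { apply Rle_trans with (INR (R0 * g) * (u0 ^ 2 / (64 * G))).
      - apply Rmult_le_compat_l; [apply pos_INR|lra].
      - rewrite mult_INR. fold G. unfold u0.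
        replace (INR R0 * G * ((/ INR R0) ^ 2 / (64 * G))) with (/ INR R0 * / 64) by (field; lra).
        fold u0. lra. }
    assert (Hy1 : y ^ 2 <= 1).
    { eapply Rle_trans; [apply Hy2|]. apply Rle_div_l; [lra|]. nra. }
    assert (Hb := bernoulli_minus (y ^ 2) (R0 * g) (conj (proj1 Hy2) Hy1)).
    apply Rle_trans with ((1 - y ^ 2) ^ (R0 * g)); [lra|].
    apply pow_incr. split; [lra|apply cos_sqr_lower].
  - replace (s - (s - u0)) with u0 by ring. unfold gexp, s.
    replace (((1 - eps) * r) ^ 2) with ((1 - eps) ^ 2 * G) by (rewrite <- Hrr; ring). ring.
Qed.

(** [m!] is at least [(m / e) ^ m], by comparing one term of the exponential series at [m] with its
    sum. *)
Lemma pw_le_power (m : nat) (x : R) : (1 <= m)%nat -> 0 <= x -> pw m x <= (x * exp 1 / INR m) ^ m.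
Proof.
  intros Hm Hx. assert (HM : 0 < INR m) by (apply lt_0_INR; lia).
  assert (H := pw_le_exp m (INR m) ltac:(lra)). unfold pw in *.
  assert (E : exp (INR m) = exp 1 ^ m) by (rewrite <- exp_mult_INR; f_equal; ring).
  rewrite E in H.
  assert (HF := INR_fact_lt_0 m). assert (Hp : 0 < INR m ^ m) by now apply pow_lt.
  unfold Rdiv at 2. rewrite !Rpow_mult_distr, pow_inv.
  unfold Rdiv. rewrite Rmult_assoc. apply Rmult_le_compat_l; [now apply pow_le|].
  apply (Rmult_le_reg_l (INR m ^ m)); [assumption|].
  replace (INR m ^ m * (exp 1 ^ m * / INR m ^ m)) with (exp 1 ^ m) by (field; lra). exact H.
Qed.

Lemma double_exp_dominates (a C : R) (k : nat) : 0 < C -> exists g0, forall g, (g0 <= g)%nat ->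
  C * exp (a * INR g ^ k) <= exp (exp (INR g) / 2).
Proof.
  intros HC. set (D := 2 * (Rabs a + Rabs (ln C))).
  destruct (pow_below_exp D k) as [z0 [Hz1 Hz]].
  destruct (INR_unbounded z0) as [g0 Hg0]. exists g0. intros g Hg.
  assert (Hgz : z0 <= INR g) by (apply le_INR in Hg; lra). specialize (Hz _ Hgz).
  rewrite <- (exp_ln C) at 1 by assumption. rewrite <- exp_plus. apply exp_le_compat.
  assert (H1 : 1 <= INR g ^ k) by (apply pow_R1_Rle; lra).
  assert (Ha := Rle_abs a). assert (Hl := Rle_abs (ln C)). assert (Hl' := Rabs_pos (ln C)).
  unfold D in Hz. nra.
Qed.

(** The choice of [m0] makes the truncation error a power [m0 * g] of a ratio at most [exp (-10)],
    and the non-Gaussian defect is divided by a doubly exponential block length. The rate 9 leaves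
    room for a later division by [gamma ^ 2], which is at least of order [exp (- (2 * g))]. *)
Lemma lil_error_small (R0 : nat) :
  exists m0 g0, (1 <= m0)%nat /\ (1 <= g0)%nat /\ forall g h, (g0 <= g)%nat ->
    exp (exp (INR g) / 2) <= h ->
    cf_error (m0 * g) (lil_freq R0 g ^ 2 / 2) (lil_freq R0 g ^ 4 / (16 * h)) <= 4 * exp (- (9 * INR g)).
Proof.
  set (v := INR R0 ^ 2 / 16). assert (Hv : 0 <= v) by (unfold v; generalize (pow2_ge_0 (INR R0)); lra).
  destruct (INR_unbounded (v / 2 * exp 11)) as [m1 Hm1]. set (m0 := S m1).
  destruct (double_exp_dominates (v / 2 + 11) (v ^ 2 + 1) 1) as [g1 Hg1].
  { generalize (pow2_ge_0 v); lra. }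
  exists m0, (S g1). split; [unfold m0; lia|]. split; [lia|]. intros g h Hg Hh. specialize (Hg1 g ltac:(lia)).
  assert (HG : 1 <= INR g) by (change 1 with (INR 1); apply le_INR; lia).
  assert (Hm0 : v / 2 * exp 11 <= INR m0) by (unfold m0; rewrite S_INR; lra).
  assert (Hm0' : 1 <= INR m0) by (unfold m0; rewrite S_INR; generalize (pos_INR m1); lra).
  replace (lil_freq R0 g ^ 4) with (lil_freq R0 g ^ 2 * lil_freq R0 g ^ 2) by ring.
  rewrite lil_freq_sqr by lia. fold v. set (G := INR g) in *. unfold cf_error.
  assert (H1 : pw (m0 * g) (v * G / 2) <= exp (- (9 * G))).
  { eapply Rle_trans; [apply pw_le_power; [unfold m0; lia|apply Rdiv_le_0_compat; nra]|].
    rewrite mult_INR. fold G.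
    replace (v * G / 2 * exp 1 / (INR m0 * G)) with (v / 2 * exp 1 / INR m0) by (field; lra).
    apply Rle_trans with (exp (- 10) ^ (m0 * g)).
    - apply pow_incr. split.
      + apply Rdiv_le_0_compat; [|lra]. apply Rmult_le_pos; [lra|left; apply exp_pos].
      + apply Rle_div_l; [lra|].
        replace (exp 1) with (exp (-10) * exp 11) by (rewrite <- exp_plus; f_equal; ring).
        assert (H10 := exp_pos (-10)).
        replace (v / 2 * (exp (-10) * exp 11)) with (exp (-10) * (v / 2 * exp 11)) by ring.
        apply Rmult_le_compat_l; lra.
    - rewrite <- exp_mult_INR, mult_INR. fold G. apply exp_le_compat. nra. }
  assert (H2 : v * G * (v * G) / (16 * h) * exp (v * G / 2) <= exp (- (9 * G))).
  { assert (Hh0 : 0 < h) by (eapply Rlt_le_trans; [apply exp_pos|exact Hh]).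
    assert (Hvh : (v ^ 2 + 1) * exp ((v / 2 + 11) * G) <= h).
    { rewrite pow_1 in Hg1. lra. }
    assert (HG2 : G ^ 2 <= 16 * exp (2 * G)).
    { replace (2 * G) with (G + G) by ring. rewrite exp_plus. assert (H := le_exp G). nra. }
    replace (v * G * (v * G) / (16 * h) * exp (v * G / 2))
      with (v ^ 2 * G ^ 2 * exp (v * G / 2) / 16 / h) by (field; lra).
    apply Rle_div_l; [assumption|].
    apply Rle_trans with (exp (- (9 * G)) * ((v ^ 2 + 1) * exp ((v / 2 + 11) * G))).
    - replace (exp (- (9 * G)) * ((v ^ 2 + 1) * exp ((v / 2 + 11) * G)))
        with ((v ^ 2 + 1) * (exp (2 * G) * exp (v * G / 2))).
      + assert (Hv2 := pow2_ge_0 v). assert (He := exp_pos (v * G / 2)). assert (He2 := exp_pos (2 * G)).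
        replace (v ^ 2 * G ^ 2 * exp (v * G / 2) / 16) with (v ^ 2 * (G ^ 2 / 16 * exp (v * G / 2))) by field.
        apply Rmult_le_compat; [assumption| |lra|].
        * apply Rmult_le_pos; [|lra]. generalize (pow2_ge_0 G); lra.
        * apply Rmult_le_compat_r; lra.
      + rewrite <- exp_plus.
        replace (exp (2 * G + v * G / 2)) with (exp (- (9 * G)) * exp ((v / 2 + 11) * G))
          by (rewrite <- exp_plus; f_equal; field).
        ring.
    - apply Rmult_le_compat_l; [left; apply exp_pos|exact Hvh]. }
  lra.
Qed.

Lemma NoDup_lil_block (Theta j : nat) : NoDup (lil_block Theta j).
Proof. apply seq_NoDup. Qed.

Lemma lil_blocks_disjoint (Theta i j k : nat) : (2 <= Theta)%nat -> (1 <= i)%nat -> (1 <= j)%nat ->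
  i <> j -> In k (lil_block Theta i) -> ~ In k (lil_block Theta j).
Proof.
  intros HT Hi Hj Hne Hk Hk'. apply in_seq in Hk, Hk'.
  assert (Hm : forall a b, (a <= b)%nat -> (Theta ^ a <= Theta ^ b)%nat)
    by (intros; apply Nat.pow_le_mono_r; lia).
  destruct (Nat.lt_trichotomy i j) as [H|[H|H]]; [|contradiction|].
  - assert (H1 := Hm i (j - 1)%nat ltac:(lia)). assert (H2 := Hm (i - 1)%nat i ltac:(lia)). lia.
  - assert (H1 := Hm j (i - 1)%nat ltac:(lia)). assert (H2 := Hm (j - 1)%nat j ltac:(lia)). lia.
Qed.

(** If every block misses, the centred sum of the test values is at most [- J * (gamma - eta)];
    Chebyshev's inequality with [second_moment_of_blocks] bounds the outer measure of this event. *)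
Lemma lil_blocks_miss (n sigma : nat -> nat) (B : list nat) (eps gamma eta e h : R)
    (R0 g m Theta J : nat) :
  (forall k, (0 < n k)%nat) -> (forall i j, sigma i = sigma j -> i = j) ->
  (1 <= m)%nat -> hits n (2 * m) B -> (2 <= Theta)%nat -> (1 <= J)%nat ->
  tpoly 1 (lil_freq R0 g) (lil_test eps R0 g) gamma -> 0 <= gamma <= 1 -> eta < gamma ->
  0 < h -> (forall j, (J <= j < 2 * J)%nat -> h <= INR (length (good sigma B (lil_block Theta j)))) ->
  cf_error m (lil_freq R0 g ^ 2 / 2) (lil_freq R0 g ^ 4 / (16 * h)) <= e ->
  mle (fun x => 0 <= x <= 1 /\ forall j, (J <= j < 2 * J)%nat ->
         lil_test eps R0 g (wnorm (fun k => n (sigma k)) (good sigma B (lil_block Theta j)) x) <= eta)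
      ((INR J * gamma + 3 * e * INR J ^ 2) / (INR J * (gamma - eta)) ^ 2).
Proof.
  intros npos Hinj Hm HB HT HJ Hpoly Hg Heta Hh Hlen Herr.
  set (nu := fun k => n (sigma k)). set (K := fun j => good sigma B (lil_block Theta j)).
  set (F := fun j x => lil_test eps R0 g (wnorm nu (K j) x)).
  set (js := seq J J). set (D := INR J * (gamma - eta)).
  assert (HJ' : 1 <= INR J) by (change 1 with (INR 1); now apply le_INR).
  assert (HD : 0 < D) by (apply Rmult_lt_0_compat; lra).
  assert (HD2 : 0 < / D ^ 2) by (apply Rinv_0_lt_compat, pow_lt, HD).
  assert (He : 0 <= e).
  { eapply Rle_trans; [|exact Herr]. apply cf_error_nonneg.
    - generalize (pow2_ge_0 (lil_freq R0 g)); lra.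
    - apply Rdiv_le_0_compat; [apply (pow_even_nonneg _ 2)|lra]. }
  (* One hitting set and one grid serve all blocks, since they all lie below [Theta ^ (2 * J)]. *)
  destruct (adm_off n sigma (2 * m) B (good sigma B (seq 0 (Theta ^ (2 * J)))) npos Hinj ltac:(lia) HB)
    as [M [Q0 HQ0]].
  { apply NoDup_filter, seq_NoDup. }
  { intros k Hk. now apply good_not_bad in Hk. }
  fold nu in HQ0. apply mle_limit. intros delta Hd.
  set (G := fun x => / D ^ 2 * (lsum (fun j => F j x - gamma) js) ^ 2).
  destruct (mle_avg (fun x => 0 <= x <= 1 /\ forall j, (J <= j < 2 * J)%nat -> F j x <= eta) G delta)
    as [Q1 HQ1].
  - intros x. apply continuity_pt_scal.
    apply (continuity_pt_comp (fun x => lsum (fun j => F j x - gamma) js) (fun y => y ^ 2)).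
    + apply (lsum_continuity_pt (fun j x => F j x - gamma)). intros j _.
      apply continuity_pt_minus; [|apply continuity_pt_const; intros ? ?; reflexivity].
      apply (continuity_tpoly_comp 1 (lil_freq R0 g) (lil_test eps R0 g) gamma (wnorm nu (K j)) Hpoly).
      intros y. apply (continuity_pt_mult (bsum nu (K j)) (fun _ => / sqrt (INR (length (K j))))).
      * apply continuity_bsum.
      * apply continuity_pt_const; intros ? ?; reflexivity.
    + apply derivable_continuous_pt, derivable_pt_pow.
  - intros x. unfold G. apply Rmult_le_pos; [lra|apply pow2_ge_0].
  - intros x [Hx HF]. split; [assumption|]. unfold G.
    apply (Rmult_le_reg_l (D ^ 2)); [apply pow_lt, HD|].
    rewrite <- Rmult_assoc, Rinv_r, Rmult_1_l, Rmult_1_r by (apply Rgt_not_eq, pow_lt, HD).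
    assert (Hs : lsum (fun j => F j x - gamma) js <= - D).
    { apply Rle_trans with (lsum (fun _ => eta - gamma) js).
      - apply lsum_le. intros j Hj. apply in_seq in Hj. specialize (HF j ltac:(lia)). lra.
      - rewrite lsum_const. unfold js. rewrite length_seq. unfold D. lra. }
    nra.
  - assumption.
  - set (Q := S (Nat.max Q0 Q1)). specialize (HQ0 Q ltac:(lia)). specialize (HQ1 Q ltac:(lia)).
    eapply mle_mono; [| |exact HQ1]; [intros x H; exact H|]. apply Rplus_le_compat_r.
    unfold G. rewrite avg_scal. unfold Rdiv. rewrite Rmult_comm.
    apply Rmult_le_compat_r; [lra|].
    assert (Hsub : forall j, (J <= j < 2 * J)%nat ->
              incl (K j) (good sigma B (seq 0 (Theta ^ (2 * J))))).
    { intros j Hj k Hk. apply filter_In in Hk. apply filter_In. destruct Hk as [Hk1 Hk2].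
      split; [|assumption]. apply in_seq in Hk1. apply in_seq.
      assert (Theta ^ (j - 1) <= Theta ^ j)%nat by (apply Nat.pow_le_mono_r; lia).
      assert (Theta ^ j <= Theta ^ (2 * J))%nat by (apply Nat.pow_le_mono_r; lia). lia. }
    assert (Hnd : forall j, NoDup (K j)) by (intros; apply NoDup_filter, seq_NoDup).
    replace (INR J) with (INR (length js)) by (unfold js; now rewrite length_seq).
    apply second_moment_of_blocks; try assumption.
    + lia.
    + apply seq_NoDup.
    + intros j x. apply lil_test_bounds.
    + intros j Hj. apply in_seq in Hj. specialize (Hlen j ltac:(lia)). fold (K j) in Hlen.
      assert (Hadm : adm nu (2 * m) M Q (blk 1 (K j)))
        by (apply (adm_sub _ _ _ _ _ _ HQ0); [apply Hnd|apply Hsub; lia]).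
      eapply Rle_trans; [apply (tpoly_block nu (2 * m) M Q (K j) m 1 (lil_freq R0 g)); try eassumption; try lia|].
      { apply INR_lt. simpl INR. lra. }
      rewrite Rmult_1_l. eapply Rle_trans; [|exact Herr].
      assert (HT2 := pow2_ge_0 (lil_freq R0 g)).
      assert (HT4 : 0 <= lil_freq R0 g ^ 4) by apply (pow_even_nonneg _ 2).
      apply cf_error_mono; [lra|]. split.
      * apply Rdiv_le_0_compat; [assumption|lra].
      * unfold Rdiv. apply Rmult_le_compat_l; [assumption|]. apply Rinv_le_contravar; lra.
    + intros i j Hi Hj Hne. apply in_seq in Hi, Hj.
      assert (Hli := Hlen i ltac:(lia)). assert (Hlj := Hlen j ltac:(lia)).
      fold (K i) in Hli. fold (K j) in Hlj.
      assert (Hadm : adm nu (2 * m) M Q (blk 1 (K i ++ K j))).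
      { apply (adm_sub _ _ _ _ _ _ HQ0).
        - apply NoDup_app; [apply Hnd|apply Hnd|]. intros k Hk Hk'.
          apply filter_In in Hk, Hk'.
          apply (lil_blocks_disjoint Theta i j k HT ltac:(lia) ltac:(lia) Hne); tauto.
        - apply incl_app; apply Hsub; lia. }
      eapply Rle_trans; [apply (tpoly_two_blocks nu (2 * m) M Q (K i) (K j) m h 1 (lil_freq R0 g)); try eassumption; lia|].
      rewrite Rmult_1_l, Rmult_1_l. exact Herr.
Qed.

(** On this window the argument of the cosine has absolute value between [eps / 8] and 3/2, where
    cosine decreases and stays nonnegative. *)
Lemma lil_test_outside (eps w : R) (R0 g : nat) :
  0 < eps <= 1 / 10 -> (1 <= g)%nat -> -10 * sqrt (INR g) <= w <= (1 - 2 * eps) * sqrt (INR g) ->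
  lil_test eps R0 g w <= cos (eps / 8) ^ (2 * (R0 * g)).
Proof.
  intros Heps Hg Hw. assert (Hr : 0 < sqrt (INR g)) by (apply sqrt_lt_R0, lt_0_INR; lia).
  unfold lil_test. set (r := sqrt (INR g)) in *.
  set (u := (1 - eps) / 8 - / (8 * r) * w).
  replace (cos (/ (8 * r) * w + - ((1 - eps) / 8))) with (cos u)
    by (rewrite <- cos_neg; f_equal; unfold u; ring).
  assert (Hwr : -10 <= w / r <= 1 - 2 * eps).
  { split; [apply Rle_div_r; lra|apply Rle_div_l; lra]. }
  assert (Hu : u = (1 - eps) / 8 - w / r / 8) by (unfold u; field; lra).
  assert (HP := PI2_3_2).
  assert (Hub : eps / 8 <= u <= 3 / 2) by (rewrite Hu; lra).
  apply pow_incr. split.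
  - apply cos_ge_0; lra.
  - apply cos_decr_1; lra.
Qed.

(** [Y] is an unnormalized block sum and [h] the number of retained indices. Since [sqrt h] is at
    least [(1 - 2 * eps) * sqrt N], the passage to [wnorm] turns [1 - 7 * eps] into [1 - 2 * eps],
    and -5 into -10 with room to spare. *)
Lemma lil_window (eps N g h Y : R) :
  0 < eps <= 1 / 10 -> 0 < N -> 0 <= g -> (1 - 2 * eps) * N <= h ->
  -5 * sqrt (N * g) <= Y <= (1 - 7 * eps) * sqrt (N * g) ->
  -10 * sqrt g <= Y / sqrt h <= (1 - 2 * eps) * sqrt g.
Proof.
  intros Heps HN Hg Hh HY. rewrite sqrt_mult in HY by lra.
  assert (HsN : 0 < sqrt N) by now apply sqrt_lt_R0.
  assert (Hsg : 0 <= sqrt g) by apply sqrt_pos.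
  assert (Hsh : (1 - 2 * eps) * sqrt N <= sqrt h).
  { rewrite <- (sqrt_pow2 (1 - 2 * eps)) by lra. rewrite <- sqrt_mult_alt by apply pow2_ge_0.
    apply sqrt_le_1_alt. eapply Rle_trans; [|exact Hh]. apply Rmult_le_compat_r; [lra|simpl; nra]. }
  assert (Hp : 0 < sqrt h) by nra.
  assert (Hsg2 : (1 - 2 * eps) * sqrt N * sqrt g <= sqrt h * sqrt g) by (apply Rmult_le_compat_r; assumption).
  set (a := sqrt N * sqrt g) in *.
  assert (Ha : 0 <= a) by (apply Rmult_le_pos; lra).
  replace ((1 - 2 * eps) * sqrt N * sqrt g) with ((1 - 2 * eps) * a) in Hsg2 by (unfold a; ring).
  split.
  - apply (proj1 (Rle_div_r _ _ _ Hp)). nra.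
  - apply (proj2 (Rle_div_l _ _ _ Hp)).
    assert ((1 - 7 * eps) * a <= (1 - 2 * eps) * ((1 - 2 * eps) * a)) by nra. nra.
Qed.

(** First index and number of the blocks, about [exp g], so that the iterated logarithm of
    [Theta ^ j] is about [g] for the blocks considered. *)
Definition lil_start (g : nat) : nat := Z.to_nat (up (exp (INR g))).

Lemma lil_start_bounds (g : nat) : exp (INR g) <= INR (lil_start g) <= 2 * exp (INR g).
Proof.
  unfold lil_start. destruct (archimed (exp (INR g))) as [H1 H2].
  assert (He : 1 <= exp (INR g)) by (rewrite <- exp_0; apply exp_le_compat, pos_INR).
  assert (Hz : (0 <= up (exp (INR g)))%Z) by (apply le_IZR; lra).
  rewrite (INR_IZR_INZ (Z.to_nat _)), Z2Nat.id by assumption. lra.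
Qed.

(** The iterated logarithm exceeds [g] by at most [ln (4 * ln Theta)], which is negligible for large
    [g]. *)
Lemma lil_scale (eps : R) (Theta : nat) : 0 < eps -> (3 <= Theta)%nat ->
  exists g0, forall g j, (g0 <= g)%nat -> (lil_start g <= j < 2 * lil_start g)%nat ->
    exp (exp (INR g)) <= INR (Theta ^ j) /\
    INR g <= ln (ln (INR (Theta ^ j))) <= (1 + eps) ^ 2 * INR g.
Proof.
  intros Heps HT. assert (HT3 : 3 <= INR Theta) by (replace 3 with (INR 3) by (simpl; ring); now apply le_INR).
  assert (HlT : 1 <= ln (INR Theta)).
  { rewrite <- (ln_exp 1). apply ln_le; [apply exp_pos|]. generalize exp_le_3; lra. }
  set (C := ln (4 * ln (INR Theta))).
  destruct (INR_unbounded (C / eps)) as [g0 Hg0]. exists g0. intros g j Hg Hj.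
  assert (HgC : C <= eps * INR g).
  { apply le_INR in Hg. assert (HC : C / eps <= INR g) by lra. apply Rle_div_l in HC; lra. }
  destruct (lil_start_bounds g) as [H1 H2].
  assert (He := exp_pos (INR g)).
  assert (Hj1 : exp (INR g) <= INR j) by (eapply Rle_trans; [exact H1|apply le_INR; lia]).
  assert (Hj2 : INR j <= 4 * exp (INR g)).
  { apply Rle_trans with (INR (2 * lil_start g)); [apply le_INR; lia|].
    rewrite mult_INR. change (INR 2) with 2. lra. }
  assert (HlnN : ln (INR (Theta ^ j)) = INR j * ln (INR Theta)) by (rewrite pow_INR; apply ln_pow; lra).
  assert (HNpos : 0 < INR (Theta ^ j)) by (rewrite pow_INR; apply pow_lt; lra).
  split.
  - rewrite <- (exp_ln (INR (Theta ^ j))) by assumption. apply exp_le_compat. rewrite HlnN. nra.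
  - rewrite HlnN. split.
    + rewrite <- (ln_exp (INR g)) at 1. apply ln_le; [assumption|nra].
    + apply Rle_trans with (ln (exp (INR g) * (4 * ln (INR Theta)))).
      * apply ln_le; [apply Rmult_lt_0_compat; lra|]. nra.
      * rewrite ln_mult, ln_exp by lra. fold C. assert (Hg0' := pos_INR g). simpl. nra.
Qed.

(** The two-sided bound is supplied by the upper half of the law. It controls the initial segment
    preceding a block, and it keeps the normalized block sums above [-10 * sqrt g], where the test
    function has no other peak. *)
Definition lil_trapped (n sigma : nat -> nat) (delta : R) (N0 : nat) (x : R) : Prop :=
  0 <= x <= 1 /\ forall N, (N0 <= N)%nat ->
    Rabs (trig_sum n sigma N x) <= 2 * sqrt (INR N * ln (ln (INR N))) /\
    trig_sum n sigma N x <= (1 - delta) * sqrt (INR N * ln (ln (INR N))).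

Lemma lil_block_split (n sigma : nat -> nat) (Theta j : nat) (x : R) : (1 <= Theta)%nat ->
  trig_sum n sigma (Theta ^ j) x = trig_sum n sigma (Theta ^ (j - 1)) x +
    bsum (fun k => n (sigma k)) (lil_block Theta j) x.
Proof.
  intros HT. rewrite !bsum_seq. unfold lil_block.
  assert (H : (Theta ^ (j - 1) <= Theta ^ j)%nat) by (apply Nat.pow_le_mono_r; lia).
  replace (Theta ^ j)%nat with (Theta ^ (j - 1) + (Theta ^ j - Theta ^ (j - 1)))%nat at 1 by lia.
  rewrite seq_app. unfold bsum. rewrite lsum_app. reflexivity.
Qed.

(* [b] is the number of deleted indices, [S'] the sum up to [N / Theta]. *)
Lemma trapped_block_sum (eps g LL LL' N N' S S' Y b : R) :
  0 < eps <= 1 / 10 -> 1 <= g -> 1 <= N -> 0 <= LL <= (1 + eps) ^ 2 * g -> LL' <= LL ->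
  0 <= N' <= N * (eps ^ 2 / 16) ->
  Rabs S <= 2 * sqrt (N * LL) -> S <= (1 - 10 * eps) * sqrt (N * LL) ->
  Rabs S' <= 2 * sqrt (N' * LL') -> Rabs (S - S' - Y) <= b -> b <= eps * sqrt N ->
  -5 * sqrt (N * g) <= Y <= (1 - 7 * eps) * sqrt (N * g).
Proof.
  intros He Hg HN HLL HLL' HN' HS1 HS2 HS' HY Hb. set (Z := sqrt (N * g)).
  assert (HZ : 0 <= Z) by apply sqrt_pos.
  assert (HNZ : sqrt N <= Z) by (apply sqrt_le_1_alt; nra).
  assert (HZL : sqrt (N * LL) <= (1 + eps) * Z).
  { unfold Z. rewrite <- (sqrt_pow2 (1 + eps)) by lra. rewrite <- sqrt_mult_alt by apply pow2_ge_0.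
    apply sqrt_le_1_alt. nra. }
  assert (HZ' : sqrt (N' * LL') <= eps / 2 * Z).
  { unfold Z. rewrite <- (sqrt_pow2 (eps / 2)) by lra. rewrite <- sqrt_mult_alt by apply pow2_ge_0.
    apply sqrt_le_1_alt. apply Rle_trans with (N' * LL); [apply Rmult_le_compat_l; lra|].
    apply Rle_trans with (N * (eps ^ 2 / 16) * ((1 + eps) ^ 2 * g)).
    - apply Rmult_le_compat; lra.
    - replace ((eps / 2) ^ 2 * (N * g)) with (N * (eps ^ 2 / 16) * (4 * g)) by field.
      apply Rmult_le_compat_l.
      + apply Rmult_le_pos; [lra|]. generalize (pow2_ge_0 eps); lra.
      + apply Rmult_le_compat_r; [lra|simpl; nra]. }
  assert (Hs0 := sqrt_pos (N * LL)).
  apply Rabs_le_between in HS1, HS', HY. split; [nra|].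
  assert ((1 - 10 * eps) * sqrt (N * LL) <= (1 - 9 * eps) * Z); [|nra].
  destruct (Rle_lt_dec 0 (1 - 10 * eps)) as [Hd|Hd]; [|lra].
  apply Rle_trans with ((1 - 10 * eps) * ((1 + eps) * Z)); [apply Rmult_le_compat_l; lra|nra].
Qed.

(** For a trapped point every block sum avoids the peak, so every test value is at most [eta], at
    most half the mean [gamma]. Such points are rare because [J * gamma] is at least of order
    [exp (eps * g)]. *)
Lemma lil_trapped_measure (n sigma : nat -> nat) (eps : R) :
  (forall k, (0 < n k)%nat) -> condRstar n -> (forall i j, sigma i = sigma j -> i = j) ->
  0 < eps <= 1 / 10 ->
  exists Theta C g0, (2 <= Theta)%nat /\ forall g, (g0 <= g)%nat ->
    mle (lil_trapped n sigma (10 * eps) (Theta ^ (lil_start g - 1))) (C * exp (- (eps * INR g))).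
Proof.
  intros npos hR Hinj Heps.
  (* With this [Theta] the sum up to [Theta ^ (j - 1)] is at most [eps * sqrt (N * g)] on the
     trapped set, where [N = Theta ^ j]. *)
  destruct (INR_unbounded (16 / eps ^ 2)) as [T0 HT0]. set (Theta := (T0 + 3)%nat).
  assert (He2 : 0 < eps ^ 2) by (apply pow_lt; lra).
  assert (HTh : 16 / eps ^ 2 <= INR Theta)
    by (unfold Theta; rewrite plus_INR; generalize (pos_INR 3); lra).
  assert (HTh3 : 3 <= INR Theta)
    by (replace 3 with (INR 3) by (simpl; ring); apply le_INR; unfold Theta; lia).
  set (x0 := cos (eps / 8) ^ 2).
  assert (HP := PI2_3_2).
  assert (Hx0 : 0 <= x0 < 1).
  { split; [apply pow2_ge_0|]. assert (H := sin2_cos2 (eps / 8)). unfold Rsqr in H.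
    assert (Hsin : 0 < sin (eps / 8)) by (apply sin_gt_0; lra). unfold x0. nra. }
  (* [R0] makes the test function off the peak at most [exp (- (2 * g))], against a mean of at least
     [c1 * exp (- g)]. *)
  destruct (pow_small x0 (exp (-2)) Hx0 (exp_pos _)) as [R1 HR1].
  set (R0 := Nat.max R1 1). specialize (HR1 R0 (Nat.le_max_l _ _)).
  assert (HR0 : (1 <= R0)%nat) by apply Nat.le_max_r.
  destruct (lil_test_mean eps R0 Heps HR0) as [c1 [Hc1 Hmean]].
  destruct (lil_error_small R0) as [m0 [g1 [Hm0 [Hg1 Herr]]]].
  destruct (condRstar_hitting n hR) as [C0 [kappa [HC0 Hhit]]].
  destruct (lil_scale eps Theta ltac:(lra) ltac:(unfold Theta; lia)) as [g2 Hscale].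
  destruct (double_exp_dominates (C0 * (2 * INR m0) ^ kappa) (/ eps) kappa) as [g3 Hg3];
    [apply Rinv_0_lt_compat; lra|].
  destruct (INR_unbounded (- ln (c1 / 2))) as [g4 Hg4].
  exists Theta, (4 / c1 + 48 / c1 ^ 2), (g1 + g2 + g3 + g4 + 4)%nat.
  split; [unfold Theta; lia|]. intros g Hg.
  set (G := INR g). assert (HG : 4 <= G) by (unfold G; replace 4 with (INR 4) by (simpl; ring); apply le_INR; lia).
  set (J := lil_start g). assert (HJ := lil_start_bounds g). fold J G in HJ.
  assert (HeG : 2 <= exp G) by (generalize (exp_ineq1_le G); lra).
  assert (HJ2 : (2 <= J)%nat) by (apply INR_le; simpl INR; lra).
  destruct (lil_test_tpoly eps R0 g ltac:(lia)) as [gamma Hpoly].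
  assert (Hgam := Hmean g gamma ltac:(lia) Hpoly). fold G in Hgam.
  set (eta := cos (eps / 8) ^ (2 * (R0 * g))).
  assert (Heta : eta <= exp (- (2 * G))).
  { unfold eta. rewrite !pow_mult. fold x0.
    apply Rle_trans with (exp (-2) ^ g).
    - apply pow_incr. split; [apply pow_le; lra|exact HR1].
    - rewrite <- exp_mult_INR. fold G. apply exp_le_compat. lra. }
  assert (Hg1' : c1 * exp (- G) <= gamma).
  { eapply Rle_trans; [|apply Hgam]. apply Rmult_le_compat_l; [lra|]. apply exp_le_compat.
    assert ((1 - eps) ^ 2 <= 1) by (simpl; nra). nra. }
  assert (Heta2 : eta <= gamma / 2).
  { apply Rle_trans with (c1 / 2 * exp (- G)); [|lra].
    eapply Rle_trans; [exact Heta|]. replace (- (2 * G)) with (- G + - G) by ring. rewrite exp_plus.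
    apply Rmult_le_compat_r; [left; apply exp_pos|].
    rewrite <- (exp_ln (c1 / 2)) by lra. apply exp_le_compat.
    assert (INR g4 <= G) by (apply le_INR; lia). lra. }
  assert (Hgpos : 0 < gamma).
  { eapply Rlt_le_trans; [|exact Hg1']. apply Rmult_lt_0_compat; [assumption|apply exp_pos]. }
  set (m := (m0 * g)%nat). assert (Hm : (1 <= m)%nat) by (unfold m; nia).
  destruct (Hhit (2 * m)%nat ltac:(lia)) as [B [HB HBl]].
  (* A lower bound for the number of retained indices in a block which still dominates the number of
     deleted ones; [h ^ 2] is at most [Theta ^ j]. *)
  set (h := exp (exp G / 2)).
  assert (Hb : INR (length B) <= eps * h).
  { specialize (Hg3 g ltac:(lia)). fold G in Hg3. fold h in Hg3.
    eapply Rle_trans; [exact HBl|].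
    replace (C0 * INR (2 * m) ^ kappa) with (C0 * (2 * INR m0) ^ kappa * G ^ kappa).
    - apply (Rmult_le_compat_l eps) in Hg3; [|lra]. rewrite <- Rmult_assoc, Rinv_r, Rmult_1_l in Hg3; lra.
    - unfold m. rewrite !mult_INR. fold G. change (INR 2) with 2.
      rewrite Rmult_assoc, <- Rpow_mult_distr. do 2 f_equal. ring. }
  assert (Hh2 : 2 <= h) by (unfold h; generalize (exp_ineq1_le (exp G / 2)); lra).
  assert (Hscale' : forall j, (J <= j < 2 * J)%nat ->
     h ^ 2 <= INR (Theta ^ j) /\ h <= sqrt (INR (Theta ^ j)) /\
     INR (Theta ^ (j - 1)) <= INR (Theta ^ j) * (eps ^ 2 / 16) /\
     (1 - 2 * eps) * INR (Theta ^ j) <= INR (length (good sigma B (lil_block Theta j))) /\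
     h <= INR (length (good sigma B (lil_block Theta j)))).
  { intros j Hj. destruct (Hscale g j ltac:(lia) Hj) as [H1 _]. fold G in H1.
    set (N := INR (Theta ^ j)) in *.
    assert (Hh : h ^ 2 = exp (exp G)).
    { unfold h. replace (exp G) with (exp G / 2 * INR 2) at 2 by (simpl; field). now rewrite exp_mult_INR. }
    assert (HhN : h ^ 2 <= N) by lra.
    assert (Hsq : h <= sqrt N) by (rewrite <- (sqrt_pow2 h) by lra; now apply sqrt_le_1_alt).
    assert (HNT : N = INR Theta * INR (Theta ^ (j - 1))).
    { unfold N. rewrite <- mult_INR, <- Nat.pow_succ_r'. do 2 f_equal. lia. }
    assert (HN' : INR (Theta ^ (j - 1)) <= N * (eps ^ 2 / 16)).
    { rewrite HNT. assert (H0 := pos_INR (Theta ^ (j - 1))).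
      apply (Rmult_le_compat_r (eps ^ 2 / 16)) in HTh; [|lra].
      replace (16 / eps ^ 2 * (eps ^ 2 / 16)) with 1 in HTh by (field; lra). nra. }
    assert (Hlen : (1 - 2 * eps) * N <= INR (length (good sigma B (lil_block Theta j)))).
    { destruct (length_good sigma B (lil_block Theta j) Hinj (NoDup_lil_block _ _)) as [H2 _].
      unfold lil_block in H2 at 1. rewrite length_seq, minus_INR in H2
        by (apply Nat.pow_le_mono_r; unfold Theta; lia).
      fold N in H2. assert (eps * h <= eps * N) by (apply Rmult_le_compat_l; nra).
      assert (eps ^ 2 / 16 <= eps) by (simpl; nra). nra. }
    repeat split; try assumption. nra. }
  assert (Hmle := lil_blocks_miss n sigma B eps gamma eta (4 * exp (- (9 * G))) h R0 g m Theta J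
     npos Hinj Hm HB ltac:(unfold Theta; lia) ltac:(lia) Hpoly ltac:(lra) ltac:(lra) ltac:(lra)
     (fun j Hj => proj2 (proj2 (proj2 (proj2 (Hscale' j Hj)))))
     (Herr g h ltac:(lia) (Rle_refl _))).
  eapply mle_mono; [| |exact Hmle].
  - intros x [Hx Htr]. split; [assumption|]. intros j Hj.
    destruct (Hscale' j Hj) as [A1 [A2 [A3 [A4 _]]]].
    destruct (Hscale g j ltac:(lia) Hj) as [_ HLL]. fold G in HLL.
    assert (Hpow1 : (Theta ^ (J - 1) <= Theta ^ (j - 1))%nat) by (apply Nat.pow_le_mono_r; unfold Theta; lia).
    assert (Hpow2 : (Theta ^ (j - 1) <= Theta ^ j)%nat) by (apply Nat.pow_le_mono_r; unfold Theta; lia).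
    destruct (Htr (Theta ^ j)%nat ltac:(lia)) as [S1 S2].
    destruct (Htr (Theta ^ (j - 1))%nat Hpow1) as [S3 _].
    assert (HLL' : ln (ln (INR (Theta ^ (j - 1)))) <= ln (ln (INR (Theta ^ j)))).
    { assert (Hl1 : 1 < INR (Theta ^ (j - 1))).
      { rewrite pow_INR. apply Rlt_pow_R1; [lra|lia]. }
      apply ln_le.
      - rewrite <- ln_1. apply ln_increasing; lra.
      - apply ln_le; [lra|now apply le_INR]. }
    assert (Hgood := bsum_good (fun k => n (sigma k)) sigma B (lil_block Theta j) x Hinj (NoDup_lil_block _ _)).
    assert (Hsplit := lil_block_split n sigma Theta j x ltac:(unfold Theta; lia)).
    set (ks := good sigma B (lil_block Theta j)) in *.
    set (N := INR (Theta ^ j)) in *. set (S := trig_sum n sigma (Theta ^ j) x) in *.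
    set (S' := trig_sum n sigma (Theta ^ (j - 1)) x) in *.
    assert (HN1 : 1 <= N) by nra.
    apply lil_test_outside; [assumption|lia|]. fold G. unfold wnorm.
    apply (lil_window eps N); [assumption|lra|lra|exact A4|].
    apply (trapped_block_sum eps G (ln (ln N)) (ln (ln (INR (Theta ^ (j - 1))))) N
             (INR (Theta ^ (j - 1))) S S' _ (INR (length B))); try assumption; try lra.
    + split; [apply pos_INR|assumption].
    + replace (S - S') with (bsum (fun k => n (sigma k)) (lil_block Theta j) x) by lra. exact Hgood.
    + eapply Rle_trans; [exact Hb|]. apply Rmult_le_compat_l; lra.
  - set (e := 4 * exp (- (9 * G))). set (j := INR J) in *.
    assert (Hj : exp G <= j) by apply HJ.
    assert (Hjpos : 0 < j) by lra.
    assert (He0 : 0 < e) by (unfold e; generalize (exp_pos (- (9 * G))); lra).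
    (* As [eta] is at most [gamma / 2], the Chebyshev bound becomes
       [4 / (J * gamma) + 12 * e / gamma ^ 2]. *)
    apply Rle_trans with ((j * gamma + 3 * e * j ^ 2) / (j * (gamma / 2)) ^ 2).
    { unfold Rdiv. apply Rmult_le_compat_l.
      - apply Rplus_le_le_0_compat; [nra|]. apply Rmult_le_pos; [lra|apply pow2_ge_0].
      - apply Rinv_le_contravar.
        + apply pow_lt, Rmult_lt_0_compat; lra.
        + apply pow_incr. split; [apply Rmult_le_pos; lra|]. apply Rmult_le_compat_l; lra. }
    replace ((j * gamma + 3 * e * j ^ 2) / (j * (gamma / 2)) ^ 2)
      with (4 / (j * gamma) + 12 * e / gamma ^ 2) by (field; lra).
    rewrite Rmult_plus_distr_r. apply Rplus_le_compat.
    (* [J] is at least [exp G] and [gamma] at least [c1 * exp (- ((1 - eps) ^ 2 * G))]; the surplus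
       exponent [2 * eps - eps ^ 2] is at least [eps]. *)
    + assert (Hjg : c1 * exp (eps * G) <= j * gamma).
      { apply Rle_trans with (exp G * (c1 * exp (- ((1 - eps) ^ 2 * G)))).
        - replace (exp G * (c1 * exp (- ((1 - eps) ^ 2 * G))))
            with (c1 * exp (G + - ((1 - eps) ^ 2 * G))) by (rewrite exp_plus; ring).
          apply Rmult_le_compat_l; [lra|]. apply exp_le_compat.
          replace (G + - ((1 - eps) ^ 2 * G)) with ((2 * eps - eps ^ 2) * G) by ring.
          apply Rmult_le_compat_r; nra.
        - apply Rmult_le_compat; try lra.
          apply Rmult_le_pos; [lra|left; apply exp_pos]. }
      assert (Hp := exp_pos (eps * G)). rewrite exp_Ropp.
      replace (4 / c1 * / exp (eps * G)) with (4 * / (c1 * exp (eps * G))) by (field; lra).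
      unfold Rdiv. apply Rmult_le_compat_l; [lra|]. apply Rinv_le_contravar; [nra|exact Hjg].
    + assert (Hg2 : (c1 * exp (- G)) ^ 2 <= gamma ^ 2).
      { apply pow_incr. split; [apply Rmult_le_pos; [lra|left; apply exp_pos]|assumption]. }
      assert (Hcp : 0 < (c1 * exp (- G)) ^ 2).
      { apply pow_lt, Rmult_lt_0_compat; [lra|apply exp_pos]. }
      apply Rle_trans with (12 * e / (c1 * exp (- G)) ^ 2).
      * unfold Rdiv. apply Rmult_le_compat_l; [lra|]. now apply Rinv_le_contravar.
      * unfold e. replace (- (9 * G)) with ((- G + - G) + - (7 * G)) by ring. rewrite !exp_plus.
        assert (HpG := exp_pos (- G)).
        replace (12 * (4 * (exp (- G) * exp (- G) * exp (- (7 * G)))) / (c1 * exp (- G)) ^ 2)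
          with (48 / c1 ^ 2 * exp (- (7 * G))) by (field; lra).
        apply Rmult_le_compat_l; [apply Rdiv_le_0_compat; [lra|apply pow_lt; lra]|].
        apply exp_le_compat. nra.
Qed.

(** For fixed [N0] the trapped set lies in those of [lil_trapped_measure] for all large [g], whose
    outer measure tends to 0. It is therefore null, and so is the union over [N0]; the points that
    violate the two-sided bound are null by the upper half. *)
Theorem lil_lower (n sigma : nat -> nat) (delta : R) :
  (forall k, (0 < n k)%nat) -> condRstar n -> (forall i j, sigma i = sigma j -> i = j) ->
  0 < delta <= 1 ->
  null_set (fun x => 0 <= x <= 1 /\ exists N0, forall N, (N0 <= N)%nat ->
              trig_sum n sigma N x <= (1 - delta) * sqrt (INR N * ln (ln (INR N)))).
Proof.
  intros npos hR Hinj Hd. set (eps := delta / 10).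
  assert (Heps : 0 < eps <= 1 / 10) by (unfold eps; lra).
  destruct (lil_trapped_measure n sigma eps npos hR Hinj Heps) as [Theta [C [g0 [HT Hm]]]].
  replace (10 * eps) with delta in Hm by (unfold eps; field).
  assert (Htrap : forall N0, null_set (lil_trapped n sigma delta N0)).
  { intros N0. apply null_set_mle, mle_limit. intros d Hdp. rewrite Rplus_0_l.
    set (D := Rabs C + 1). assert (HD : 0 < D) by (unfold D; generalize (Rabs_pos C); lra).
    destruct (INR_unbounded (- ln (d / D) / eps)) as [g1 Hg1].
    set (g := (g0 + g1 + N0)%nat). specialize (Hm g ltac:(unfold g; lia)).
    eapply mle_mono; [| |exact Hm].
    - intros x [Hx Hb]. split; [assumption|]. intros N HN. apply Hb.
      destruct (lil_start_bounds g) as [H1 _]. assert (H2 := le_exp (INR g)).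
      assert (Hgs : (g <= lil_start g)%nat) by (apply INR_le; lra).
      assert (Hlin := Nat.pow_gt_lin_r Theta (lil_start g - 1) ltac:(lia)). lia.
    - assert (HgG : INR g1 <= INR g) by (apply le_INR; lia).
      assert (Hex : exp (- (eps * INR g)) <= d / D).
      { assert (HdD : 0 < d / D) by (apply Rdiv_lt_0_compat; lra).
        rewrite <- (exp_ln (d / D)) by assumption. apply exp_le_compat.
        assert (H : - ln (d / D) / eps <= INR g) by lra. apply Rle_div_l in H; lra. }
      apply Rle_trans with (D * exp (- (eps * INR g))).
      + apply Rmult_le_compat_r; [left; apply exp_pos|]. unfold D. generalize (Rle_abs C). lra.
      + apply Rle_trans with (D * (d / D)); [apply Rmult_le_compat_l; lra|right; field; lra]. }
  apply (null_set_mono (fun x => (0 <= x <= 1 /\ ~ lil_bounded n sigma (1 + 1) x) \/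
                                 exists N0, lil_trapped n sigma delta N0 x)).
  - intros x [Hx [N0 HN0]]. destruct (classic (lil_bounded n sigma (1 + 1) x)) as [[N1 HN1]|Hb].
    + right. exists (Nat.max N0 N1). split; [assumption|]. intros N HN. split.
      * replace 2 with (1 + 1) by ring. apply HN1. lia.
      * apply HN0. lia.
    + left. split; assumption.
  - apply null_set_or; [apply lil_upper; try assumption; lra|].
    now apply null_set_countable_union.
Qed.

(** * Combination of the two halves *)

Lemma iterated_log_pos (N : nat) : (16 <= N)%nat -> 0 < sqrt (INR N * ln (ln (INR N))).
Proof.
  intros HN. assert (H16 : 16 <= INR N) by (replace 16 with (INR 16) by (simpl; ring); now apply le_INR).
  apply sqrt_lt_R0, Rmult_lt_0_compat; [lra|].
  assert (H3 := exp_le_3). assert (He := exp_pos 1).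
  assert (Hl : 1 < ln (INR N)) by (rewrite <- (ln_exp 1); apply ln_increasing; lra).
  rewrite <- ln_1. apply ln_increasing; lra.
Qed.

(** It suffices to treat the tolerances [1 / (k + 2)], a countable family tending to 0 and bounded
    by 1 as [lil_lower] requires. *)
Theorem permuted_lil (n sigma : nat -> nat) :
  (forall k, (0 < n k)%nat) -> condRstar n -> (forall i j, sigma i = sigma j -> i = j) ->
  null_set (fun x => 0 <= x <= 1 /\
    ~ limsup_is (fun N => trig_sum n sigma N x / sqrt (INR N * ln (ln (INR N)))) 1).
Proof.
  intros npos hR Hinj.
  set (e := fun k : nat => / INR (S (S k))).
  assert (He : forall k, 0 < e k <= 1).
  { intros k. unfold e. assert (H := pos_INR k). rewrite !S_INR. split.
    - apply Rinv_0_lt_compat; lra.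
    - rewrite <- Rinv_1. apply Rinv_le_contravar; lra. }
  apply (null_set_mono (fun x => exists k,
    (0 <= x <= 1 /\ ~ lil_bounded n sigma (1 + e k) x) \/
    (0 <= x <= 1 /\ exists N0, forall N, (N0 <= N)%nat ->
        trig_sum n sigma N x <= (1 - e k) * sqrt (INR N * ln (ln (INR N)))))).
  - intros x [Hx Hno]. apply NNPP. intros Hnone. apply Hno. intros eps Heps.
    destruct (INR_unbounded (/ eps)) as [k Hk].
    assert (Hek : e k < eps).
    { rewrite <- (Rinv_inv eps). unfold e. apply Rinv_lt_contravar.
      - apply Rmult_lt_0_compat; [now apply Rinv_0_lt_compat|apply lt_0_INR; lia].
      - rewrite !S_INR. lra. }
    split.
    + assert (Hb : lil_bounded n sigma (1 + e k) x).
      { apply NNPP. intros Hb. apply Hnone. exists k. left. split; assumption. }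
      destruct Hb as [N0 HN0]. exists (Nat.max N0 16). intros N HN.
      assert (Hp := iterated_log_pos N ltac:(lia)). specialize (HN0 N ltac:(lia)).
      apply (proj2 (Rlt_div_l _ _ _ Hp)). apply Rabs_le_between in HN0. nra.
    + intros N0. apply NNPP. intros Hlow. apply Hnone. exists k. right. split; [assumption|].
      exists (Nat.max N0 16). intros N HN. assert (Hp := iterated_log_pos N ltac:(lia)).
      destruct (Rle_lt_dec (trig_sum n sigma N x) ((1 - e k) * sqrt (INR N * ln (ln (INR N)))))
        as [H|H]; [assumption|]. exfalso. apply Hlow. exists N. split; [lia|].
      apply (proj1 (Rlt_div_r _ _ _ Hp)). nra.
  - apply null_set_countable_union. intros k. apply null_set_or.
    + apply lil_upper; try assumption. apply He.
    + apply lil_lower; try assumption. apply He.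
Qed.

Theorem theorem3 (n : nat -> nat) (npos : forall k, (0 < n k)%nat) (hR : condR n) :
  (forall sigma : nat -> nat, bijective_nat sigma ->
     forall t p : R, normal_half_cdf_is t p ->
       forall m : nat -> R,
         (forall N : nat,
            lebesgue_outer_is
              (fun x => 0 <= x <= 1 /\
                 trig_sum n sigma (S N) x / sqrt (INR (S N)) <= t) (m N)) ->
         Un_cv m p)
  /\
  (condRstar n ->
     forall sigma : nat -> nat, bijective_nat sigma ->
       null_set (fun x => 0 <= x <= 1 /\
         ~ limsup_is (fun N => trig_sum n sigma N x / sqrt (INR N * ln (ln (INR N)))) 1)).
Proof.
  split.
  - intros sigma [Hinj _] t p Hp m Hm. exact (permuted_clt n sigma t p m npos hR Hinj Hp Hm).
  - intros hRs sigma [Hinj _]. exact (permuted_lil n sigma npos hRs Hinj).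
Qed.
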